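(* Let $R$ be a regular local ring such that the Grothendieck--Serre conjecture holds for $R$ and $\mathbf{SO}_n$. Let $Q_n$ be the split quadratic form over $R$ in $n$ variables. Let $Q=\sum_{i,j}q_{ij}x_ix_j$ be a quadratic form in $n$ variables with coefficients in $R$ such that its discriminant is invertible in $R$ if $n$ is even, and its half-discriminant is invertible in $R$ if $n$ is odd. Assume that there is a linear transformation with coefficients in the fraction field of $R$ taking $Q$ to $Q_n$. Then there is a linear transformation with coefficients in $R$ taking $Q$ to $Q_n$.
   Context: The element $2$ is not assumed to be invertible in $R$. The split quadratic form is $Q_n=x_1x_{m+1}+\dots+x_mx_{2m}$ if $n=2m$, and $Q_n=x_1x_{m+1}+\dots+x_mx_{2m}+x_{2m+1}^2$ if $n=2m+1$. $\mathbf{SO}_n$ denotes the split special orthogonal group scheme over $R$ associated to $Q_n$: if $\mathbf{O}_n$ is the $R$-group scheme of linear transformations preserving $Q_n$, then for $n$ odd $\mathbf{SO}_n$ is the kernel of the determinant on $\mathbf{O}_n$, and for $n$ even $\mathbf{SO}_n$ is the kernel of the Dickson homomorphism $\mathbf{O}_n\to\mathbb{Z}/2\mathbb{Z}$ (given by the action on the center of the even Clifford algebra of $Q_n$). It is a split reductive group scheme. The Grothendieck--Serre conjecture holds for $R$ and a reductive $R$-group scheme $\mathbf{G}$ if every principal $\mathbf{G}$-bundle over $\operatorname{Spec}R$ that is trivial over the fraction field of $R$ is trivial. The discriminant of a quadratic form is the determinant of the matrix of its polar bilinear form (entries $q_{ij}+q_{ji}$). For $n$ odd, this determinant, viewed as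 a universal polynomial with integer coefficients in the coefficients of the form, is divisible by $2$; the half-discriminant is the value of the quotient polynomial at the coefficients of $Q$ (it is $1/2$ times the discriminant when $2$ is invertible). Over a ring $A$, a linear transformation with coefficients in $A$ taking one form to another means an element of $GL_n(A)$, i.e. an invertible linear change of variables over $A$, transforming the first form into the second. *)

(* Defs.v *)
(* Arbitrary commutative rings are [comNzRingType], i.e.
   nonzero rings; this loses nothing, as every scheme below has exactly one
   point over the zero ring. *)
From HB Require Import structures.
From mathcomp Require Import all_boot all_order all_algebra.
From mathcomp Require Import mpoly.

Set Implicit Arguments.
Unset Strict Implicit.
Unset Printing Implicit Defensive.

Import GRing.Theory.
Local Open Scope ring_scope.

(** * Regular local rings *)

Section RegularLocal.
Variable R : comNzRingType.

Definition is_ideal (I : R -> Prop) : Prop :=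
  [/\ I 0, forall a b, I a -> I b -> I (a + b) & forall r a, I a -> I (r * a)].

Definition generated_by (d : nat) (x : 'I_d -> R) (I : R -> Prop) : Prop :=
  forall a, I a <-> exists c : 'I_d -> R, a = \sum_(i < d) c i * x i.

Definition noetherian : Prop :=
  forall I, is_ideal I -> exists (d : nat) (x : 'I_d -> R), generated_by x I.

Definition prime_ideal (P : R -> Prop) : Prop :=
  [/\ is_ideal P, ~ P 1 & forall a b, P (a * b) -> P a \/ P b].

Definition maximal_ideal (M : R -> Prop) : Prop :=
  [/\ is_ideal M, ~ M 1 &
      forall I, is_ideal I -> ~ I 1 -> (forall a, M a -> I a) ->
      forall a, I a -> M a].

Definition is_local (M : R -> Prop) : Prop :=
  maximal_ideal M /\
  forall M', maximal_ideal M' -> forall a, M' a <-> M a.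

Definition prime_chain (k : nat) (P : nat -> R -> Prop) : Prop :=
  (forall i, (i <= k)%N -> prime_ideal (P i)) /\
  (forall i, (i < k)%N ->
     (forall a, P i a -> P i.+1 a) /\ exists2 a, P i.+1 a & ~ P i a).

Definition krull_dim (d : nat) : Prop :=
  (exists P, prime_chain d P) /\
  (forall k P, prime_chain k P -> (k <= d)%N).

Definition regular_local : Prop :=
  noetherian /\
  exists M, is_local M /\
  exists d, krull_dim d /\ exists x : 'I_d -> R, generated_by x M.

End RegularLocal.

(** * Faithfully flat ring homomorphisms *)

(* [t : M x S -> T] is a tensor product of [M] and [S] over [R], where [S] is
   an [R]-algebra through [phi]. *)
Definition balanced (R S : comNzRingType) (phi : {rmorphism R -> S})
    (M : lmodType R) (T : zmodType) (t : M -> S -> T) : Prop :=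
  [/\ forall m m' s, t (m + m') s = t m s + t m' s,
      forall m s s', t m (s + s') = t m s + t m s' &
      forall r m s, t (r *: m) s = t m (phi r * s)].

Definition is_tensor (R S : comNzRingType) (phi : {rmorphism R -> S})
    (M : lmodType R) (T : zmodType) (t : M -> S -> T) : Prop :=
  balanced phi t /\
  forall (T' : zmodType) (t' : M -> S -> T'), balanced phi t' ->
  exists h : {additive T -> T'},
    (forall m s, h (t m s) = t' m s) /\
    (forall h' : {additive T -> T'},
       (forall m s, h' (t m s) = t' m s) -> h' =1 h).

Definition exact (M1 M2 M3 : zmodType) (f : M1 -> M2) (g : M2 -> M3) : Prop :=
  forall y, g y = 0 <-> exists x, f x = y.

Definition faithfully_flat (R S : comNzRingType) (phi : {rmorphism R -> S}) :
    Prop :=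
  forall (M1 M2 M3 : lmodType R) (f : {linear M1 -> M2}) (g : {linear M2 -> M3})
    (T1 T2 T3 : zmodType) (t1 : M1 -> S -> T1) (t2 : M2 -> S -> T2)
    (t3 : M3 -> S -> T3) (fS : {additive T1 -> T2}) (gS : {additive T2 -> T3}),
  is_tensor phi t1 -> is_tensor phi t2 -> is_tensor phi t3 ->
  (forall m s, fS (t1 m s) = t2 (f m) s) ->
  (forall m s, gS (t2 m s) = t3 (g m) s) ->
  exact f g <-> exact fS gS.

(** * Principal bundles and the Grothendieck--Serre conjecture *)

(* A subgroup functor of [GL_n]: [G A g] means [g \in G(A)]. *)
Definition matrix_functor (n : nat) : Type :=
  forall A : comNzRingType, 'M[A]_n -> Prop.

(* An affine [R]-scheme [E = Spec B] with a right action of [G]. The [A]-points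
   of [E] are the ring homomorphisms [x : B -> A]; the [R]-algebra structure
   that such a point induces on [A] is [x \o act_str], and the action, being
   over [R], does not change it. The values of [act_op x g] for [g] outside
   [G(A)] are irrelevant. *)
Record affine_action (R : comNzRingType) (n : nat) (G : matrix_functor n) := {
  act_ring : comNzRingType;
  act_str : {rmorphism R -> act_ring};
  act_op : forall A : comNzRingType,
    {rmorphism act_ring -> A} -> 'M[A]_n -> {rmorphism act_ring -> A};
  act_over : forall (A : comNzRingType) x (g : 'M[A]_n), G A g ->
    act_op x g \o act_str =1 x \o act_str;
  act_one : forall (A : comNzRingType) x, @act_op A x 1%:M =1 x;
  act_mul : forall (A : comNzRingType) x (g h : 'M[A]_n), G A g -> G A h ->
    act_op x (g *m h) =1 act_op (act_op x g) h;
  act_natural : forall (A A' : comNzRingType) (f : {rmorphism A -> A'})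
      (x : {rmorphism act_ring -> A}) (g : 'M[A]_n), G A g ->
    act_op (f \o x : {rmorphism act_ring -> A'}) (map_mx f g)
      =1 f \o act_op x g
}.

(* The base change of [E] along [phi : R -> S] is isomorphic to [G] acting on
   itself by right translations: [i] is a [G]-equivariant isomorphism of
   functors on [S]-algebras [psi : S -> A] from [G] to [E]. *)
Definition trivial_over (R : comNzRingType) (n : nat) (G : matrix_functor n)
    (E : affine_action R G) (S : comNzRingType) (phi : {rmorphism R -> S}) :
    Prop :=
  exists i : forall A : comNzRingType,
      {rmorphism S -> A} -> 'M[A]_n -> {rmorphism act_ring E -> A},
  [/\ forall (A : comNzRingType) (psi : {rmorphism S -> A}) g, G A g ->
        i A psi g \o @act_str _ _ _ E =1 psi \o phi,
      forall (A A' : comNzRingType) (f : {rmorphism A -> A'})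
          (psi : {rmorphism S -> A}) g, G A g ->
        i A' (f \o psi : {rmorphism S -> A'}) (map_mx f g) =1 f \o i A psi g,
      forall (A : comNzRingType) (psi : {rmorphism S -> A}) g h, G A g -> G A h ->
        i A psi (g *m h) =1 act_op (i A psi g) h &
      forall (A : comNzRingType) (psi : {rmorphism S -> A}) (y : {rmorphism act_ring E -> A}),
        y \o @act_str _ _ _ E =1 psi \o phi ->
        exists! g, G A g /\ i A psi g =1 y].

(* Affineness of [E] is no restriction when [G] is affine, since affine
   morphisms descend along fpqc coverings; and an fpqc covering of an affine
   scheme is refined by a single faithfully flat ring homomorphism. *)
Definition principal_bundle (R : comNzRingType) (n : nat)
    (G : matrix_functor n) (E : affine_action R G) : Prop :=
  exists (S : comNzRingType) (phi : {rmorphism R -> S}),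
    faithfully_flat phi /\ trivial_over E phi.

Definition grothendieck_serre (R : idomainType) (n : nat)
    (G : matrix_functor n) : Prop :=
  forall E : affine_action R G, principal_bundle E ->
    trivial_over E (@tofrac R) -> trivial_over E (@idfun R).

(** * Quadratic forms *)

(* A quadratic form [\sum_(i, j) q i j x_i x_j] is given by its matrix [q], and
   two forms over [A] are equal when they agree on [A^n]: the values at the
   [e_i] and [e_i + e_j] determine the coefficients. *)
Definition qform (A : comNzRingType) (n : nat) (q : 'M[A]_n) (v : 'cV[A]_n) : A :=
  \sum_(i < n) \sum_(j < n) q i j * v i 0 * v j 0.

(* Variables are numbered from 0: with [m = n./2], the form is
   [\sum_(i < m) x_i x_(m + i)], plus [x_(2m) ^+ 2] when [n] is odd. *)
Definition split_form (A : comNzRingType) (n : nat) : 'M[A]_n :=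
  \matrix_(i < n, j < n)
    (((i < n./2)%N && (j == n./2 + i :> nat)%N)
     || [&& odd n, i == n.-1 :> nat & j == n.-1 :> nat])%:R.

Definition discriminant (A : comNzRingType) (n : nat) (q : 'M[A]_n) : A :=
  \det (q + q^T).

Definition universal_form (n : nat) : 'M[{mpoly int[n * n]}]_n :=
  \matrix_(i < n, j < n) 'X_(mxvec_index i j).

(* The integer polynomial obtained by halving the coefficients; this is the
   exact quotient by 2 whenever [p] is divisible by 2. *)
Definition half_mpoly (k : nat) (p : {mpoly int[k]}) : {mpoly int[k]} :=
  \sum_(m <- msupp p) (p@_m %/ 2)%Z *: 'X_[m].

Definition half_discriminant (A : comNzRingType) (n : nat) (q : 'M[A]_n) : A :=
  mmap (intr : int -> A) (fun k => mxvec q 0 k)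
    (half_mpoly (discriminant (universal_form n))).

(* An invertible linear change of variables over [A] takes [q] to [q']. *)
Definition takes_to (A : comUnitRingType) (n : nat) (q q' : 'M[A]_n) : Prop :=
  exists2 g : 'M[A]_n, g \in unitmx & forall v, qform q (g *m v) = qform q' v.

(** * Clifford algebras and the split special orthogonal group *)

Definition is_clifford (A : comNzRingType) (n : nat) (q : 'M[A]_n)
    (C : algType A) (iota : {linear 'cV[A]_n -> C}) : Prop :=
  (forall v, iota v * iota v = (qform q v)%:A) /\
  forall (D : algType A) (j : {linear 'cV[A]_n -> D}),
    (forall v, j v * j v = (qform q v)%:A) ->
    exists f : {lrmorphism C -> D},
      (forall v, f (iota v) = j v) /\
      (forall f' : {lrmorphism C -> D},
         (forall v, f' (iota v) = j v) -> f' =1 f).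

Inductive clifford_even (A : comNzRingType) (n : nat) (C : algType A)
    (iota : 'cV[A]_n -> C) : C -> Prop :=
| clifford_even_scalar a : clifford_even iota a%:A
| clifford_even_add x y :
    clifford_even iota x -> clifford_even iota y -> clifford_even iota (x + y)
| clifford_even_mul v w x :
    clifford_even iota x -> clifford_even iota (iota v * iota w * x).

Definition clifford_even_center (A : comNzRingType) (n : nat) (C : algType A)
    (iota : 'cV[A]_n -> C) (z : C) : Prop :=
  clifford_even iota z /\ forall x, clifford_even iota x -> x * z = z * x.

Definition orthogonal (n : nat) : matrix_functor n := fun A g =>
  (exists h : 'M[A]_n, g *m h = 1%:M /\ h *m g = 1%:M) /\
  forall v, qform (split_form A n) (g *m v) = qform (split_form A n) v.

(* For [n > 0] even the center of the even Clifford algebra is [A * A], and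
   [(Z/2)(A)] is its group of [A]-automorphisms; so [g] is in the kernel of the
   Dickson homomorphism when the automorphism [C(g)] of the Clifford algebra
   induced by [g] is the identity on that center. The Clifford algebra being
   unique up to unique isomorphism, quantifying over all of them amounts to
   choosing one. *)
Definition dickson_kernel (n : nat) : matrix_functor n := fun A g =>
  forall (C : algType A) (iota : {linear 'cV[A]_n -> C}),
    is_clifford (split_form A n) iota ->
  forall Cg : {lrmorphism C -> C}, (forall v, Cg (iota v) = iota (g *m v)) ->
  forall z, clifford_even_center iota z -> Cg z = z.

Definition SO (n : nat) : matrix_functor n := fun A g =>
  orthogonal g /\ (if odd n then \det g = 1 else dickson_kernel g).

(* Main.v *)
Require Import Defs.
From HB Require Import structures.
From mathcomp Require Import all_boot all_order all_algebra.
From mathcomp Require Import perm boolp ring zify.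
From mathcomp Require Import generic_quotient ring_quotient mpoly.

Set Implicit Arguments.
Unset Strict Implicit.
Unset Printing Implicit Defensive.

Import GRing.Theory.
Local Open Scope ring_scope.

(** The forms [Q] and [Q_n] are isometric over some finite free, hence
    faithfully flat, extension of [R], so the scheme of isometries between them
    is a torsor under the orthogonal group. A subscheme of it is a torsor under
    [SO_n] and has a point over the fraction field; by hypothesis it has a point
    over [R], which is the required change of variables.

    Cutting out that subscheme takes an element of [R] that is found over the
    fraction field. In odd dimension, an isometry [H] over the fraction field
    satisfies [hd(Q) = det(H)^2 hd(Q_n)] for the half-discriminants, so the
    inverse of [det H] is a square root of an element of [R]; the subscheme is
    given by the value of the determinant. In even dimension, the center of the
    even Clifford algebra of [Q] is generated by an element [zeta] with
    [zeta^2 = B zeta - N], where [B] and [N] are in [R]. An isometry [H] maps it to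
    an element [alpha + (B - 2 alpha) epsilon] of the center of the even Clifford
    algebra of [Q_n], with [epsilon] the parity idempotent and
    [alpha^2 = B alpha - N] ([clifford_invariant_value]); the subscheme is given
    by the value of [alpha]. As [B^2 - 4 N] is a unit, two isometries with the
    same [alpha] differ by an element that fixes [epsilon], that is, by a point of
    the Dickson kernel ([dickson_kernelP]). This rests on a model of the Clifford
    algebra of [Q_n] by matrices of size [2^m], whose universal property
    ([split_clifford_lift]) is proved by splitting off one hyperbolic pair at a
    time.

    In both cases the element of the fraction field is a root of a monic
    quadratic polynomial over [R], and it belongs to [R] because regular local
    rings are normal ([regular_local_integrally_closed]). For generators
    [x_0, ..., x_(d-1)] of the maximal ideal, with [d] the dimension, Krull's
    principal ideal theorem ([prime_between]) shows that the ideals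
    [(x_0, ..., x_(k-1))] are prime, and complete integral closedness of the
    quotients by these ideals follows by descending induction on [k], with
    Krull's intersection theorem ([almost_integral_dvd]).

    The extension that splits [Q] is built from an orthogonal decomposition of
    [Q] over the local ring [R] into binary forms and at most one unary form
    ([block_decomposition]): each of them splits once a root of a monic quadratic
    polynomial is adjoined ([split_cover]). Over that extension [det H] or
    [alpha] may have the wrong value; it is corrected by a sign in odd dimension,
    and in even dimension by a reflection over the part of the extension where
    the two roots are exchanged.

    Finally, the subscheme is represented by the quotient of a polynomial ring by
    the polynomials vanishing on all of its points ([coordinate_ring],
    [torsor_section]). *)

(** * Noetherian rings and the principal ideal theorem *)

Section CommutativeAlgebra.
Variable R : comNzRingType.
Implicit Types (I J K L P Q M : R -> Prop) (a b c r s u x y : R).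

Definition ideal_sub I J := forall a, I a -> J a.

Definition principal x : R -> Prop := fun a => exists r, a = r * x.

Definition ideal_sum I J : R -> Prop :=
  fun a => exists i j, [/\ I i, J j & a = i + j].

(** The least ideal containing the products, defined by quantification over all
    ideals that contain them. *)
Definition ideal_prod I J : R -> Prop :=
  fun a => forall K, is_ideal K ->
    (forall x y, I x -> J y -> K (x * y)) -> K a.

Fixpoint ideal_pow I n : R -> Prop :=
  if n is n'.+1 then ideal_prod I (ideal_pow I n') else fun=> True.

Definition colon I u : R -> Prop := fun a => I (a * u).

(** The contraction to the ring of the extension of [I] to the localization
    at the prime [P]. *)
Definition saturation P I : R -> Prop := fun a => exists2 s, ~ P s & I (s * a).

Definition saturated P I := forall s a, ~ P s -> I (s * a) -> I a.

Lemma ideal0 I : is_ideal I -> I 0. Proof. by case. Qed.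
Lemma idealD I a b : is_ideal I -> I a -> I b -> I (a + b).
Proof. by case=> _ + _; apply. Qed.
Lemma idealM I r a : is_ideal I -> I a -> I (r * a).
Proof. by case=> _ _; apply. Qed.
Lemma idealMr I r a : is_ideal I -> I a -> I (a * r).
Proof. by rewrite mulrC; apply: idealM. Qed.
Lemma idealN I a : is_ideal I -> I a -> I (- a).
Proof. by move=> iI Ia; rewrite -mulN1r; apply: idealM. Qed.
Lemma idealB I a b : is_ideal I -> I a -> I b -> I (a - b).
Proof. by move=> iI Ia Ib; apply: idealD => //; exact: idealN. Qed.
Lemma ideal_sumr I (T : Type) (e : seq T) (F : T -> R) : is_ideal I ->
  (forall i, I (F i)) -> I (\sum_(i <- e) F i).
Proof.
by move=> iI IF; apply: big_ind => [|x y Ix Iy|//]; [exact: ideal0 | exact: idealD].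
Qed.

Lemma principal_ideal x : is_ideal (principal x).
Proof.
split=> [|_ _ [r ->] [s ->]|r _ [s ->]]; first by exists 0; rewrite mul0r.
- by exists (r + s); rewrite mulrDl.
- by exists (r * s); rewrite mulrA.
Qed.

Lemma principal_gen x : principal x x. Proof. by exists 1; rewrite mul1r. Qed.

Lemma ideal_sum_ideal I J : is_ideal I -> is_ideal J -> is_ideal (ideal_sum I J).
Proof.
move=> iI iJ; split=> [|_ _ [i [j [Ii Jj ->]]] [i' [j' [Ii' Jj' ->]]]|r _ [i [j [Ii Jj ->]]]].
- by exists 0, 0; rewrite addr0; split=> //; exact: ideal0.
- by exists (i + i'), (j + j'); rewrite addrACA; split=> //; exact: idealD.
- by exists (r * i), (r * j); rewrite mulrDr; split=> //; exact: idealM.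
Qed.

Lemma ideal_suml I J : is_ideal J -> ideal_sub I (ideal_sum I J).
Proof. by move=> iJ a Ia; exists a, 0; rewrite addr0; split=> //; apply: ideal0. Qed.

Lemma ideal_sum_r I J : is_ideal I -> ideal_sub J (ideal_sum I J).
Proof. by move=> iJ a Ia; exists 0, a; rewrite add0r; split=> //; apply: ideal0. Qed.

Lemma sum_principal_ideal I x : is_ideal I -> is_ideal (ideal_sum I (principal x)).
Proof. by move=> iI; apply: ideal_sum_ideal => //; exact: principal_ideal. Qed.

Lemma ideal_prod_ideal I J : is_ideal (ideal_prod I J).
Proof.
split=> [K iK _|a b Ha Hb K iK HK|r a Ha K iK HK]; first exact: ideal0.
- by apply: idealD => //; [apply: Ha | apply: Hb].
- by apply: idealM => //; apply: Ha.
Qed.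

Lemma ideal_pow_ideal I n : is_ideal (ideal_pow I n).
Proof. by case: n => [//|n] /=; exact: ideal_prod_ideal. Qed.

Lemma ideal_pow_mem I n a : I a -> ideal_pow I n (a ^+ n).
Proof. by move=> Ia; elim: n => [//|n IHn] K iK; rewrite exprS; apply. Qed.

Lemma ideal_powS_sub I n : ideal_sub (ideal_pow I n.+1) (ideal_pow I n).
Proof. by move=> a; apply=> [|x y _]; [exact: ideal_pow_ideal | move=> Hy; apply: idealM => //; exact: ideal_pow_ideal]. Qed.

Lemma colon_ideal I u : is_ideal I -> is_ideal (colon I u).
Proof.
move=> iI; rewrite /colon; split=> [|a b|r a].
- by rewrite mul0r; exact: ideal0.
- by rewrite mulrDl; exact: idealD.
- by rewrite -mulrA; exact: idealM.
Qed.

Section Prime.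
Variable P : R -> Prop.
Hypothesis prP : prime_ideal P.

Lemma prime_ideal_ideal : is_ideal P. Proof. by case: prP. Qed.

Lemma prime_notM a b : ~ P a -> ~ P b -> ~ P (a * b).
Proof. by case: prP => _ _ PM Pa Pb /PM []. Qed.

Lemma prime_cancel a b : ~ P a -> P (a * b) -> P b.
Proof. by case: prP => _ _ PM Pa /PM []. Qed.

Lemma prime_exp a n : P (a ^+ n) -> P a.
Proof.
case: prP => _ P1 PM; elim: n => [|n IHn]; first by rewrite expr0.
by rewrite exprS => /PM [].
Qed.

Lemma prime_not1 : ~ P 1. Proof. by case: prP. Qed.

Lemma saturation_ideal I : is_ideal I -> is_ideal (saturation P I).
Proof.
move=> iI; split=> [|a b [s Ps Ia] [t Pt Ib]|r a [s Ps Ia]].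
- by exists 1; [exact: prime_not1 | rewrite mulr0; exact: ideal0].
- exists (s * t); first exact: prime_notM.
  rewrite mulrDr mulrAC -[s * t * b]mulrA; apply: idealD => //.
    exact: idealMr.
  exact: idealM.
- by exists s => //; rewrite mulrCA; apply: idealM.
Qed.

Lemma saturation_saturated I : saturated P (saturation P I).
Proof.
move=> s a Ps [t Pt Ia]; exists (t * s); first exact: prime_notM.
by rewrite -mulrA.
Qed.

Lemma sub_saturation I : ideal_sub I (saturation P I).
Proof. by move=> a Ia; exists 1; [exact: prime_not1 | rewrite mul1r]. Qed.

Lemma saturation_sub I J : saturated P J -> ideal_sub I J ->
  ideal_sub (saturation P I) J.
Proof. by move=> sJ IJ a [s Ps /IJ]; apply: sJ. Qed.

Lemma saturationS I J : ideal_sub I J ->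
  ideal_sub (saturation P I) (saturation P J).
Proof. by move=> IJ a [s Ps /IJ]; exists s. Qed.

End Prime.

Hypothesis noethR : noetherian R.

(** An ascending chain without maximal element would have a union that no
    finite set generates. *)
Lemma noetherian_max (F : (R -> Prop) -> Prop) I0 :
  (forall I, F I -> is_ideal I) -> F I0 ->
  exists2 I, F I & forall J, F J -> ideal_sub I J -> ideal_sub J I.
Proof.
move=> FI FI0; apply: contrapT => nomax.
have next I : exists J, F I -> [/\ F J, ideal_sub I J & ~ ideal_sub J I].
  case: (pselect (F I)) => [fI|]; last by exists I.
  apply: contrapT => noJ; apply: nomax; exists I => // J FJ IJ.
  apply: contrapT => nJI; apply: noJ; exists J => _; split=> //.
have [f fP] := choice next.
pose C k := iter k f I0.
have FC k : F (C k) by elim: k => [//|k IHk] /=; case: (fP _ IHk).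
have CS k l : (k <= l)%N -> ideal_sub (C k) (C l).
  move=> /subnK <-; elim: (l - k)%N => [//|m IHm] a /IHm.
  by rewrite addSn /=; case: (fP _ (FC (m + k)%N)) => _ + _; apply.
pose U a := exists k, C k a.
have iU : is_ideal U.
  split=> [|a b [k Ca] [l Cb]|r a [k Ca]].
  - by exists 0%N; apply: ideal0; apply: FI; exact: (FC 0%N).
  - exists (maxn k l); apply: (idealD (FI _ (FC _))).
      exact: CS (leq_maxl _ _) _ Ca.
    exact: CS (leq_maxr _ _) _ Cb.
  - by exists k; apply: (idealM _ (FI _ (FC _))).
have [d [x gx]] := noethR iU.
have Ux i : U (x i).
  apply/gx; exists (fun j => (j == i)%:R); rewrite (bigD1 i) //= eqxx mul1r.
  by rewrite big1 ?addr0 // => j /negPf ->; rewrite mul0r.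
have [k kP] := choice Ux.
pose N := \max_i k i.
have CN i : C N (x i) by apply: CS (kP i); exact: leq_bigmax.
have [_ _] := fP _ (FC N); apply=> a Ca.
have /gx [c ->] : U a by exists N.+1.
by apply: (ideal_sumr _ (FI _ (FC N))) => i; apply: (idealM _ (FI _ (FC N))).
Qed.

(** Nakayama's lemma for [K] and its subideal [L], localized at [Q]. The
    generators of [K] are eliminated one at a time: the relation satisfied by
    the last one has a coefficient outside [Q]. *)
Lemma nakayama Q K L : prime_ideal Q -> is_ideal K -> is_ideal L ->
  ideal_sub K (saturation Q (ideal_sum L (ideal_prod Q K))) ->
  ideal_sub K (saturation Q L).
Proof.
move=> prQ iK iL KLQ; have iQ := prime_ideal_ideal prQ.
have [d [x gx]] := noethR iK.
pose y k := oapp x 0 (insub k).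
pose G := fix G k := if k is k'.+1 then ideal_sum (G k') (principal (y k')) else L.
have iG k : is_ideal (G k).
  elim: k => //= k IHk; apply: ideal_sum_ideal => //; exact: principal_ideal.
have GS k l : (k <= l)%N -> ideal_sub (G k) (G l).
  move=> /subnK <-; elim: (l - k)%N => [//|m IHm] a /IHm.
  by rewrite addSn /=; apply: ideal_suml; exact: principal_ideal.
have Ky k : K (y k).
  rewrite /y; case: insubP => [i _ _|_] /=; last exact: ideal0.
  apply/gx; exists (fun j => (j == i)%:R); rewrite (bigD1 i) //= eqxx mul1r.
  by rewrite big1 ?addr0 // => j /negPf ->; rewrite mul0r.
have KG : ideal_sub K (saturation Q (G d)).
  move=> _ /gx[c ->]; apply: sub_saturation => //.
  apply: ideal_sumr => // i; apply: idealM => //.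
  apply: (GS i.+1) => //=; apply: ideal_sum_r => //.
  by rewrite /y valK /=; exact: principal_gen.
suff H k : ideal_sub K (saturation Q (G k)) -> ideal_sub K (saturation Q L).
  exact: H KG.
elim: k => [//|k IHk KGk]; apply: IHk.
have yG : saturation Q (G k) (y k).
  have [s Qs [l [e [Ll He E]]]] := KLQ _ (Ky k).
  pose T e' := exists s g q, [/\ ~ Q s, G k g, Q q & s * e' = g + q * y k].
  have [] : T e.
    apply: He => [|q z Qq Kz]; last first.
      have [t Qt [g [h [Gg [r ->] Ez]]]] := KGk _ Kz.
      exists t, (q * g), (q * r); split=> //; [exact: idealM|exact: idealMr|].
      by rewrite mulrCA Ez; ring.
    split=> [|a b [t [g [q [Qt Gg Qq E1]]]] [t' [g' [q' [Qt' Gg' Qq' E2]]]]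
             |r a [t [g [q [Qt Gg Qq E1]]]]].
    - exists 1, 0, 0; split; [exact: prime_not1|exact: ideal0|exact: ideal0|].
      by rewrite mulr0 mul0r addr0.
    - exists (t * t'), (t' * g + t * g'), (t' * q + t * q'); split.
      + exact: prime_notM.
      + by apply: idealD => //; exact: idealM.
      + by apply: idealD => //; exact: idealM.
      + rewrite mulrDr [t * t' * a]mulrAC E1 -mulrA E2; ring.
    - exists t, (r * g), (r * q); split=> //; [exact: idealM|exact: idealM|].
      by rewrite mulrCA E1; ring.
  move=> t [g [q [Qt Gg Qq E2]]]; exists (t * s - q).
    move=> H; apply: (prime_notM prQ Qt Qs).
    by rewrite -(subrK q (t * s)); apply: idealD.
  have -> : (t * s - q) * y k = t * l + g.
    by rewrite mulrBl -mulrA E mulrDr E2; ring.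
  apply: idealD => //; apply: idealM => //; exact: (GS 0%N).
case: yG => s Qs Gy a /KGk[t Qt [g [h [Gg [r ->] E]]]].
exists (s * t); first exact: prime_notM.
have -> : s * t * a = s * g + r * (s * y k) by rewrite -mulrA E; ring.
by apply: idealD => //; exact: idealM.
Qed.

(** Descending chain condition for the localization at [P] of the quotient by
    [I], in terms of ideals that are contracted from that localization. *)
Definition dcc_above P I := forall K : nat -> R -> Prop,
  (forall n, [/\ is_ideal (K n), saturated P (K n), ideal_sub I (K n) &
                 ideal_sub (K n.+1) (K n)]) ->
  exists N, forall n, (N <= n)%N -> ideal_sub (K N) (K n).

Lemma desc_leq (K : nat -> R -> Prop) :
  (forall n, ideal_sub (K n.+1) (K n)) ->
  forall k l, (k <= l)%N -> ideal_sub (K l) (K k).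
Proof.
move=> KS k l /subnK <-; elim: (l - k)%N => [//|m IHm] a.
by rewrite addSn => /KS; apply: IHm.
Qed.

(** One step of a composition series: [J] is the saturation of [I + (u)], and
    [P] annihilates [u] modulo [I]. *)
Lemma dcc_step P I u : prime_ideal P -> is_ideal I -> saturated P I ->
  ~ I u -> ideal_sub P (colon I u) ->
  dcc_above P (saturation P (ideal_sum I (principal u))) -> dcc_above P I.
Proof.
move=> prP iI sI nIu Pu; set J := saturation _ _ => DJ K HK.
have iK n : is_ideal (K n) by case: (HK n).
have sK n : saturated P (K n) by case: (HK n).
have IK n : ideal_sub I (K n) by case: (HK n).
have Kdec := desc_leq (fun n => let: And4 _ _ _ h := HK n in h).
have iJ : is_ideal J.
  by apply: saturation_ideal => //; exact: sum_principal_ideal.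
case: (pselect (forall n, K n u)) => [Ku|/existsNP[n0 nKu]].
  apply: DJ => n; split=> //; last exact: Kdec.
  apply: saturation_sub => // _ [i [_ [Ii [r ->] ->]]].
  by apply: idealD => //; [exact: IK|apply: idealM].
pose JK n := saturation P (ideal_sum (K n) J).
have [|N HN] := DJ JK.
  move=> n; split; first by apply: saturation_ideal => //; exact: ideal_sum_ideal.
  - exact: saturation_saturated.
  - by move=> a Ja; apply: sub_saturation => //; exact: ideal_sum_r.
  - apply: saturationS => _ [i [j [Ki Jj ->]]].
    by exists i, j; split=> //; apply: Kdec Ki.
exists (maxn N n0) => n; rewrite geq_max => /andP[Nn n0n] k Kk.
have /(HN n Nn)[s Ps [k' [j [Kk' Jj E]]]] : JK N k.
  apply: sub_saturation => //; apply: ideal_suml => //.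
  exact: Kdec (leq_maxl _ _) _ Kk.
have Kj : K (maxn N n0) j.
  have -> : j = s * k - k' by rewrite E addrC addKr.
  apply: idealB => //; first exact: idealM.
  by apply: Kdec Kk'; rewrite geq_max Nn.
have Ij : I j.
  have [t Pt [i [_ [Ii [r ->] E2]]]] := Jj.
  apply: (sI t) => //; rewrite E2; apply: idealD => //.
  case: (pselect (P r)) => [Pr|Pr]; first exact: Pu.
  case: nKu; apply: (Kdec _ _ (leq_maxr N n0)); apply: (sK _ r) => //.
  have -> : r * u = t * j - i by rewrite E2 addrC addKr.
  by apply: idealB => //; [exact: idealM | exact: IK].
apply: (sK n s) => //; rewrite E; apply: idealD => //; exact: IK.
Qed.

(** Krull's principal ideal theorem, for the domain [R / P0] localized at
    [P2]: were [P2] minimal over [P0 + (x)], that ring modulo [x] would be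
    Artinian, so the symbolic powers of [P1] would become stationary modulo
    [x], hence stationary, and Nakayama's lemma would give [P1 = P0]. *)
Lemma prime_between P0 P1 P2 x : prime_ideal P0 -> prime_ideal P1 ->
  prime_ideal P2 -> ideal_sub P0 P1 -> ~ ideal_sub P1 P0 -> ideal_sub P1 P2 ->
  P2 x -> ~ P1 x ->
  exists P, [/\ prime_ideal P, P x, ideal_sub P0 P, ideal_sub P P2 &
                ~ ideal_sub P2 P].
Proof.
move=> pr0 pr1 pr2 P01 nP10 P12 P2x nP1x; apply: contrapT => noP.
have Pmin P : prime_ideal P -> P x -> ideal_sub P0 P -> ideal_sub P P2 ->
    ideal_sub P2 P.
  by move=> *; apply: contrapT => ?; apply: noP; exists P.
have [i0 i1 i2] := And3 (prime_ideal_ideal pr0) (prime_ideal_ideal pr1)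
  (prime_ideal_ideal pr2).
pose F I := [/\ is_ideal I, saturated P2 I, ideal_sub P0 I & I x] /\
  ~ dcc_above P2 I.
pose I0 := saturation P2 (ideal_sum P0 (principal x)).
have iI0 : is_ideal I0 by apply: saturation_ideal => //; exact: sum_principal_ideal.
have DI0 : dcc_above P2 I0.
  apply: contrapT => nD.
  have F0 : F I0.
    split=> //; split=> //; first exact: saturation_saturated.
    - by move=> a Pa; apply: sub_saturation => //; apply: ideal_suml => //; exact: principal_ideal.
    - by apply: sub_saturation => //; apply: ideal_sum_r => //; exact: principal_gen.
  have [I [[iI sI P0I Ix] nDI] Imax] := @noetherian_max F I0 (fun I h => let: conj (And4 a _ _ _) _ := h in a) F0.
  have nI1 : ~ I 1.
    move=> I1; apply: nDI => K HK; exists 0%N => n _ a _.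
    by case: (HK n) => iK _ IK _; rewrite -[a]mulr1; apply: idealM => //; exact: IK.
  pose C J := exists2 u, ~ I u & J = colon I u.
  (* The annihilators of the nonzero elements modulo [I] have a maximal member,
     which is prime. *)
  have [|| _ [u nIu ->] Umax] := @noetherian_max C (colon I 1).
  - by move=> _ [u _ ->]; exact: colon_ideal.
  - by exists 1.
  have prU : prime_ideal (colon I u).
    split; [exact: colon_ideal | by rewrite /colon mul1r |].
    move=> a b Hab; case: (pselect (I (a * u))) => [|nIau]; first by left.
    right; apply: (Umax (colon I (a * u))); first by exists (a * u).
      by rewrite /colon => r Hr; rewrite mulrCA; apply: idealM.
    by move: Hab; rewrite /colon mulrCA mulrA.
  have P2U : ideal_sub P2 (colon I u).
    apply: Pmin => //; rewrite /colon; first exact: idealMr.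
      by move=> a /P0I Ia; exact: idealMr.
    by move=> s Is; apply: contrapT => nPs; apply: nIu; exact: sI Is.
  apply: nDI; apply: (dcc_step (u := u)) => //.
  apply: contrapT => nDJ; apply: nIu.
  have IJ : ideal_sub I (saturation P2 (ideal_sum I (principal u))).
    by move=> a Ia; apply: sub_saturation => //; apply: ideal_suml => //; exact: principal_ideal.
  apply: (Imax (saturation P2 (ideal_sum I (principal u)))) => //.
    split=> //; split; first by apply: saturation_ideal => //; exact: sum_principal_ideal.
    - exact: saturation_saturated.
    - by move=> a /P0I; exact: IJ.
    - exact: IJ.
  by apply: sub_saturation => //; apply: ideal_sum_r => //; exact: principal_gen.
(* The symbolic powers of [P1]. *)
pose K n := saturation P1 (ideal_sum (ideal_pow P1 n) P0).
have iK n : is_ideal (K n).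
  by apply: saturation_ideal => //; apply: ideal_sum_ideal => //; exact: ideal_pow_ideal.
have sK n : saturated P1 (K n) by exact: saturation_saturated.
have KS n : ideal_sub (K n.+1) (K n).
  apply: saturationS => _ [i [j [Ii Jj ->]]]; exists i, j; split=> //.
  exact: ideal_powS_sub.
have K0 n : ideal_sub P0 (K n).
  by move=> a Pa; apply: sub_saturation => //; apply: ideal_sum_r => //; exact: ideal_pow_ideal.
pose K' n := saturation P2 (ideal_sum (K n) (principal x)).
have [|N HN] := DI0 K'.
  move=> n; split; first by apply: saturation_ideal => //; exact: sum_principal_ideal.
  - exact: saturation_saturated.
  - apply: saturationS => _ [i [j [Ii Jj ->]]]; exists i, j; split=> //; exact: K0.
  - apply: saturationS => _ [i [j [Ii Jj ->]]]; exists i, j; split=> //; exact: KS.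
have KN : ideal_sub (K N) (saturation P2 (K N.+1)).
  apply: nakayama => // a Ka.
  have [s Ps [b [_ [Kb [r ->] E]]]] : K' N.+1 a.
    apply: (HN N.+1) => //; apply: sub_saturation => //.
    by apply: ideal_suml => //; exact: principal_ideal.
  exists s => //; exists b, (r * x); split=> // J iJ HJ; rewrite mulrC.
  apply: HJ => //; apply: (sK _ x) => //.
  have -> : x * r = s * a - b by rewrite E addrC addKr mulrC.
  by apply: idealB => //; [exact: idealM | exact: KS].
have PN : ideal_sub (ideal_pow P1 N) (saturation P1 P0).
  apply: nakayama => //; first exact: ideal_pow_ideal.
  move=> a Pa.
  have /KN [s Ps [t Pt [i [j [Hi Hj E]]]]] : K N a.
    by apply: sub_saturation => //; exact: ideal_suml.
  exists (t * s); first by apply: prime_notM => // /P12.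
  by rewrite -mulrA; exists j, i; split=> //; rewrite addrC.
apply: nP10 => p P1p.
have [s Ps] := PN _ (ideal_pow_mem N P1p).
by move=> /(prime_cancel pr0 (fun h => Ps (P01 _ h))) /(prime_exp pr0).
Qed.

(** A chain of primes whose top contains [x] can be pushed, from the top
    down, into the primes containing [x], at the cost of one term. *)
Lemma chain_through d (P : nat -> R -> Prop) x :
  prime_chain d.+1 P -> P d.+1 x ->
  exists P' : nat -> R -> Prop, [/\ prime_chain d P', forall i, (i <= d)%N -> P' i x,
                 ideal_sub (P 0%N) (P' 0%N) & P' d = P d.+1].
Proof.
elim: d P => [|d IHd] P [prP strP] Px.
  exists (fun=> P 1%N); split=> //; last by case: (strP 0%N).
  by split=> // i _; exact: prP.
have [Q [Qchain Qx P0Q Qtop topQ]] : exists Q : nat -> R -> Prop,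
    [/\ prime_chain d Q, forall i, (i <= d)%N -> Q i x, ideal_sub (P 0%N) (Q 0%N),
        ideal_sub (Q d) (P d.+2) & ~ ideal_sub (P d.+2) (Q d)].
  case: (pselect (P d.+1 x)) => [Px1|nPx1].
    have [|//|Q [Qc Qx P0Q Qd]] := IHd P.
      by split=> i Hi; [apply: prP; apply: leqW | apply: strP; apply: leqW].
    have [s1 [z Pz nPz]] := strP d.+1 (ltnSn _).
    by exists Q; split; rewrite ?Qd // => H; apply: nPz; exact: H.
  have [s1 [z Pz nPz]] := strP d.+1 (ltnSn _).
  have [s0 [z' Pz' nPz']] := strP d (leqnSn _).
  have [||||||||T [prT Tx PT TP nPT]] := @prime_between (P d) (P d.+1) (P d.+2) x => //.
  - by apply: prP; rewrite -addn2 leq_addr.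
  - exact: prP.
  - exact: prP.
  - by move=> H; apply: nPz'; exact: H.
  pose P2 i := if (i <= d)%N then P i else T.
  have [||Q [Qc Qx P0Q Qd]] := IHd P2.
  - split=> i Hi; rewrite /P2.
      by case: ifP => // Hi'; apply: prP; apply: leqW.
    have id : (i <= d)%N by [].
    rewrite id; case: ifP => Hi'.
      by apply: strP; exact: leqW.
    have -> : i = d by apply/eqP; rewrite eqn_leq id leqNgt Hi'.
    by split=> //; exists x => // /s0.
  - by rewrite /P2 ltnn.
  - by exists Q; split=> //; rewrite Qd /P2 ltnn.
exists (fun i => if (i <= d)%N then Q i else P d.+2); split=> //; last by rewrite ltnn.
  have [prQ strQ] := Qchain; split=> i Hi; first by case: ifP => // ?; [exact: prQ|exact: prP].
  have id : (i <= d)%N by [].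
  rewrite id; case: ifP => Hi'; first exact: strQ.
  have -> : i = d by apply/eqP; rewrite eqn_leq id leqNgt Hi'.
  split=> //; have /existsNP[z] := topQ.
  by move=> /not_implyP[? ?]; exists z.
by move=> i _; case: ifP => // Hi; exact: Qx.
Qed.

End CommutativeAlgebra.

(** * Regular local rings are completely integrally closed *)

Section LocalRing.
Variables (R : comNzRingType) (M : R -> Prop).
Hypotheses (noethR : noetherian R) (locM : is_local M).
Implicit Types (a b c r s x y : R) (I J P : R -> Prop).

Let iM : is_ideal M. Proof. by case: locM => -[]. Qed.
Let nM1 : ~ M 1. Proof. by case: locM => -[]. Qed.

Lemma local_unit a : ~ M a -> exists b, a * b = 1.
Proof.
move=> nMa; apply: contrapT => /forallNP nu.
have np1 : ~ principal a 1 by case=> r E; apply: (nu r); rewrite mulrC.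
pose F I := [/\ is_ideal I, ~ I 1 & I a].
have [||I [iI nI1 Ia] Imax] := @noetherian_max R noethR F (principal a).
- by move=> I [].
- by split=> //; [exact: principal_ideal | exact: principal_gen].
apply: nMa; case: locM => _ /(_ I) <- //; split=> // J iJ nJ1 IJ.
by apply: Imax => //; split=> //; exact: IJ.
Qed.

Lemma local_proper I : is_ideal I -> ~ I 1 -> ideal_sub I M.
Proof.
move=> iI nI1 a Ia; apply: contrapT => /local_unit[b ab].
by apply: nI1; rewrite -ab; exact: idealMr.
Qed.

Lemma local_cancel s a I : is_ideal I -> ~ M s -> I (s * a) -> I a.
Proof.
move=> iI /local_unit[t st] Isa.
have -> : a = t * (s * a) by rewrite mulrA [t * s]mulrC st mul1r.
exact: idealM.
Qed.

Lemma local_prime : prime_ideal M.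
Proof.
split=> // a b Mab; apply: contrapT => /not_orP[nMa nMb].
by apply: nMb; exact: local_cancel Mab.
Qed.

Lemma local_prime_sub P : prime_ideal P -> ideal_sub P M.
Proof. by case=> iP nP1 _; exact: local_proper. Qed.

Lemma local_one_sub a b : M a -> ~ M (1 - a * b).
Proof.
move=> Ma Mab; apply: nM1; rewrite -(subrK (a * b) 1).
by apply: idealD => //; exact: idealMr.
Qed.

(** Krull's intersection theorem in the quotient by [J]. The successive
    quotients of [a] by the powers of [x] span an ascending chain of ideals,
    which becomes stationary; there [1 - t x] kills one of them. *)
Lemma krull_intersection J x a : is_ideal J -> M x ->
  (forall n, exists r, J (a - x ^+ n * r)) -> J a.
Proof.
move=> iJ Mx /choice[r rP].
pose F I := exists n, I = colon J (x ^+ n).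
have [||_ [N ->] Nmax] := @noetherian_max R noethR F (colon J (x ^+ 0)).
- by move=> _ [n ->]; exact: colon_ideal.
- by exists 0%N.
have colN n : ideal_sub (colon J (x ^+ n)) (colon J (x ^+ N)).
  move=> y Hy; apply: (Nmax (colon J (x ^+ (N + n)))); first by exists (N + n)%N.
    by move=> z Hz; rewrite /colon exprD mulrA; apply: idealMr.
  by rewrite /colon exprD mulrCA; apply: idealM.
pose s n := x ^+ N * r (N + n)%N.
have sS n : J (s n - x * s n.+1).
  have : colon J (x ^+ N) (r (N + n)%N - x * r (N + n.+1)%N).
    apply: (colN (N + n)%N); rewrite /colon.
    have -> : (r (N + n)%N - x * r (N + n.+1)%N) * x ^+ (N + n) =
      (a - x ^+ (N + n.+1) * r (N + n.+1)%N) - (a - x ^+ (N + n) * r (N + n)%N).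
      by rewrite addnS exprS; ring.
    exact: idealB.
  by rewrite /colon /s; congr J; ring.
pose G I := exists n, I = ideal_sum J (principal (s n)).
have [||_ [m ->] mmax] := @noetherian_max R noethR G (ideal_sum J (principal (s 0%N))).
- by move=> _ [n ->]; exact: sum_principal_ideal.
- by exists 0%N.
have Jsm : J (s m.+1).
  have [] := mmax (ideal_sum J (principal (s m.+1))) _ _ (s m.+1).
  - by exists m.+1.
  - move=> _ [i [_ [Ji [t ->] ->]]].
    exists (i + t * (s m - x * s m.+1)), (t * x * s m.+1); split=> //.
    + by apply: idealD => //; exact: idealM.
    + by exists (t * x).
    + by ring.
  - by apply: ideal_sum_r => //; exact: principal_gen.
  move=> i [_ [Ji [t ->] E]].
  apply: (local_cancel (s := 1 - x * t)) => //; first exact: local_one_sub.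
  have -> : (1 - x * t) * s m.+1 = i + t * (s m - x * s m.+1).
    by rewrite mulrBl mul1r {1}E; ring.
  by apply: idealD => //; exact: idealM.
have Js0 k : (k <= m.+1)%N -> J (s (m.+1 - k)%N).
  elim: k => [|k IHk] km; first by rewrite subn0.
  have -> : s (m.+1 - k.+1)%N =
      s (m.+1 - k.+1)%N - x * s (m.+1 - k.+1).+1 + x * s (m.+1 - k)%N.
    by rewrite -subSn // subSS subrK.
  by apply: idealD => //; apply: idealM => //; apply: IHk; exact: ltnW.
have := Js0 _ (leqnn _); rewrite subnn /s addn0 => Jr.
by rewrite -(subrK (x ^+ N * r N) a); exact: idealD.
Qed.

Section RegularSystem.
Variables (d : nat) (x : nat -> R).

(** The ideal generated by the first [k] members of a system of parameters. *)
Fixpoint initial_ideal k : R -> Prop :=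
  if k is k'.+1 then ideal_sum (initial_ideal k') (principal (x k'))
  else fun a => a = 0.

Hypothesis genM : ideal_sub M (initial_ideal d).
Hypothesis xM : forall k, M (x k).
Hypothesis chainM : exists P : nat -> R -> Prop, prime_chain d P.

Notation I_ := initial_ideal.

Lemma initial_ideal_ideal k : is_ideal (I_ k).
Proof.
elim: k => [|k IHk]; last exact: sum_principal_ideal.
by split=> [//|a b -> ->|r a ->]; rewrite ?addr0 ?mulr0.
Qed.
Hint Resolve initial_ideal_ideal : core.

Lemma initial_idealS k : ideal_sub (I_ k) (I_ k.+1).
Proof. by apply: ideal_suml; exact: principal_ideal. Qed.

Lemma initial_ideal_gen k : I_ k.+1 (x k).
Proof. by apply: ideal_sum_r => //; exact: principal_gen. Qed.

Lemma initial_ideal_sub k I : is_ideal I -> ideal_sub (I_ k) I -> I (x k) ->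
  ideal_sub (I_ k.+1) I.
Proof.
move=> iI kI xI _ [i [_ [Hi [r ->] ->]]].
by apply: idealD => //; [exact: kI | exact: idealM].
Qed.

Lemma initial_ideal_M k : ideal_sub (I_ k) M.
Proof.
elim: k => [|k IHk]; first by move=> _ ->; exact: ideal0.
exact: initial_ideal_sub.
Qed.

(** The top of a chain of primes may be moved up to [M]. *)
Lemma chain_to_top l (P : nat -> R -> Prop) : prime_chain l.+1 P ->
  prime_chain l.+1 (fun i => if (i <= l)%N then P i else M).
Proof.
move=> [prP strP]; split=> i Hi.
  by case: ifP => ?; [exact: prP | exact: local_prime].
have il : (i <= l)%N by [].
rewrite il; case: ifP => Hi'; first exact: strP.
have [s1 [z Pz nPz]] := strP i Hi.
have PM j : (j <= l.+1)%N -> ideal_sub (P j) M.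
  by move=> /prP; exact: local_prime_sub.
split; first by apply: PM; exact: ltnW.
by exists z => //; exact: PM Pz.
Qed.

(** The height theorem: [R / I_ k] has Krull dimension at most the number of
    the remaining generators of [M]. *)
Lemma chain_bound e k l (P : nat -> R -> Prop) : (k + e = d)%N ->
  prime_chain l P -> ideal_sub (I_ k) (P 0%N) -> (l <= e)%N.
Proof.
elim: e k l P => [|e IHe] k l P kd chP IP; case: l chP IP => [//|l] chP IP.
  move: kd; rewrite addn0 => kd; case: chP => prP strP.
  have [_ [z Pz []]] := strP 0%N isT; apply: IP; rewrite kd.
  by apply: genM; exact: (local_prime_sub (prP 1%N isT)).
have [|P' [chP' xP' PP' _]] := chain_through (x := x k) noethR (chain_to_top chP).
  by rewrite ltnn.
apply: (IHe k.+1 l P') => //; first by rewrite addSnnS.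
have [prP' _] := chP'; apply: initial_ideal_sub.
- exact: (prime_ideal_ideal (prP' _ _)).
- by move=> a /IP; exact: PP'.
- exact: xP'.
Qed.

(** Pushing a chain of maximal length into the primes containing the next
    parameter costs one term only, so the parameters cut the dimension down one
    by one. *)
Lemma chain_exists k : (k <= d)%N ->
  exists P : nat -> R -> Prop, prime_chain (d - k) P /\ ideal_sub (I_ k) (P 0%N).
Proof.
elim: k => [_|k IHk kd].
  have [P chP] := chainM; exists P; rewrite subn0; split=> // _ ->.
  by case: chP => prP _; apply: ideal0; exact: (prime_ideal_ideal (prP 0%N _)).
have [P [chP IP]] := IHk (ltnW kd); rewrite -(subnSK kd) in chP.
have [|P' [chP' xP' PP' _]] := chain_through (x := x k) noethR (chain_to_top chP).
  by rewrite ltnn.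
exists P'; split=> //; have [prP' _] := chP'; apply: initial_ideal_sub.
- exact: (prime_ideal_ideal (prP' _ _)).
- by move=> a /IP; exact: PP'.
- exact: xP'.
Qed.

(** The quotients [R / I_ k] are domains. The smallest prime [P 0] of a chain of
    maximal length does not contain [x k], and is contained in the prime
    [I_ k.+1], by the bound on chains; so [P 0 = I_ k + x k * P 0]. *)
Lemma initial_ideal_prime k : (k <= d)%N ->
  prime_ideal (I_ k) /\ ((k < d)%N -> ~ I_ k (x k)).
Proof.
move=> kd; move: {2}(d - k)%N (erefl (d - k)%N) => e; elim: e k kd => [|e IHe] k kd.
  move/eqP; rewrite subn_eq0 => dk; have {kd dk}-> : k = d by apply/eqP; rewrite eqn_leq kd.
  split; last by rewrite ltnn.
  have [iI _ _] := initial_ideal_ideal d.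
  have EM a : I_ d a <-> M a by split; [exact: initial_ideal_M | exact: genM].
  have [_ _ PM] := local_prime; split=> [//|/EM //|a b /EM /PM].
  by rewrite !EM.
move=> dke; have {}kd : (k < d)%N by rewrite -subn_gt0 dke.
have dke' : (d - k.+1 = e)%N by rewrite subnS dke.
have ked : (k.+1 + e = d)%N by rewrite -dke' subnKC.
have [prI _] := IHe _ kd dke'.
have [P []] := chain_exists (ltnW kd); rewrite dke => chP IP.
have [prP strP] := chP; have iP0 := prime_ideal_ideal (prP 0%N isT).
have nPx : ~ P 0%N (x k).
  by move=> Px; have := chain_bound ked chP (initial_ideal_sub iP0 IP Px); rewrite ltnn.
have [|P' [chP' xP' PP' _]] := chain_through (x := x k) noethR (chain_to_top chP).
  by rewrite ltnn.
have [prP' strP'] := chP'; have iP' := prime_ideal_ideal (prP' 0%N isT).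
have IP' : ideal_sub (I_ k.+1) (P' 0%N).
  apply: initial_ideal_sub => //; last exact: xP'.
  by move=> a /IP; exact: PP'.
have P'I : ideal_sub (P' 0%N) (I_ k.+1).
  apply: contrapT => nP'I.
  pose Q i := if i is i'.+1 then P' i' else I_ k.+1.
  suff /(chain_bound ked) : prime_chain e.+1 Q.
    by move=> /(_ (fun=> id)); rewrite ltnn.
  split=> [[|i] // Hi|[|i] Hi]; [exact: prP' | | exact: strP'].
  split=> //; have /existsNP[z] := nP'I.
  by move=> /not_implyP[? ?]; exists z.
have P0I : ideal_sub (P 0%N) (I_ k).
  have H : ideal_sub (P 0%N) (saturation M (I_ k)).
    apply: nakayama => //; first exact: local_prime.
    move=> p Pp; apply: sub_saturation; first exact: local_prime.
    have [i [_ [Ii [r ->] E]]] : I_ k.+1 p by apply/P'I/PP'.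
    exists i, (r * x k); split=> // K iK HK; rewrite mulrC; apply: HK => //.
    apply: (prime_cancel (prP 0%N isT) nPx); rewrite mulrC.
    have -> : r * x k = p - i by rewrite E addrC addKr.
    by apply: idealB => //; exact: IP.
  by move=> p /H [s nMs]; exact: local_cancel.
have EP a : I_ k a <-> P 0%N a by split; [exact: IP | exact: P0I].
split=> [|_ /EP //].
have [_ nP1 PM] := prP 0%N isT; split=> [//|/EP //|a b /EP /PM].
by rewrite !EP.
Qed.

(** As [x k] is prime modulo [I_ k], it can be divided out of the cofactor of an
    element that it does not divide. *)
Lemma initial_dvd k l j b e : (k < d)%N -> ~ I_ k.+1 b ->
  (exists f, I_ k (b ^+ j * e - x k ^+ l * f)) ->
  exists f, I_ k (e - x k ^+ l * f).
Proof.
move=> kd nb; have [prI /(_ kd) nx] := initial_ideal_prime (ltnW kd).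
have [prI1 _] := initial_ideal_prime kd.
elim: l e => [|l IHl] e [f Hf].
  by exists e; rewrite expr0 mul1r subrr; exact: ideal0.
have [i [_ [Ii [e1 ->] Ee]]] : I_ k.+1 e.
  apply: (prime_cancel (a := b ^+ j) prI1); first by move=> /prime_exp - /(_ prI1).
  rewrite -(subrK (x k ^+ l.+1 * f) (b ^+ j * e)); apply: idealD => //.
    exact: initial_idealS.
  rewrite exprSr -mulrA; apply: idealM => //; apply: idealMr => //.
  exact: initial_ideal_gen.
have [|f1 Hf1] := IHl e1.
  exists f; apply: (prime_cancel prI nx).
  have -> : x k * (b ^+ j * e1 - x k ^+ l * f) =
    b ^+ j * e - x k ^+ l.+1 * f - b ^+ j * i by rewrite Ee exprS; ring.
  by apply: idealB => //; exact: idealM.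
exists f1; have -> : e - x k ^+ l.+1 * f1 = i + x k * (e1 - x k ^+ l * f1).
  by rewrite Ee exprS; ring.
by apply: idealD => //; exact: idealM.
Qed.

(** By Krull's intersection theorem, [x k] divides a nonzero element of the
    quotient only finitely many times. *)
Lemma initial_order k y : (k < d)%N -> ~ I_ k y ->
  exists n z, I_ k (y - x k ^+ n * z) /\ ~ I_ k.+1 z.
Proof.
move=> kd nIy; apply: contrapT => H; apply: nIy.
apply: (krull_intersection (initial_ideal_ideal k) (xM k)); elim=> [|n [r Hr]].
  by exists y; rewrite expr0 mul1r subrr; exact: ideal0.
have [i [_ [Ii [t ->] E]]] : I_ k.+1 r.
  by apply: contrapT => nr; apply: H; exists n, r.
exists t; have -> : y - x k ^+ n.+1 * t = y - x k ^+ n * r + x k ^+ n * i.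
  by rewrite E exprSr; ring.
by apply: idealD => //; exact: idealM.
Qed.

(** [a / b] is almost integral over [R / I_ k], with denominator [c]. *)
Definition almost_integral k c a b :=
  forall j, exists e, I_ k (c * a ^+ j - b ^+ j * e).

Lemma almost_integral_shift k c a b r : almost_integral k c a b ->
  almost_integral k c (a - b * r) b.
Proof.
move=> H j; suff /(_ 0%N j) : forall i j, exists e,
    I_ k (c * a ^+ i * (a - b * r) ^+ j - b ^+ (i + j) * e) by rewrite expr0 mulr1.
move=> {j}i j; elim: j i => [|j IHj] i.
  by have [e He] := H i; exists e; rewrite expr0 mulr1 addn0.
have [e1 He1] := IHj i.+1; have [e2 He2] := IHj i.
exists (e1 - r * e2).
have -> : c * a ^+ i * (a - b * r) ^+ j.+1 - b ^+ (i + j.+1) * (e1 - r * e2) =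
    (c * a ^+ i.+1 * (a - b * r) ^+ j - b ^+ (i.+1 + j) * e1) -
    (b * r) * (c * a ^+ i * (a - b * r) ^+ j - b ^+ (i + j) * e2).
  by rewrite addnS addSn !exprS; ring.
by apply: idealB => //; exact: idealM.
Qed.

(** The quotients [R / I_ k] are completely integrally closed, by descending
    induction: an almost integral [a / b] with [b] prime to [x = x k] is in
    [R] modulo [x]; subtracting that value leaves [x] times an almost
    integral fraction with the same denominator. *)
Lemma almost_integral_dvd k c a b : (k <= d)%N -> ~ I_ k b -> ~ I_ k c ->
  almost_integral k c a b -> exists r, I_ k (a - b * r).
Proof.
move=> kd; move: {2}(d - k)%N (erefl (d - k)%N) => e.
elim: e k kd a b c => [|e IHe] k kd a b c.
  move/eqP; rewrite subn_eq0 => dk; have {kd dk}-> : k = d by apply/eqP; rewrite eqn_leq kd.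
  move=> nb _ _; have [|b' bb'] := @local_unit b; first by move=> /genM.
  by exists (b' * a); rewrite mulrA bb' mul1r subrr; exact: ideal0.
move=> dke; have {}kd : (k < d)%N by rewrite -subn_gt0 dke.
have dke' : (d - k.+1 = e)%N by rewrite subnS dke.
have [prI /(_ kd) nx] := initial_ideal_prime (ltnW kd).
have [prI1 _] := initial_ideal_prime kd.
have nxn n : ~ I_ k (x k ^+ n) by move=> /(prime_exp prI).
have main a' b' c' : ~ I_ k.+1 b' -> ~ I_ k.+1 c' ->
    almost_integral k c' a' b' -> exists r, I_ k (a' - b' * r).
  move=> nb nc H.
  have : ideal_sum (I_ k) (principal b') a'.
    apply: (krull_intersection _ (xM k)); first exact: sum_principal_ideal.
    move=> n; elim: n a' H => [|n IHn] a' H.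
      exists a'; rewrite expr0 mul1r subrr.
      by apply: ideal0; exact: sum_principal_ideal.
    have [|r [i [_ [Ii [a1 ->] E]]]] := IHe k.+1 kd a' b' c' dke' nb nc.
      by move=> j; have [f Hf] := H j; exists f; exact: initial_idealS.
    have H1 : almost_integral k c' a1 b'.
      move=> j; have [f Hf] := almost_integral_shift r H j.
      have [|f1 Hf1] := @initial_dvd k j j b' f kd nb.
        exists (c' * a1 ^+ j).
        have -> : b' ^+ j * f - x k ^+ j * (c' * a1 ^+ j) =
          (c' * ((i + a1 * x k) ^+ j - (a1 * x k) ^+ j)) -
          (c' * (a' - b' * r) ^+ j - b' ^+ j * f).
          by rewrite E [(a1 * _) ^+ j]exprMn; ring.
        apply: idealB => //; apply: idealM => //; rewrite subrXX.
        by apply: idealMr => //; rewrite addrK.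
      exists f1; apply: (prime_cancel prI (nxn j)).
      have -> : x k ^+ j * (c' * a1 ^+ j - b' ^+ j * f1) =
         (c' * (a' - b' * r) ^+ j - b' ^+ j * f) + b' ^+ j * (f - x k ^+ j * f1) -
         (c' * ((i + a1 * x k) ^+ j - (a1 * x k) ^+ j)).
        by rewrite E [(a1 * _) ^+ j]exprMn; ring.
      apply: idealB => //; first by apply: idealD => //; exact: idealM.
      apply: idealM => //; rewrite subrXX.
      by apply: idealMr => //; rewrite addrK.
    have [s [i2 [_ [Ii2 [t ->] E2]]]] := IHn a1 H1.
    exists s, (i + x k * i2), ((r + x k * t) * b'); split.
    + by apply: idealD => //; exact: idealM.
    + by exists (r + x k * t).
    + rewrite exprS -mulrA; apply: (@addIr _ (x k * (x k ^+ n * s) - b' * r)).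
      rewrite addrA subrK E.
      by rewrite -[a1](subrK (x k ^+ n * s)) E2; ring.
  move=> [i [_ [Ii [r ->] ->]]]; exists r.
  by have -> : i + r * b' - b' * r = i by ring.
move=> nb nc H.
have [n [b' [Hb nb']]] := initial_order kd nb.
have [l [c' [Hc nc']]] := initial_order kd nc.
case: (pselect (I_ k a)) => [Ia|na]; first by exists 0; rewrite mulr0 subr0.
have [p [a' [Ha na']]] := initial_order kd na.
(* Modulo [I_ k] the hypothesis reads x^(l + p j) c' a'^j = x^(n j) b'^j e. *)
have H' j : exists e, I_ k (x k ^+ l * c' * (x k ^+ p * a') ^+ j - (x k ^+ n * b') ^+ j * e).
  have [f Hf] := H j; exists f.
  have -> : x k ^+ l * c' * (x k ^+ p * a') ^+ j - (x k ^+ n * b') ^+ j * f =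
     (c * a ^+ j - b ^+ j * f) - (c - x k ^+ l * c') * a ^+ j
     - x k ^+ l * c' * (a ^+ j - (x k ^+ p * a') ^+ j)
     + (b ^+ j - (x k ^+ n * b') ^+ j) * f by ring.
  rewrite !subrXX; apply: idealD => //; last by apply: idealMr => //; apply: idealMr.
  apply: idealB => //; last by apply: idealM => //; apply: idealMr.
  by apply: idealB => //; apply: idealMr.
have np : (n <= p)%N.
  rewrite leqNgt; apply/negP => pn; have [f Hf] := H' l.+1.
  have : I_ k (c' * a' ^+ l.+1 - x k ^+ (n * l.+1 - (l + p * l.+1)) * (b' ^+ l.+1 * f)).
    have hE : (l + p * l.+1 < n * l.+1)%N.
      by apply: (@leq_trans (p.+1 * l.+1)); [rewrite mulSn ltn_add2r | rewrite leq_mul2r].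
    apply: (prime_cancel prI (nxn (l + p * l.+1)%N)).
    rewrite mulrBr [X in _ - X]mulrA -exprD subnKC ?(ltnW hE) // exprD !exprM.
    by move: Hf; rewrite !exprMn; congr I_; ring.
  have : (0 < n * l.+1 - (l + p * l.+1))%N.
    rewrite subn_gt0; apply: (@leq_trans (p.+1 * l.+1)); first by rewrite mulSn ltn_add2r.
    by rewrite leq_mul2r.
  case: (_ - _)%N => [//|m] _ Hm.
  have : I_ k.+1 (c' * a' ^+ l.+1).
    rewrite -(subrK (x k ^+ m.+1 * (b' ^+ l.+1 * f)) (c' * _)); apply: idealD => //.
      exact: initial_idealS.
    rewrite exprS -mulrA; apply: idealMr => //; exact: initial_ideal_gen.
  by move=> /(prime_cancel prI1 nc') /(prime_exp prI1).
have [|r Hr] := main (x k ^+ (p - n) * a') b' c' nb' nc'.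
  move=> j; have [f Hf] := H' j.
  have Hf' : I_ k (x k ^+ l * (c' * (x k ^+ (p - n) * a') ^+ j) - b' ^+ j * f).
    apply: (prime_cancel prI (nxn (n * j)%N)); move: Hf.
    by rewrite -{1}(subnK np) exprD !exprMn !exprM; congr I_; ring.
  have [|f1 Hf1] := @initial_dvd k l j b' f kd nb'.
    exists (c' * (x k ^+ (p - n) * a') ^+ j).
    by rewrite -opprB; exact: idealN.
  exists f1; apply: (prime_cancel prI (nxn l)).
  have -> : x k ^+ l * (c' * (x k ^+ (p - n) * a') ^+ j - b' ^+ j * f1) =
     (x k ^+ l * (c' * (x k ^+ (p - n) * a') ^+ j) - b' ^+ j * f) +
     b' ^+ j * (f - x k ^+ l * f1) by ring.
  by apply: idealD => //; exact: idealM.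
exists r; have -> : a - b * r = (a - x k ^+ p * a') - (b - x k ^+ n * b') * r
    + x k ^+ n * (x k ^+ (p - n) * a' - b' * r).
  by rewrite -{1}(subnK np) exprD; ring.
apply: idealD => //; last exact: idealM.
by apply: idealB => //; exact: idealMr.
Qed.

End RegularSystem.
End LocalRing.

(** A root [a / b] of a monic quadratic polynomial is almost integral with
    denominator [b]. *)
Lemma regular_local_integrally_closed (R : idomainType) (a b u v : R) :
  regular_local R -> b != 0 -> a ^+ 2 = u * a * b - v * b ^+ 2 ->
  exists r, a = b * r.
Proof.
move=> [noethR [M [locM [d [[[P chP] _] [x gx]]]]]] b0 E.
pose y k := oapp x 0 (insub k).
have iM : is_ideal M by case: locM => -[].
have My k : M (y k).
  rewrite /y; case: insubP => [i _ _|_] /=; last exact: ideal0.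
  apply/gx; exists (fun j => (j == i)%:R); rewrite (bigD1 i) //= eqxx mul1r.
  by rewrite big1 ?addr0 // => j /negPf ->; rewrite mul0r.
have genM : ideal_sub M (initial_ideal y d).
  have mono k l : (k <= l)%N -> ideal_sub (initial_ideal y k) (initial_ideal y l).
    move=> /subnK <-; elim: (l - k)%N => [//|m IHm] c /IHm.
    by rewrite addSn; exact: initial_idealS.
  move=> _ /gx[c ->]; apply: ideal_sumr => [|i]; first exact: initial_ideal_ideal.
  apply: idealM; first exact: initial_ideal_ideal.
  apply: (mono i.+1) => //; rewrite -[x i]/(oapp x 0 (Some i)) -[Some i]valK.
  exact: initial_ideal_gen.
have [||||r /eqP] := @almost_integral_dvd R M noethR locM d y genM My
    (ex_intro _ P chP) 0 b a b.
- by [].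
- exact/eqP.
- exact/eqP.
- (* (a / b)^j is a linear combination of 1 and a / b. *)
  move=> j; suff [p [q Hpq]] : exists p q, b * a ^+ j = b ^+ j * (p * b + q * a).
    by exists (p * b + q * a); rewrite Hpq /= subrr.
  elim: j => [|j [p [q Hpq]]]; first by exists 1, 0; ring.
  exists (- (q * v)), (p + q * u).
  rewrite exprSr mulrA Hpq; transitivity (b ^+ j * (p * b * a + q * a ^+ 2)); first by ring.
  by rewrite E (exprS b j); ring.
- by rewrite /= subr_eq0 => /eqP ->; exists r.
Qed.

(** * The center of the even Clifford algebra *)

Section Zeta.
Variables (A : comNzRingType) (D : algType A).
Implicit Types (a b c : nat -> A) (U V : nat -> D) (W z : D).

Lemma comm_alg W (r : A) : GRing.comm W r%:A.
Proof. by rewrite /GRing.comm mulr_algl mulr_algr. Qed.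

Lemma comm_scale W z (r : A) : GRing.comm W z -> GRing.comm W (r *: z).
Proof. by rewrite /GRing.comm -scalerAr -scalerAl => ->. Qed.

(** Generator of the center of the even Clifford algebra of the orthogonal sum
    of the forms [a i x^2 + b i x y + c i y^2], whose basis vectors become
    [U i] and [V i]. A single block contributes the root [U i * V i] of
    [t^2 - b i t + a i c i], and two centers with roots [z] and [zeta], of
    traces [b] and [B], are composed by the formula that multiplies
    [2 z - b] and [2 zeta - B]. *)
Fixpoint zeta b U V k : D :=
  if k is k'.+1 then
    (U k' * V k') * zeta b U V k' +
    ((b k')%:A - U k' * V k') * ((\prod_(i < k') b i)%:A - zeta b U V k')
  else 1.

(** Product of [zeta] and its conjugate, that is the constant term of the
    quadratic equation of [zeta]; the linear one is the product of the [b i]. *)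
Fixpoint zeta_norm a b c k : A :=
  if k is k'.+1 then
    (a k' * c k') * (\prod_(i < k') b i) ^+ 2 + (b k') ^+ 2 * zeta_norm a b c k'
    - 4%:R * (a k' * c k') * zeta_norm a b c k'
  else 0.

Lemma zeta_norm_disc a b c k :
  (\prod_(i < k) b i) ^+ 2 - 4%:R * zeta_norm a b c k =
  \prod_(i < k) (b i ^+ 2 - 4%:R * (a i * c i)).
Proof.
elim: k => [|k IHk]; first by rewrite !big_ord0 /= expr1n mulr0 subr0.
by rewrite !big_ord_recr /= -IHk; ring.
Qed.

Definition anticomm W z := W * z = - (z * W).

Lemma anticommC W z : anticomm W z -> anticomm z W.
Proof. by rewrite /anticomm => ->; rewrite opprK. Qed.

Record clifford_rel m a b c U V : Prop := CliffordRel {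
  rel_U : forall i, (i < m)%N -> U i * U i = (a i)%:A;
  rel_V : forall i, (i < m)%N -> V i * V i = (c i)%:A;
  rel_UV : forall i, (i < m)%N -> U i * V i + V i * U i = (b i)%:A;
  rel_UU : forall i j, (i < m)%N -> (j < m)%N -> i != j -> anticomm (U i) (U j);
  rel_VV : forall i j, (i < m)%N -> (j < m)%N -> i != j -> anticomm (V i) (V j);
  rel_UVa : forall i j, (i < m)%N -> (j < m)%N -> i != j -> anticomm (U i) (V j)
}.

Lemma anticomm_comm_mul W z z' :
  anticomm W z -> anticomm W z' -> GRing.comm W (z * z').
Proof.
rewrite /anticomm /GRing.comm => H H'.
by rewrite mulrA H mulNr -(mulrA z W) H' mulrN opprK mulrA.
Qed.

Lemma zeta_comm b U V k W :
  (forall i, (i < k)%N -> anticomm W (U i) /\ anticomm W (V i)) ->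
  GRing.comm W (zeta b U V k).
Proof.
elim: k => [|k IHk] H /=; first exact: commr1.
have [HU HV] := H k (ltnSn _).
have Cz : GRing.comm W (U k * V k) by exact: anticomm_comm_mul.
have Ck : GRing.comm W (zeta b U V k) by apply: IHk => i ik; apply: H; exact: ltnW.
apply: commrD; first exact: commrM.
by apply: commrM; apply: commrB => //; exact: comm_alg.
Qed.

Lemma compose_conj z w (s t : A) :
  (s * t)%:A - (z * w + (s%:A - z) * (t%:A - w)) =
  (s%:A - z) * w + z * (t%:A - w).
Proof.
have -> : (s * t)%:A = s%:A * t%:A :> D by rewrite mulr_algl scalerA.
rewrite !mulrBl !mulrBr !opprD !opprK !addrA.
by rewrite [LHS](ACl (1*3*4*2*5*6)) /= subrr add0r.

Qed.

Lemma compose_conj_l W z w (s t : A) :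
  W * z = (s%:A - z) * W -> GRing.comm W w ->
  W * (z * w + (s%:A - z) * (t%:A - w)) =
  ((s * t)%:A - (z * w + (s%:A - z) * (t%:A - w))) * W.
Proof.
move=> Hz Hw; rewrite compose_conj.
have Hz' : W * (s%:A - z) = z * W.
  by rewrite mulrBr Hz mulrBl opprB addrC -addrA -(comm_alg W s) addNr addr0.
have Hw' : W * (t%:A - w) = (t%:A - w) * W.
  by rewrite mulrBr mulrBl Hw comm_alg.
by rewrite [LHS]mulrDr [RHS]mulrDl [W * (z * w)]mulrA [W * (_ * _)]mulrA Hz Hz' -!mulrA Hw Hw'.
Qed.

Lemma compose_conj_r W z w (s t : A) :
  GRing.comm W z -> W * w = (t%:A - w) * W ->
  W * (z * w + (s%:A - z) * (t%:A - w)) =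
  ((s * t)%:A - (z * w + (s%:A - z) * (t%:A - w))) * W.
Proof.
move=> Hz Hw; rewrite compose_conj.
have Hw' : W * (t%:A - w) = w * W.
  by rewrite mulrBr Hw mulrBl opprB addrC -addrA -(comm_alg W t) addNr addr0.
have Hz' : W * (s%:A - z) = (s%:A - z) * W.
  by rewrite mulrBr mulrBl Hz comm_alg.
by rewrite [LHS]mulrDr [RHS]mulrDl [W * (z * w)]mulrA [W * (_ * _)]mulrA Hz Hz' -!mulrA Hw Hw' addrC.
Qed.

Lemma compose_norm z w (s t p q : A) : GRing.comm z w ->
  z * (s%:A - z) = p%:A -> w * (t%:A - w) = q%:A ->
  (z * w + (s%:A - z) * (t%:A - w)) *
  ((s * t)%:A - (z * w + (s%:A - z) * (t%:A - w))) =
  (p * t ^+ 2 + s ^+ 2 * q - 4%:R * p * q)%:A.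
Proof.
move=> Czw Hp Hq; rewrite compose_conj.
set z' := s%:A - z in Hp *; set w' := t%:A - w in Hq *.
have Czw' : GRing.comm z w' by apply: commrB => //; exact: comm_alg.
have Cz'w : GRing.comm z' w.
  by apply/commr_sym/commrB; [exact: comm_alg | exact: commr_sym].
have Cz'w' : GRing.comm z' w'.
  by apply: commrB => //; exact: comm_alg.
have Czz' : GRing.comm z z' by apply: commrB => //; exact: comm_alg.
have Cww' : GRing.comm w w' by apply: commrB => //; exact: comm_alg.
have Hs : z + z' = s%:A by rewrite addrC subrK.
have Ht : w + w' = t%:A by rewrite addrC subrK.
clearbody z' w'.
have Hz2 : z * z + z' * z' = (s ^+ 2 - 2%:R * p)%:A.
  have : (z + z') * (z + z') = (s ^+ 2)%:A.
    by rewrite ?Hs ?Ht mulr_algl scalerA.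
  rewrite mulrDl !mulrDr -Czz' Hp => E.
  by rewrite scalerBl -E mulr_natl mulr2n scalerDl opprD !addrA [RHS](ACl (1*2*5*3*6*4)) /= !addrK.
have Hw2 : w * w + w' * w' = (t ^+ 2 - 2%:R * q)%:A.
  have : (w + w') * (w + w') = (t ^+ 2)%:A.
    by rewrite ?Hs ?Ht mulr_algl scalerA.
  rewrite mulrDl !mulrDr -Cww' Hq => E.
  by rewrite scalerBl -E mulr_natl mulr2n scalerDl opprD !addrA [RHS](ACl (1*2*5*3*6*4)) /= !addrK.
have -> : (z * w + z' * w') * (z' * w + z * w') =
   p%:A * (w * w + w' * w') + (z * z + z' * z') * q%:A.
  rewrite !mulrDl !mulrDr.
  have -> : z * w * (z' * w) = p%:A * (w * w) by rewrite -mulrA (mulrA w) -Cz'w !mulrA Hp.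
  have -> : z' * w' * (z * w') = p%:A * (w' * w').
    by rewrite -mulrA (mulrA w') -Czw' !mulrA -Czz' Hp.
  have -> : z * w * (z * w') = z * z * q%:A.
    by rewrite -mulrA (mulrA w) -Czw -Hq !mulrA.
  have -> : z' * w' * (z' * w) = z' * z' * q%:A.
    by rewrite -mulrA (mulrA w') -Cz'w' -Hq Cww' !mulrA.
  by rewrite !addrA (ACl (1*4*2*3)).
rewrite Hw2 Hz2 !mulr_algl !scalerA -scalerDl.
by congr (_ *: _); ring.
Qed.

Section Relations.
Variables (m : nat) (a b c : nat -> A) (U V : nat -> D).
Hypothesis rel : clifford_rel m a b c U V.

(** A vector of the last block conjugates the factor [U k * V k] and commutes
    with the other one; a vector of an earlier block does the opposite. *)
Lemma zeta_gen_conj k i W : (k <= m)%N -> (i < k)%N -> W = U i \/ W = V i ->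
  W * zeta b U V k = ((\prod_(j < k) b j)%:A - zeta b U V k) * W.
Proof.
move=> + + HW; elim: k => [//|k IHk] km ik.
have anti j : (j < k.+1)%N -> i != j -> anticomm W (U j) /\ anticomm W (V j).
  move=> jk ij; have [im jm] : (i < m)%N /\ (j < m)%N.
    by split; [exact: leq_trans ik km | exact: leq_trans jk km].
  case: HW => ->; split.
  - exact: (rel_UU rel).
  - exact: (rel_UVa rel).
  - by apply/anticommC/(rel_UVa rel); rewrite // eq_sym.
  - exact: (rel_VV rel).
rewrite big_ord_recr /= [_ * b k]mulrC.
move: ik; rewrite ltnS leq_eqVlt => /orP[/eqP ik|ik]; last first.
  apply: compose_conj_r; last by apply: IHk => //; exact: ltnW.
  have [||HU HV] := anti k; [by [] | by rewrite neq_ltn ik | exact: anticomm_comm_mul].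
subst i; apply: compose_conj_l; last first.
  by apply: zeta_comm => i ik; apply: anti; [exact: ltnW | rewrite neq_ltn ik orbT].
have VU : V k * U k = (b k)%:A - U k * V k by rewrite -(rel_UV rel km) addrC addKr.
case: HW => ->; last by rewrite mulrA VU.
by rewrite [RHS]mulrBl -[U k * V k * U k]mulrA VU [U k * (_ - _)]mulrBr opprB
  -(comm_alg (U k) (b k)) addrC subrK.
Qed.

Lemma zeta_normP k : (k <= m)%N ->
  zeta b U V k * ((\prod_(j < k) b j)%:A - zeta b U V k) = (zeta_norm a b c k)%:A.
Proof.
elim: k => [|k IHk] km; first by rewrite /= big_ord0 scale1r subrr mulr0 scale0r.
rewrite big_ord_recr /= [_ * b k]mulrC; apply: compose_norm.
- apply/commr_sym/commrM; apply/commr_sym/zeta_comm => i ik.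
    have im : (i < m)%N by exact: leq_trans ik (ltnW km).
    have ki : k != i by rewrite neq_ltn ik orbT.
    by split; [exact: (rel_UU rel) | exact: (rel_UVa rel)].
  have im : (i < m)%N by exact: leq_trans ik (ltnW km).
  have ki : k != i by rewrite neq_ltn ik orbT.
  split; last exact: (rel_VV rel).
  by apply/anticommC/(rel_UVa rel); rewrite // eq_sym.
- rewrite mulrBr mulr_algr -[U k * V k * (U k * V k)]mulrA.
  have VU : V k * U k = (b k)%:A - U k * V k by rewrite -(rel_UV rel km) addrC addKr.
  rewrite (mulrA (V k)) VU mulrBl mulr_algl -[U k * V k * V k]mulrA (rel_V rel km).
  rewrite mulr_algr mulrBr -!scalerAr (rel_U rel km).
  by rewrite opprB addrC subrK scalerA mulrC.
- exact: IHk (ltnW km).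
Qed.

End Relations.

Lemma zeta_linear_conj U V k (B : A) (x y : nat -> A) Z :
  (forall i, (i < k)%N -> U i * Z = (B%:A - Z) * U i /\ V i * Z = (B%:A - Z) * V i) ->
  (\sum_(i < k) (x i *: U i + y i *: V i)) * Z =
  (B%:A - Z) * \sum_(i < k) (x i *: U i + y i *: V i).
Proof.
move=> H; rewrite mulr_suml mulr_sumr; apply: eq_bigr => i _.
have [HU HV] := H i (ltn_ord i).
by rewrite mulrDl mulrDr -!scalerAl -!scalerAr HU HV.
Qed.

Lemma clifford_even_zeta n (iota : 'cV[A]_n -> D) b U V k :
  (forall i, (i < k)%N -> exists v w, U i = iota v /\ V i = iota w) ->
  clifford_even iota (zeta b U V k).
Proof.
have mulE x y : clifford_even iota x -> clifford_even iota y -> clifford_even iota (x * y).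
  move=> + Hy; elim=> [r|x1 x2 _ H1 _ H2|v w x1 _ H1].
  - rewrite mulr_algl; elim: Hy r => [s|y1 y2 _ H1 _ H2|v w y1 _ H1] r.
    + by rewrite scalerA; constructor.
    + by rewrite scalerDr; constructor.
    + by rewrite scalerAr; constructor.
  - by rewrite mulrDl; constructor.
  - by rewrite -mulrA; constructor.
have oppE x : clifford_even iota x -> clifford_even iota (- x).
  by move=> Hx; rewrite -scaleN1r -mulr_algl; apply: mulE => //; constructor.
elim: k => [|k IHk] H /=; first by rewrite -[1]scale1r; constructor.
have [v [w [-> ->]]] := H k (ltnSn _).
have Ez : clifford_even iota (iota v * iota w).
  rewrite -[X in clifford_even _ X]mulr1 -[1]scale1r; do 2!constructor.
have Ek := IHk (fun i ik => H i (ltnW ik)).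
constructor; apply: mulE => //.
  by constructor; [constructor | exact: oppE].
by constructor; [constructor | exact: oppE].
Qed.

End Zeta.

Lemma zeta_morph (A A' : comNzRingType) (f : {rmorphism A -> A'})
  (D : algType A) (D' : algType A') (F : {rmorphism D -> D'})
  (b : nat -> A) (U V : nat -> D) k : (forall r, F r%:A = (f r)%:A) ->
  F (zeta b U V k) = zeta (f \o b) (F \o U) (F \o V) k.
Proof.
move=> FA; elim: k => [|k IHk] /=; first exact: rmorph1.
by rewrite rmorphD !rmorphM !rmorphB !rmorphM !FA IHk rmorph_prod.
Qed.

Lemma eq_zeta (A : comNzRingType) (D : algType A) (b b' : nat -> A)
  (U V U' V' : nat -> D) k :
  (forall i, (i < k)%N -> [/\ b i = b' i, U i = U' i & V i = V' i]) ->
  zeta b U V k = zeta b' U' V' k.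
Proof.
elim: k => [//|k IHk] H /=; have [-> -> ->] := H k (ltnSn _).
rewrite IHk; last by move=> i ik; apply: H; exact: ltnW.
congr (_ + _ * (_%:A - _)); apply: eq_bigr => i _.
by have [] := H i (ltnW (ltn_ord i)).
Qed.

(** * The Clifford algebra of the split form *)

Fixpoint spin_dim m : nat :=
  if m is m'.+1 then (spin_dim m' + (spin_dim m').+1)%N else 0%N.

(** The Clifford algebra of [x_0 y_0 + ... + x_(m-1) y_(m-1)]; the successor
    exposes its ring structure, and makes two copies of the index type of [m]
    convertible to that of [m.+1]. *)
Notation split_clifford A m := 'M[A]_((spin_dim m).+1).

Section SplitClifford.
Variable A : comNzRingType.
Local Notation Cl m := (split_clifford A m).

Definition cblock m (a b c d : Cl m) : Cl m.+1 := block_mx a b c d.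

Lemma cblockP m (M : Cl m.+1) : exists a b c d, M = cblock a b c d.
Proof.
exists (ulsubmx (M : 'M[A]_((spin_dim m).+1 + (spin_dim m).+1)%N)).
exists (ursubmx (M : 'M[A]_((spin_dim m).+1 + (spin_dim m).+1)%N)).
exists (dlsubmx (M : 'M[A]_((spin_dim m).+1 + (spin_dim m).+1)%N)).
exists (drsubmx (M : 'M[A]_((spin_dim m).+1 + (spin_dim m).+1)%N)).
by rewrite /cblock submxK.
Qed.

Lemma cblock_inj m (a b c d a' b' c' d' : Cl m) :
  cblock a b c d = cblock a' b' c' d' -> [/\ a = a', b = b', c = c' & d = d'].
Proof.
pose k := (spin_dim m).+1.
by move=> H; have [] := @eq_block_mx A k k k k _ _ _ _ _ _ _ _ H.
Qed.

Lemma cblockM m (a b c d a' b' c' d' : Cl m) :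
  cblock a b c d * cblock a' b' c' d' =
  cblock (a * a' + b * c') (a * b' + b * d') (c * a' + d * c') (c * b' + d * d').
Proof.
pose k := (spin_dim m).+1; exact: (@mulmx_block A k k k k k k a b c d a' b' c' d').
Qed.

Lemma cblockD m (a b c d a' b' c' d' : Cl m) :
  cblock a b c d + cblock a' b' c' d' = cblock (a + a') (b + b') (c + c') (d + d').
Proof.
pose k := (spin_dim m).+1; exact: (@add_block_mx A k k k k a b c d a' b' c' d').
Qed.

Lemma cblockN m (a b c d : Cl m) :
  - cblock a b c d = cblock (- a) (- b) (- c) (- d).
Proof. pose k := (spin_dim m).+1; exact: (@opp_block_mx A k k k k a b c d). Qed.

Lemma cblockZ m r (a b c d : Cl m) :
  r *: cblock a b c d = cblock (r *: a) (r *: b) (r *: c) (r *: d).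
Proof. pose k := (spin_dim m).+1; exact: (@scale_block_mx A k k k k r a b c d). Qed.

Lemma cblock1 m : 1 = cblock 1 0 0 1 :> Cl m.+1.
Proof. pose k := (spin_dim m).+1; exact: (@scalar_mx_block A k k 1). Qed.

Lemma cblock0 m : 0 = cblock 0 0 0 0 :> Cl m.+1.
Proof. pose k := (spin_dim m).+1; exact: (esym (@block_mx0 A k k k k)). Qed.

Lemma cblock_alg m r : r%:A = cblock r%:A 0 0 r%:A :> Cl m.+1.
Proof. by rewrite cblock1 cblockZ !scaler0. Qed.

Lemma alg_inj m (r s : A) : r%:A = s%:A :> Cl m -> r = s.
Proof. by move/matrixP/(_ ord0 ord0); rewrite !mxE eqxx !mulr1. Qed.

(** The action of a vector on the spin module: the last hyperbolic pair
    exchanges two copies of the smaller spin module, and the sign makes the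
    other vectors anticommute with that pair. *)
Fixpoint split_vector m (x y : nat -> A) : Cl m :=
  if m is m'.+1 then
    cblock (split_vector m' x y) (x m')%:A (y m')%:A (- split_vector m' x y)
  else 0.

Lemma eq_split_vector m (x y x' y' : nat -> A) :
  (forall i, (i < m)%N -> x i = x' i /\ y i = y' i) ->
  split_vector m x y = split_vector m x' y'.
Proof.
elim: m => [//|m IHm] H /=; have [-> ->] := H m (ltnSn _).
by rewrite IHm // => i im; apply: H; exact: ltnW.
Qed.

Lemma split_vectorD m (x y x' y' : nat -> A) :
  split_vector m (fun i => x i + x' i) (fun i => y i + y' i) =
  split_vector m x y + split_vector m x' y'.
Proof.
by elim: m => [|m IHm] /=; rewrite ?addr0 // cblockD IHm opprD -!scalerDl.
Qed.

Lemma split_vectorZ m r (x y : nat -> A) :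
  split_vector m (fun i => r * x i) (fun i => r * y i) = r *: split_vector m x y.
Proof.
by elim: m => [|m IHm] /=; rewrite ?scaler0 // cblockZ IHm scalerN !scalerA.
Qed.

Lemma split_vector_sqr m (x y : nat -> A) :
  split_vector m x y * split_vector m x y = (\sum_(i < m) x i * y i)%:A.
Proof.
elim: m => [|m IHm] /=; first by rewrite mul0r big_ord0 scale0r.
rewrite cblockM mulrNN IHm big_ord_recr /= !mulr_algl !mulr_algr !scalerN !addrN.
by rewrite cblock_alg !scalerA -!scalerDl [y m * _]mulrC addrC.
Qed.

Definition coord_fun m : nat -> A := fun i => (i == m)%:R.

Definition split_U m i : Cl m := split_vector m (coord_fun i) (fun=> 0).
Definition split_V m i : Cl m := split_vector m (fun=> 0) (coord_fun i).

Lemma split_vector0 m : split_vector m (fun=> 0) (fun=> 0) = 0.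
Proof. by elim: m => [//|m IHm] /=; rewrite IHm oppr0 scale0r -cblock0. Qed.

Lemma split_U_last m : split_U m.+1 m = cblock 0 1 0 0.
Proof.
rewrite /split_U /= {2}/coord_fun eqxx scale1r scale0r.
rewrite (_ : split_vector m _ _ = 0) ?oppr0 // -[RHS](split_vector0 m).
by apply: eq_split_vector => i im; rewrite /coord_fun ltn_eqF.
Qed.

Lemma split_V_last m : split_V m.+1 m = cblock 0 0 1 0.
Proof.
rewrite /split_V /= {2}/coord_fun eqxx scale1r scale0r.
rewrite (_ : split_vector m _ _ = 0) ?oppr0 // -[RHS](split_vector0 m).
by apply: eq_split_vector => i im; rewrite /coord_fun ltn_eqF.
Qed.

Lemma split_U_init m i : (i < m)%N -> split_U m.+1 i = cblock (split_U m i) 0 0 (- split_U m i).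
Proof. by move=> im; rewrite /split_U /= [coord_fun i m]/coord_fun gtn_eqF // !scale0r. Qed.

Lemma split_V_init m i : (i < m)%N -> split_V m.+1 i = cblock (split_V m i) 0 0 (- split_V m i).
Proof. by move=> im; rewrite /split_V /= [coord_fun i m]/coord_fun gtn_eqF // !scale0r. Qed.

Lemma split_vector_sum m (x y : nat -> A) :
  split_vector m x y = \sum_(i < m) (x i *: split_U m i + y i *: split_V m i).
Proof.
elim: m => [|m IHm]; first by rewrite big_ord0.
rewrite big_ord_recr /= split_U_last split_V_last !cblockZ cblockD !scaler0 !addr0 !add0r.
rewrite (eq_bigr (fun i : 'I_m => cblock (x i *: split_U m i + y i *: split_V m i) 0 0
   (- (x i *: split_U m i + y i *: split_V m i)))); last first.
  move=> i _; rewrite split_U_init ?split_V_init // !cblockZ cblockD !scaler0 !addr0.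
  by rewrite !scalerN -opprD.
have -> : \sum_(i < m) cblock (x i *: split_U m i + y i *: split_V m i) 0 0
   (- (x i *: split_U m i + y i *: split_V m i)) =
   cblock (split_vector m x y) 0 0 (- split_vector m x y).
  rewrite IHm -sumrN; elim/big_rec3: _ => [|i u v w _ ->]; first exact: cblock0.
  by rewrite cblockD !addr0.
by rewrite cblockD !addr0 !add0r.
Qed.

(** The parity idempotent, which projects the spin module onto one half. *)
Definition parity m : Cl m := zeta (fun=> 1) (split_U m) (split_V m) m.

Lemma parityS m : parity m.+1 = cblock (parity m) 0 0 (1 - parity m).
Proof.
rewrite /parity /= split_U_last split_V_last !cblockM !mulr0 !mul0r !addr0 mulr1.
have H k : (k <= m)%N -> zeta (fun=> 1) (split_U m.+1) (split_V m.+1) k =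
  cblock (zeta (fun=> 1) (split_U m) (split_V m) k) 0 0
         (zeta (fun=> 1) (split_U m) (split_V m) k).
  elim: k => [_|k IHk km] /=; first exact: cblock1.
  rewrite IHk ?(ltnW km) // split_U_init // split_V_init //.
  rewrite cblockM !(mulr0, mul0r, addr0, add0r) mulrNN.
  rewrite !cblock_alg !cblockN !cblockD !oppr0 !addr0 !cblockM.
  by rewrite !(mulr0, mul0r, addr0, add0r) cblockD !addr0.
rewrite H //; set e := zeta _ _ _ _; rewrite big1 // !scale1r cblock1 !cblockN !cblockD.
rewrite !(oppr0, add0r, addr0, subrr) !cblockM cblockD.
by rewrite !(mulr0, mul0r, mul1r, addr0, add0r).
Qed.

Lemma split_rel m : clifford_rel m (fun=> 0) (fun=> 1) (fun=> 0) (split_U m) (split_V m).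
Proof.
have polar x y x' y' : split_vector m x y * split_vector m x' y' +
    split_vector m x' y' * split_vector m x y =
    (\sum_(i < m) (x i * y' i + x' i * y i))%:A.
  have := split_vector_sqr m (fun i => x i + x' i) (fun i => y i + y' i).
  rewrite split_vectorD mulrDl !mulrDr !split_vector_sqr => E.
  apply: (@addrI _ (\sum_(i < m) x i * y i)%:A); apply: (@addIr _ (\sum_(i < m) x' i * y' i)%:A).
  rewrite !addrA in E *; rewrite E -!scalerDl -!big_split /=.
  by congr (_%:A); apply: eq_bigr => i _; ring.
have anti x y x' y' : (forall i, x i * y' i + x' i * y i = 0) ->
    anticomm (split_vector m x y) (split_vector m x' y').
  move=> H; have := polar x y x' y'; rewrite big1 // scale0r => /eqP.
  by rewrite addr_eq0 => /eqP.
split=> [i im|i im|i im|i j im jm ij|i j im jm ij|i j im jm ij].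
- by rewrite split_vector_sqr big1 // => k _; rewrite mulr0.
- by rewrite split_vector_sqr big1 // => k _; rewrite mul0r.
- rewrite polar (bigD1 (Ordinal im)) //= big1 => [|k]; rewrite /coord_fun.
    by rewrite eqxx mulr1 mul0r !addr0.
  by rewrite -val_eqE /= => /negPf ->; rewrite !mul0r addr0.
- by apply: anti => k; rewrite mulr0 mulr0 addr0.
- by apply: anti => k; rewrite !mul0r addr0.
- apply: anti => k; rewrite mul0r addr0 /coord_fun -natrM mulnb.
  by have [->|_] := eqVneq (k : nat) i; rewrite ?(negPf ij).
Qed.

Lemma parity_conj m (x y : nat -> A) :
  split_vector m x y * parity m = (1 - parity m) * split_vector m x y.
Proof.
rewrite split_vector_sum -[1 in RHS]scale1r; apply: zeta_linear_conj => i im.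
have := zeta_gen_conj (split_rel m) (leqnn m) im.
by rewrite big1 // => H; split; apply: H; [left|right].
Qed.

Lemma parity_idem m : parity m * parity m = parity m.
Proof.
have := zeta_normP (split_rel m) (leqnn m); rewrite big1 // -/(parity m).
have -> : zeta_norm (fun=> 0) (fun=> 1) (fun=> 0) m = 0 :> A.
  by elim: m => //= k ->; rewrite !(mulr0, mul0r, addr0, subr0).
by rewrite scale0r scale1r mulrBr mulr1 => /eqP; rewrite subr_eq0 => /eqP.
Qed.

(** The matrix units of the last hyperbolic pair are products of vectors, and
    multiplying by [e f - f e] turns a vector of the smaller space into a block
    scalar matrix; so the vectors generate the algebra. *)
Lemma split_clifford_ind m (P : Cl m -> Prop) :
  (forall r, P r%:A) -> (forall M N, P M -> P N -> P (M + N)) ->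
  (forall M N, P M -> P N -> P (M * N)) -> (forall x y, P (split_vector m x y)) ->
  forall M, P M.
Proof.
elim: m P => [|m IHm] P PA PD PM PV M.
  have -> : M = (M 0 0)%:A by apply/matrixP=> i j; rewrite !ord1 !mxE mulr1.
  exact: PA.
pose e := cblock 0 1 0 0 : Cl m.+1; pose f := cblock 0 0 1 0 : Cl m.+1.
have Pe : P e by rewrite /e -split_U_last; exact: PV.
have Pf : P f by rewrite /f -split_V_last; exact: PV.
have Eef : e * f = cblock 1 0 0 0 by rewrite cblockM !(mulr0, mul0r, mul1r, addr0, add0r).
have Efe : f * e = cblock 0 0 0 1 by rewrite cblockM !(mulr0, mul0r, mul1r, addr0, add0r).
have Pd (c : Cl m) : P (cblock c 0 0 c).
  apply: (IHm (fun c => P (cblock c 0 0 c))) => [r|c1 c2 H1 H2|c1 c2 H1 H2|x y].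
  - by rewrite -cblock_alg.
  - by have := PD _ _ H1 H2; rewrite cblockD !addr0.
  - by have := PM _ _ H1 H2; rewrite cblockM !(mulr0, mul0r, addr0, add0r).
  - have -> : cblock (split_vector m x y) 0 0 (split_vector m x y) =
        split_vector m.+1 (fun i => if i == m then 0 else x i)
          (fun i => if i == m then 0 else y i) * (e * f + (- 1)%:A * (f * e)).
      rewrite /= !eqxx !scale0r Eef Efe mulr_algl cblockZ cblockD cblockM.
      rewrite !(scaler0, mulr0, mul0r, addr0, add0r) mulr1 scaleN1r mulrNN mulr1.
      by congr cblock; apply: eq_split_vector => i im; rewrite ltn_eqF.
    by repeat first [exact: PV | exact: Pe | exact: Pf | exact: PA | apply PM | apply PD].
have [a [b [c [d ->]]]] := cblockP M.
have -> : cblock a b c d = cblock a 0 0 a * (e * f) + cblock b 0 0 b * e +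
    (cblock c 0 0 c * f + cblock d 0 0 d * (f * e)).
  by rewrite Eef Efe !cblockM !cblockD !(mulr0, mul0r, mulr1, addr0, add0r).
by repeat first [exact: Pd | exact: Pe | exact: Pf | apply PM | apply PD].
Qed.

(** By induction: commuting with [e f] makes [M] block diagonal, commuting
    with [v (e + f)] for [v] in the smaller quadratic space makes the two
    blocks conjugate under [v]. *)
Lemma even_centralizer m (M : Cl m.+1) :
  (forall x y x' y', GRing.comm M (split_vector m.+1 x y * split_vector m.+1 x' y')) ->
  exists s t, M = s%:A + t *: parity m.+1.
Proof.
elim: m M => [|m IHm] M HM.
  have [a [b [c [d E]]]] := cblockP M; rewrite {M}E in HM *.
  have := HM (coord_fun 0%N) (fun=> 0) (fun=> 0) (coord_fun 0%N).
  rewrite -/(split_U 1 0) -/(split_V 1 0) split_U_last split_V_last /GRing.comm.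
  rewrite !cblockM !(mulr0, mul0r, mulr1, mul1r, addr0, add0r) => /cblock_inj[_ b0 c0 _].
  exists (d 0 0), (a 0 0 - d 0 0).
  rewrite parityS cblock_alg cblockZ cblockD !(scaler0, addr0) -b0 c0 /parity /=.
  have scal (N : Cl 0) : (N 0 0)%:A = N.
    by apply/matrixP=> i j; rewrite !ord1 !mxE mulr1.
  by rewrite subrr scaler0 addr0 -scalerDl addrC subrK !scal.
have [a [b [c [d E]]]] := cblockP M; rewrite {M}E in HM *.
have := HM (coord_fun m.+1) (fun=> 0) (fun=> 0) (coord_fun m.+1).
rewrite -/(split_U m.+2 m.+1) -/(split_V m.+2 m.+1) split_U_last split_V_last /GRing.comm.
rewrite !cblockM !(mulr0, mul0r, mulr1, mul1r, addr0, add0r) => /cblock_inj[_ b0 c0 _].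
subst b c; pose tr (x : nat -> A) i := if i == m.+1 then 0 else x i.
have Etr x y : split_vector m.+2 (tr x) (tr y) =
    cblock (split_vector m.+1 x y) 0 0 (- split_vector m.+1 x y).
  have E : split_vector m.+1 (tr x) (tr y) = split_vector m.+1 x y.
    by apply: eq_split_vector => i im; rewrite /tr ltn_eqF.
  transitivity (cblock (split_vector m.+1 (tr x) (tr y)) (tr x m.+1)%:A
    (tr y m.+1)%:A (- split_vector m.+1 (tr x) (tr y))) => //.
  by rewrite E /tr eqxx scale0r.
have Hv x y : a * split_vector m.+1 x y = split_vector m.+1 x y * d.
  have := HM (tr x) (tr y) (coord_fun m.+1) (coord_fun m.+1).
  rewrite Etr (_ : split_vector m.+2 (coord_fun _) _ = cblock 0 1 1 0); last first.
    have := split_vectorD m.+2 (coord_fun m.+1) (fun=> 0) (fun=> 0) (coord_fun m.+1).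
    rewrite -/(split_U m.+2 m.+1) -/(split_V m.+2 m.+1) split_U_last split_V_last.
    rewrite cblockD !(addr0, add0r) => <-.
    by apply: eq_split_vector => i _; rewrite addr0 add0r.
  rewrite /GRing.comm !cblockM !(mulr0, mul0r, mulr1, mul1r, addr0, add0r).
  by move=> /cblock_inj[].
have [|s [t Ea]] := IHm a.
  move=> x y x' y'; have := HM (tr x) (tr y) (tr x') (tr y').
  rewrite !Etr /GRing.comm !cblockM !(mulr0, mul0r, addr0, add0r).
  by move=> /cblock_inj[].
exists s, t; rewrite parityS cblock_alg cblockZ cblockD !(scaler0, addr0) -Ea.
pose w := split_vector m.+1 (coord_fun 0%N) (coord_fun 0%N).
have ww : w * w = 1.
  rewrite split_vector_sqr (bigD1 ord0) //= big1 => [|k]; rewrite /coord_fun.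
    by rewrite eqxx mulr1 addr0 scale1r.
  by rewrite -val_eqE /= => /negPf ->; rewrite mulr0.
suff -> : d = s%:A + t *: (1 - parity m.+1) by [].
rewrite -[d]mul1r -ww -mulrA -Hv mulrA Ea mulrDr mulr_algr -scalerAr mulrDl.
rewrite -!scalerAl ww; congr (_ + _ *: _).
by rewrite parity_conj -mulrA ww mulr1.
Qed.

End SplitClifford.

(** * Quadratic forms in coordinates *)

Section Forms.
Variables (A : comNzRingType) (n : nat).
Implicit Types (q : 'M[A]_n) (v w : 'cV[A]_n).

Lemma qform_mx q v : qform q v = (v^T *m q *m v) 0 0.
Proof.
rewrite /qform mxE exchange_big; apply: eq_bigr => j _.
rewrite mxE mulr_suml; apply: eq_bigr => i _.
by rewrite !mxE [v i 0 * _]mulrC.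
Qed.

Definition polar q v w : A := (v^T *m (q + q^T) *m w) 0 0.

Lemma qformD q v w : qform q (v + w) = qform q v + qform q w + polar q v w.
Proof.
have E : (v^T *m q^T *m w) 0 0 = (w^T *m q *m v) 0 0.
  have -> : v^T *m q^T *m w = (w^T *m q *m v)^T by rewrite !trmx_mul trmxK mulmxA.
  by rewrite mxE.
have -> : polar q v w = (v^T *m q *m w) 0 0 + (w^T *m q *m v) 0 0.
  by rewrite -E /polar mulmxDr mulmxDl mxE.
have addE (X Y : 'M[A]_1) : (X + Y) 0 0 = X 0 0 + Y 0 0 by rewrite mxE.
rewrite !qform_mx [(v + w)^T]linearD /= !mulmxDl !mulmxDr !addE.
ring.
Qed.

Lemma qform_mulmx q (P : 'M[A]_n) v : qform q (P *m v) = qform (P^T *m q *m P) v.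
Proof. by rewrite !qform_mx trmx_mul !mulmxA. Qed.

Lemma qform_delta q i : qform q (delta_mx i 0) = q i i.
Proof.
by rewrite qform_mx trmx_delta -rowE -colE !mxE.
Qed.

Lemma polar_delta q i j : polar q (delta_mx i 0) (delta_mx j 0) = q i j + q j i.
Proof. by rewrite /polar trmx_delta -rowE -colE !mxE. Qed.

(** The values at [e_i] and [e_i + e_j] give the diagonal and the
    symmetrization, which in turn determine the form. *)
Lemma qform_eqP q q' : (forall v, qform q v = qform q' v) <->
  (forall i, q i i = q' i i) /\ q + q^T = q' + q'^T.
Proof.
split=> [E|[Ed Es] v].
  split=> [i|]; first by rewrite -!qform_delta.
  apply/matrixP=> i j; rewrite !mxE -!polar_delta.
  have := E (delta_mx i 0 + delta_mx j 0); rewrite !qformD !E.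
  by move/addrI.
have diag (p : 'M[A]_n) : qform p v =
    \sum_i p i i * v i 0 ^+ 2 + \sum_(i < n) \sum_(j < n | (i < j)%N) (p + p^T) i j * (v i 0 * v j 0).
  transitivity (\sum_(i < n) (p i i * v i 0 ^+ 2 + \sum_(j < n | (i < j)%N) p i j * (v i 0 * v j 0)
     + \sum_(j < n | (j < i)%N) p i j * (v i 0 * v j 0))).
    apply: eq_bigr => i _; rewrite (bigD1 i) //= -addrA; congr (_ + _).
      by rewrite expr2 mulrA.
    rewrite (bigID (fun j : 'I_n => (i < j)%N)) /=; congr (_ + _).
      apply: eq_big => [j|j _]; last by rewrite mulrA.
      by rewrite andbC -val_eqE /=; case: ltngtP.
    apply: eq_big => [j|j _]; last by rewrite mulrA.
    by rewrite -val_eqE /=; case: ltngtP.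
  rewrite 2!big_split /= -addrA; congr (_ + _).
  rewrite [X in _ + X](exchange_big_dep predT) //= -big_split /=.
  apply: eq_bigr => i _; rewrite -big_split /=; apply: eq_bigr => j _.
  by rewrite !mxE mulrDl [v j 0 * _]mulrC.
rewrite !diag Es; congr (_ + _); apply: eq_bigr => i _; by rewrite Ed.
Qed.

(** Coordinates numbered by natural numbers, vanishing from [n] on. *)
Definition coord v (i : nat) : A := oapp (fun k => v k 0) 0 (insub i).

Definition basis_vector (i : nat) : 'cV[A]_n := \col_k (k == i :> nat)%:R.

Lemma coord_ord v (i : 'I_n) : coord v i = v i 0.
Proof. by rewrite /coord valK. Qed.

Lemma coordD v w i : coord (v + w) i = coord v i + coord w i.
Proof. by rewrite /coord; case: insubP => [k _ _|_] /=; rewrite ?mxE ?addr0. Qed.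

Lemma coordZ r v i : coord (r *: v) i = r * coord v i.
Proof. by rewrite /coord; case: insubP => [k _ _|_] /=; rewrite ?mxE ?mulr0. Qed.

Lemma basis_vector_ord (i : 'I_n) : basis_vector i = delta_mx i 0.
Proof. by apply/matrixP=> k l; rewrite !mxE ord1 eqxx andbT. Qed.

Lemma coord_sum v : v = \sum_(i < n) coord v i *: basis_vector i.
Proof.
apply/matrixP=> k l; rewrite summxE ord1 (bigD1 k) //= big1 => [|j jk].
  by rewrite !mxE eqxx mulr1 addr0 coord_ord.
by rewrite !mxE eq_sym -val_eqE /= in jk *; rewrite (negPf jk) mulr0.
Qed.

(** Reflections, permutations and block diagonal changes of variables all have
    at most two entries in each row, in the columns [i] and [t i]. *)
Definition sparse_mx (p r : nat -> A) (t : nat -> nat) : 'M[A]_n :=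
  \matrix_(i, j) (p i *+ (i == j) + r i *+ (val j == t (val i))).

Lemma sparse_mxE p r t v i : (i < n)%N -> (t i < n)%N ->
  coord (sparse_mx p r t *m v) i = p i * coord v i + r i * coord v (t i).
Proof.
move=> ni nk; rewrite -[in LHS](erefl : val (Ordinal ni) = i) coord_ord mxE.
under eq_bigr => l _ do rewrite mxE mulrDl.
rewrite big_split /=; congr (_ + _).
  rewrite (bigD1 (Ordinal ni)) //= eqxx big1 => [|l].
    by rewrite addr0 -coord_ord.
  by rewrite eq_sym => /negPf ->; rewrite mulr0n mul0r.
rewrite (bigD1 (Ordinal nk)) //= eqxx big1 => [|l].
  by rewrite addr0 -coord_ord.
by rewrite -val_eqE /= => /negPf ->; rewrite mulr0n mul0r.
Qed.

(** The form [sum_i a_i x_i^2 + sum_(i < n/2) b_i x_i x_(n/2 + i)]. *)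
Definition block_form (a b : nat -> A) : 'M[A]_n :=
  \matrix_(i, j) (a i *+ (i == j) + b i *+ ((i < n./2)%N && (j == n./2 + i :> nat)%N)).

Lemma half_add_lt i : (i < n./2)%N -> (n./2 + i < n)%N.
Proof. by move=> im; rewrite -[X in (_ < X)%N]odd_double_half -addnn; lia. Qed.

Lemma qform_block (a b : nat -> A) v : qform (block_form a b) v =
  \sum_(i < n) a i * coord v i ^+ 2 +
  \sum_(i < n./2) b i * (coord v i * coord v (n./2 + i)%N).
Proof.
transitivity (\sum_(i < n) (a i * coord v i ^+ 2 +
    (b i * (coord v i * coord v (n./2 + i)%N)) *+ (i < n./2)%N)).
  apply: eq_bigr => i _.
  under eq_bigr => j _ do rewrite mxE !mulrDl.
  rewrite big_split /= (bigD1 i) //= eqxx mulr1n big1 => [|j]; last first.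
    by rewrite eq_sym => /negPf ->; rewrite mulr0n !mul0r.
  rewrite addr0 !coord_ord expr2 mulrA; congr (_ + _).
  case: ltnP => im /=; last by apply: big1 => j _; rewrite mulr0n !mul0r.
  pose k := Ordinal (half_add_lt im).
  rewrite (bigD1 k) //= eqxx mulr1n big1 => [|j].
    by rewrite addr0 (coord_ord v k) mulrA.
  by rewrite -val_eqE /= => /negPf ->; rewrite mulr0n !mul0r.
rewrite big_split /=; congr (_ + _).
have mn : (n./2 <= n)%N by lia.
rewrite (big_ord_widen _ (fun i => b i * (coord v i * coord v (n./2 + i)%N)) mn).
by rewrite [RHS]big_mkcond; apply: eq_bigr => i _; case: ifP.
Qed.

Lemma split_form_block : split_form A n = block_form (fun i => (odd n && (i == n.-1))%:R) (fun=> 1).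
Proof.
apply/matrixP=> i j; rewrite !mxE.
have [->|ij] := eqVneq i j.
  have -> : (j < n./2)%N && (j == n./2 + j :> nat)%N = false.
    by apply/negP=> /andP[? /eqP]; lia.
  by rewrite /= andbb addr0.
have -> : [&& odd n, i == n.-1 :> nat & j == n.-1 :> nat] = false.
  apply/negP=> /and3P[_ /eqP Hi /eqP Hj]; case/eqP: ij.
  by apply/val_inj; rewrite /= Hi.
by rewrite orbF mulr0n add0r.
Qed.

End Forms.

(** * The universal property and the Dickson kernel *)

Section CliffordUniversal.
Variable A : comNzRingType.
Local Notation Cl m := (split_clifford A m).

Lemma lrmorphism_of (C D : algType A) (F : C -> D) :
  (forall x y, F (x + y) = F x + F y) -> (forall r x, F (r *: x) = r *: F x) ->
  F 1 = 1 -> (forall x y, F (x * y) = F x * F y) ->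
  exists G : {lrmorphism C -> D}, G =1 F.
Proof.
move=> FD FZ F1 FM.
have aF : zmod_morphism F.
  by move=> x y; rewrite FD -[- y]scaleN1r FZ scaleN1r.
pose m1 := GRing.isZmodMorphism.Build C D F aF.
pose m2 := GRing.isMonoidMorphism.Build C D F (conj F1 FM).
pose m3 := GRing.isScalable.Build A C D *:%R F FZ.
pose G : {lrmorphism C -> D} := HB.pack F m1 m2 m3.
by exists G.
Qed.

(** With [e], [f] the images of the last hyperbolic pair, [e f - f e] commutes
    with the vectors orthogonal to that pair up to sign; multiplying these
    vectors by it makes them commute with the matrix units [e f], [e], [f],
    [f e]. *)
Lemma split_clifford_lift m (D : algType A) (e f : nat -> D) :
  clifford_rel m (fun=> 0) (fun=> 1) (fun=> 0) e f ->
  exists F : {lrmorphism Cl m -> D}, forall x y,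
    F (split_vector m x y) = \sum_(i < m) (x i *: e i + y i *: f i).
Proof.
elim: m e f => [|m IHm] e f rel.
  have [||||F HF] := @lrmorphism_of (Cl 0) D (fun M => (M 0 0)%:A).
  - by move=> x y; rewrite mxE scalerDl.
  - by move=> r x; rewrite mxE scalerA.
  - by rewrite mxE scale1r.
  - by move=> x y; rewrite mxE big_ord1 mulr_algl scalerA.
  by exists F => x y; rewrite HF mxE scale0r big_ord0.
set E := e m; set F := f m.
have EE : E * E = 0 by rewrite (rel_U rel) // scale0r.
have FF : F * F = 0 by rewrite (rel_V rel) // scale0r.
have EF : E * F + F * E = 1 by rewrite (rel_UV rel) // scale1r.
have FE : F * E = 1 - E * F by rewrite -EF addrC addKr.
have EFE : E * F * E = E by rewrite -mulrA FE mulrBr mulr1 mulrA EE mul0r subr0.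
have FEF : F * E * F = F by rewrite FE mulrBl mul1r -mulrA FF mulr0 subr0.
pose g := E * F - F * E.
have gE : g * E = E by rewrite mulrBl EFE -mulrA EE mulr0 subr0.
have Eg : E * g = - E by rewrite mulrBr !mulrA EE mul0r sub0r EFE.
have gF : g * F = - F by rewrite mulrBl FEF -mulrA FF mulr0 sub0r.
have Fg : F * g = F by rewrite mulrBr !mulrA FEF FF mul0r subr0.
have gg : g * g = 1.
  by rewrite {2}/g mulrBr !mulrA gE gF mulNr opprK.
have anti W : anticomm W E -> anticomm W F ->
    [/\ GRing.comm W g, GRing.comm E (g * W) & GRing.comm F (g * W)].
  move=> WE WF; have Wg : GRing.comm W g.
    by apply: commrB; apply: anticomm_comm_mul.
  split=> //.
    by rewrite /GRing.comm mulrA Eg -mulrA WE mulrN mulrA gE mulNr.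
  by rewrite /GRing.comm mulrA Fg -mulrA WF mulrN mulrA gF mulNr opprK.
have lt1 i : (i < m)%N -> (i < m.+1)%N by exact: ltnW.
have neqm i : (i < m)%N -> i != m by move=> im; rewrite neq_ltn im.
have anti_e i : (i < m)%N -> anticomm (e i) E /\ anticomm (e i) F.
  move=> im; split.
    exact: (rel_UU rel (lt1 _ im) (ltnSn m) (neqm _ im)).
  exact: (rel_UVa rel (lt1 _ im) (ltnSn m) (neqm _ im)).
have anti_f i : (i < m)%N -> anticomm (f i) E /\ anticomm (f i) F.
  move=> im; split; last exact: (rel_VV rel (lt1 _ im) (ltnSn m) (neqm _ im)).
  apply/anticommC/(rel_UVa rel (ltnSn m) (lt1 _ im)); rewrite eq_sym; exact: neqm.
have gmul W W' : anticomm W E -> anticomm W F -> g * W * (g * W') = W * W'.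
  move=> WE WF; have [Wg _ _] := anti W WE WF.
  by rewrite -[g * W]Wg mulrA -[W * g * g]mulrA gg mulr1.
have [|phi Hphi] := IHm (fun i => g * e i) (fun i => g * f i).
  split=> [i im|i im|i im|i j im jm ij|i j im jm ij|i j im jm ij]; rewrite /anticomm.
  - by have [? ?] := anti_e _ im; rewrite gmul // (rel_U rel (lt1 _ im)).
  - by have [? ?] := anti_f _ im; rewrite gmul // (rel_V rel (lt1 _ im)).
  - have [? ?] := anti_f _ im; have [? ?] := anti_e _ im.
    by rewrite !gmul // (rel_UV rel (lt1 _ im)).
  - have [? ?] := anti_e _ im; have [? ?] := anti_e _ jm.
    by rewrite !gmul //; exact: (rel_UU rel (lt1 _ im) (lt1 _ jm)).
  - have [? ?] := anti_f _ im; have [? ?] := anti_f _ jm.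
    by rewrite !gmul //; exact: (rel_VV rel (lt1 _ im) (lt1 _ jm)).
  - have [? ?] := anti_e _ im; have [? ?] := anti_f _ jm.
    by rewrite !gmul //; exact: (rel_UVa rel (lt1 _ im) (lt1 _ jm)).
have phiC M : GRing.comm E (phi M) /\ GRing.comm F (phi M).
  elim/split_clifford_ind: M => [r|M N [? ?] [? ?]|M N [? ?] [? ?]|x y].
  - by rewrite linearZ /= rmorph1; split; exact: comm_alg.
  - by rewrite linearD; split; apply: commrD.
  - by rewrite rmorphM; split; apply: commrM.
  - rewrite Hphi; split; apply: commr_sum => i _; apply: commrD.
    + by apply: comm_scale; have [] := anti_e i (ltn_ord i) => ? ?; case: (anti (e i)).
    + by apply: comm_scale; have [] := anti_f i (ltn_ord i) => ? ?; case: (anti (f i)).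
    + by apply: comm_scale; have [] := anti_e i (ltn_ord i) => ? ?; case: (anti (e i)).
    + by apply: comm_scale; have [] := anti_f i (ltn_ord i) => ? ?; case: (anti (f i)).
pose k := (spin_dim m).+1.
pose G (M : 'M[A]_(k + k)) : D := phi (ulsubmx M) * (E * F) + phi (ursubmx M) * E +
  phi (dlsubmx M) * F + phi (drsubmx M) * (F * E).
have GB a b c d : G (cblock a b c d) = phi a * (E * F) + phi b * E + phi c * F + phi d * (F * E).
  by rewrite /G /cblock block_mxKul block_mxKur block_mxKdl block_mxKdr.
have [||||H HG] := @lrmorphism_of (Cl m.+1) D G.
- move=> M N; have [a [b [c [d ->]]]] := cblockP M; have [a' [b' [c' [d' ->]]]] := cblockP N.
  rewrite cblockD !GB !linearD /= !mulrDl !addrA.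
  by rewrite [LHS](ACl (1*3*5*7*2*4*6*8)).
- move=> r M; have [a [b [c [d ->]]]] := cblockP M.
  by rewrite cblockZ !GB !linearZ /= -!scalerAl !scalerDr.
- by rewrite cblock1 GB !linear0 !mul0r !addr0 rmorph1 !mul1r EF.
- move=> M N; have [a [b [c [d ->]]]] := cblockP M; have [a' [b' [c' [d' ->]]]] := cblockP N.
  rewrite cblockM !GB.
  have PD x y : phi (x + y) = phi x + phi y by rewrite linearD.
  have PM x y : phi (x * y) = phi x * phi y by rewrite rmorphM.
  have CE x : phi x * E = E * phi x by case: (phiC x).
  have CF x : phi x * F = F * phi x by case: (phiC x).
  rewrite !PD !PM.
  (* Products of two of the matrix units, moved past [phi]. *)
  have X u v x y : (forall z, u * phi z = phi z * u) ->
      phi x * u * (phi y * v) = phi x * phi y * (u * v).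
    by move=> Hu; rewrite mulrA -(mulrA (phi x)) Hu !mulrA.
  have CEF x : E * F * phi x = phi x * (E * F) by rewrite -mulrA -CF !mulrA CE.
  have CFE x : F * E * phi x = phi x * (F * E) by rewrite -mulrA -CE !mulrA CF.
  have CE' x : E * phi x = phi x * E by rewrite CE.
  have CF' x : F * phi x = phi x * F by rewrite CF.
  rewrite !mulrDl !mulrDr !X //.
  have -> : E * F * (E * F) = E * F by rewrite mulrA EFE.
  have -> : E * F * F = 0 by rewrite -mulrA FF mulr0.
  have -> : E * F * (F * E) = 0 by rewrite mulrA -(mulrA E) FF mulr0 mul0r.
  have -> : E * (E * F) = 0 by rewrite mulrA EE mul0r.
  have -> : E * (F * E) = E by rewrite mulrA.
  have -> : F * (E * F) = F by rewrite mulrA.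
  have -> : F * (F * E) = 0 by rewrite mulrA FF mul0r.
  have -> : F * E * (E * F) = 0 by rewrite mulrA -(mulrA F) EE mulr0 mul0r.
  have -> : F * E * E = 0 by rewrite -mulrA EE mulr0.
  have -> : F * E * (F * E) = F * E by rewrite mulrA FEF.
  rewrite EFE FEF EE FF !mulr0 !addr0 !add0r !addrA.
  by rewrite [LHS](ACl (1*3*2*4*5*7*6*8)).
exists H => x y; rewrite HG [split_vector _ _ _]/= GB big_ord_recr /=.
have phiA r : phi r%:A = r%:A by rewrite linearZ /= rmorph1.
have phiN M : phi (- M) = - phi M by rewrite linearN.
rewrite !phiA phiN !mulr_algl mulNr [LHS](ACl ((1*4)*(2*3))) /=.
congr (_ + _); rewrite -mulrBr -/g Hphi mulr_suml; apply: eq_bigr => i _.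
have ggV W : anticomm W E -> anticomm W F -> g * W * g = W.
  by move=> WE WF; have [Wg _ _] := anti W WE WF; rewrite -[g * W]Wg -mulrA gg mulr1.
have [? ?] := anti_e i (ltn_ord i); have [? ?] := anti_f i (ltn_ord i).
by rewrite mulrDl -!scalerAl !ggV.
Qed.

Lemma split_clifford_ext m (D : algType A) (F G : {lrmorphism Cl m -> D}) :
  (forall x y, F (split_vector m x y) = G (split_vector m x y)) -> F =1 G.
Proof.
move=> E; have KA (K : {lrmorphism Cl m -> D}) r : K r%:A = r%:A.
  by rewrite linearZ /= rmorph1.
have KD (K : {lrmorphism Cl m -> D}) x y : K (x + y) = K x + K y by rewrite linearD.
have KM (K : {lrmorphism Cl m -> D}) x y : K (x * y) = K x * K y by rewrite rmorphM.
elim/split_clifford_ind => [r|M N HM HN|M N HM HN|//].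
- by rewrite !KA.
- by rewrite !KD HM HN.
- by rewrite !KM HM HN.
Qed.

Section CliffordForm.
Variables (n : nat) (q : 'M[A]_n) (D : algType A) (j : {linear 'cV[A]_n -> D}).
Hypothesis jq : forall v, j v * j v = (qform q v)%:A.

Lemma clifford_polar v w : j v * j w + j w * j v = (polar q v w)%:A.
Proof.
have := jq (v + w); rewrite linearD mulrDl !mulrDr !jq qformD !scalerDl.
rewrite !addrA -!addrA => /addrI; rewrite addrA [RHS]addrC => /addIr.
by [].
Qed.

Lemma clifford_rel_block (a b : nat -> A) : ~~ odd n -> q = block_form n a b ->
  clifford_rel n./2 a b (fun i => a (n./2 + i)%N) (fun i => j (basis_vector A n i))
    (fun i => j (basis_vector A n (n./2 + i))).
Proof.
move=> evn Eq.
have anti i k : (i < n)%N -> (k < n)%N -> i != k -> k != (n./2 + i)%N ->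
    i != (n./2 + k)%N -> anticomm (j (basis_vector A n i)) (j (basis_vector A n k)).
  move=> ni nk ik ki1 ki2; apply/eqP; rewrite /anticomm -addr_eq0 clifford_polar.
  rewrite -[i]/(val (Ordinal ni)) -[k]/(val (Ordinal nk)) !basis_vector_ord polar_delta.
  rewrite Eq !mxE -!val_eqE /= [k == i]eq_sym (negPf ik) (negPf ki1) (negPf ki2).
  by rewrite !andbF !addr0 scale0r.
have sq i : (i < n)%N -> j (basis_vector A n i) * j (basis_vector A n i) = (a i)%:A.
  move=> ni; rewrite jq -[i]/(val (Ordinal ni)) basis_vector_ord qform_delta Eq mxE eqxx /=.
  by rewrite (_ : _ && _ = false) ?addr0 //; apply/negP; lia.
split=> [i im|i im|i im|i k im km ik|i k im km ik|i k im km ik].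
- by apply: sq; lia.
- by apply: sq; lia.
- have ni : (i < n)%N by lia. have nk : (n./2 + i < n)%N by lia.
  rewrite clifford_polar -[X in basis_vector _ _ X]/(val (Ordinal ni)) basis_vector_ord.
  rewrite -[(_ + i)%N]/(val (Ordinal nk)) basis_vector_ord polar_delta Eq !mxE -!val_eqE /=.
  rewrite im eqxx (_ : (i == _) = false) /=; last by apply/negP; lia.
  rewrite (_ : (_ == i) = false) /=; last by apply/negP; lia.
  by rewrite (_ : _ && _ = false) ?addr0 ?add0r ?addr0 //; apply/negP; lia.
- by apply: anti; lia.
- by apply: anti; lia.
- by apply: anti; lia.
Qed.

End CliffordForm.

Section SplitEven.
Variable n : nat.
Hypothesis evn : ~~ odd n.

(** The coordinates [i] and [n./2 + i] form the [i]-th hyperbolic pair. *)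
Definition split_iota (v : 'cV[A]_n) : Cl n./2 :=
  split_vector n./2 (coord v) (fun i => coord v (n./2 + i)).

Fact split_iota_linear : linear split_iota.
Proof.
move=> r v w; rewrite /split_iota -split_vectorZ -split_vectorD.
by apply: eq_split_vector => i _; rewrite !coordD !coordZ.
Qed.

HB.instance Definition _ := GRing.isLinear.Build A 'cV[A]_n (Cl n./2) *:%R
  split_iota split_iota_linear.

Lemma qform_split (v : 'cV[A]_n) :
  qform (split_form A n) v = \sum_(i < n./2) coord v i * coord v (n./2 + i).
Proof.
rewrite split_form_block qform_block big1 ?add0r => [|i _].
  by apply: eq_bigr => i _; rewrite mul1r.
by rewrite (negPf evn) mul0r.
Qed.

Lemma split_iota_sqr v : split_iota v * split_iota v = (qform (split_form A n) v)%:A.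
Proof. by rewrite split_vector_sqr qform_split. Qed.

Lemma coord_basis_vector i k : (k < n)%N -> coord (basis_vector A n i) k = (k == i)%:R.
Proof. by move=> kn; rewrite -[k in LHS]/(val (Ordinal kn)) coord_ord mxE. Qed.

Lemma split_iota_U i : (i < n./2)%N -> split_iota (basis_vector A n i) = split_U A n./2 i.
Proof.
move=> im; apply: eq_split_vector => k km; rewrite !coord_basis_vector; try lia.
by split=> //; rewrite (_ : _ == _ = false) //; apply/negP; lia.
Qed.

Lemma split_iota_V i : (i < n./2)%N ->
  split_iota (basis_vector A n (n./2 + i)) = split_V A n./2 i.
Proof.
move=> im; apply: eq_split_vector => k km; rewrite !coord_basis_vector; try lia.
by split=> //; [rewrite (_ : _ == _ = false) //; apply/negP; lia | rewrite eqn_add2l].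
Qed.

Lemma split_vector_iota x y : exists v, split_vector n./2 x y = split_iota v.
Proof.
exists (\sum_(i < n./2) (x i *: basis_vector A n i + y i *: basis_vector A n (n./2 + i))).
rewrite split_vector_sum linear_sum; apply: eq_bigr => i _.
by rewrite linearD !linearZ /= split_iota_U // split_iota_V.
Qed.

Lemma split_form_even : split_form A n = block_form n (fun=> 0) (fun=> 1).
Proof.
by rewrite split_form_block; apply/matrixP=> i j; rewrite !mxE (negPf evn).
Qed.

Lemma half_sum (V : nmodType) (F : nat -> V) :
  \sum_(i < n) F i = \sum_(i < n./2) (F i + F (n./2 + i)%N).
Proof.
rewrite big_split /= -(big_mkord xpredT F) (@big_cat_nat _ _ _ n./2) //=; last by lia.
rewrite big_mkord; congr (_ + _).
rewrite -{1}[n./2]add0n big_addn big_mkord (_ : (n - n./2 = n./2)%N); last by lia.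
by apply: eq_bigr => i _; rewrite addnC.
Qed.

Lemma half_coord_sum (v : 'cV[A]_n) : v = \sum_(i < n./2)
  (coord v i *: basis_vector A n i + coord v (n./2 + i) *: basis_vector A n (n./2 + i)).
Proof.
by rewrite [LHS]coord_sum (half_sum (fun i => coord v i *: basis_vector A n i)).
Qed.

Lemma split_is_clifford : is_clifford (split_form A n) split_iota.
Proof.
split=> [v|D j jq]; first exact: split_iota_sqr.
have rel := clifford_rel_block jq evn split_form_even.
have [F HF] := split_clifford_lift rel.
have Fj v : F (split_iota v) = j v.
  rewrite HF [in RHS](half_coord_sum v) linear_sum; apply: eq_bigr => i _.
  by rewrite linearD !linearZ.
exists F; split=> // F' HF'; apply: split_clifford_ext => x y.
by have [v ->] := split_vector_iota x y; rewrite Fj HF'.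
Qed.

Lemma orthogonal_lift (g : 'M[A]_n) : Defs.orthogonal g ->
  exists F : {lrmorphism Cl n./2 -> Cl n./2}, forall v, F (split_iota v) = split_iota (g *m v).
Proof.
move=> [_ og]; pose j v := split_iota (g *m v).
have jL : linear j by move=> r v w; rewrite /j mulmxDr -scalemxAr linearP.
pose jl := GRing.isLinear.Build A 'cV[A]_n (Cl n./2) *:%R j jL.
pose J : {linear 'cV[A]_n -> Cl n./2} := HB.pack j jl.
have [_ /(_ _ J) []] := split_is_clifford; first by move=> v; rewrite split_iota_sqr og.
by move=> F [HF _]; exists F.
Qed.

Lemma parity_even : clifford_even split_iota (parity A n./2).
Proof.
apply: clifford_even_zeta => i im.
exists (basis_vector A n i), (basis_vector A n (n./2 + i)).
by rewrite split_iota_U // split_iota_V.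
Qed.

Lemma even_comm_parity x : clifford_even split_iota x -> x * parity A n./2 = parity A n./2 * x.
Proof.
elim=> [r|y z _ Hy _ Hz|v w y _ Hy]; first by rewrite mulr_algl mulr_algr.
  by rewrite mulrDl mulrDr Hy Hz.
rewrite -mulrA Hy !mulrA; congr (_ * _).
have E u : split_iota u * (1 - parity A n./2) = parity A n./2 * split_iota u.
  by rewrite mulrBr mulr1 parity_conj mulrBl mul1r opprB addrC subrK.
by rewrite -mulrA parity_conj mulrA E.
Qed.

Hypothesis n_gt0 : (0 < n)%N.

Lemma even_central z : (forall v w, GRing.comm z (split_iota v * split_iota w)) ->
  exists s t, z = s%:A + t *: parity A n./2.
Proof.
move=> Hz; have m0 : (0 < n./2)%N by move: evn n_gt0; lia.
have H m : (0 < m)%N -> forall M : Cl m,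
    (forall x y x' y', GRing.comm M (split_vector m x y * split_vector m x' y')) ->
    exists s t, M = s%:A + t *: parity A m.
  by case: m => [|m] // _ M HM; apply: (@even_centralizer A m M HM).
apply: (H _ m0) => x y x' y'; have [v ->] := split_vector_iota x y.
by have [w ->] := split_vector_iota x' y'.
Qed.

Lemma vector_sqr1 : exists v, split_iota v * split_iota v = 1.
Proof.
have m0 : (0 < n./2)%N by move: evn n_gt0; lia.
have [v Hv] := split_vector_iota (fun i => (i == 0%N)%:R) (fun i => (i == 0%N)%:R).
exists v; rewrite -Hv split_vector_sqr (bigD1 (Ordinal m0)) //= big1 => [|k].
  by rewrite mulr1 addr0 scale1r.
by rewrite -val_eqE /= => /negPf ->; rewrite mulr0.
Qed.

(** All Clifford algebras of the split form being isomorphic, and the center of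
    the even part being spanned by [1] and the parity idempotent, the Dickson
    kernel is the stabilizer of that idempotent. *)
Lemma dickson_kernelP (g : 'M[A]_n) : Defs.orthogonal g -> dickson_kernel g <->
  forall F : {lrmorphism Cl n./2 -> Cl n./2},
    (forall v, F (split_iota v) = split_iota (g *m v)) -> F (parity A n./2) = parity A n./2.
Proof.
move=> og; split=> [dg F HF|Hg C iota isC Cg HCg z [ez cz]].
  by apply: dg HF _ _; [exact: split_is_clifford | split; [exact: parity_even | exact: even_comm_parity]].
have [iq univ] := isC; have [siq suniv] := split_is_clifford.
have [h [hi _]] := univ _ _ siq; have [h' [hi' _]] := suniv _ _ iq.
have h'h : h' \o h =1 idfun.
  have [f [_ fu]] := univ _ _ iq => x.
  rewrite (fu (h' \o h)) => [|v]; last by rewrite /= hi hi'.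
  by rewrite -(fu idfun).
pose G : {lrmorphism Cl n./2 -> Cl n./2} := h \o Cg \o h'.
have HF v : G (split_iota v) = split_iota (g *m v) by rewrite /G /= hi' HCg hi.
have HFp := Hg _ HF.
have [|s [t E]] := even_central (z := h z).
  move=> v w; rewrite /GRing.comm -!hi -!rmorphM; congr (h _).
  by rewrite cz // -[iota v * iota w]mulr1 -[1 in X in clifford_even _ X]scale1r; do 2!constructor.
have : h (Cg z) = h z.
  have -> : h (Cg z) = G (h z) by rewrite /G /=; have /= -> := h'h z.
  have GE (K : {lrmorphism Cl n./2 -> Cl n./2}) x : K (s%:A + t *: x) = s%:A + t *: K x.
    by rewrite linearD !linearZ /= rmorph1.
  by rewrite E GE HFp.
by move=> /(congr1 h'); have /= -> := h'h (Cg z); have /= -> := h'h z.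
Qed.

End SplitEven.
End CliffordUniversal.

(** * The Clifford invariant of an isometry *)

Section Invariant.
Variables (A : comNzRingType) (n : nat).
Hypotheses (evn : ~~ odd n) (n_gt0 : (0 < n)%N).
Local Notation Cl := (split_clifford A n./2).
Local Notation iota := (@split_iota A n).
Local Notation parity := (parity A n./2).

(** The image in the Clifford algebra of the split form, under the isometry
    [H], of the generator [zeta] of the center of the even Clifford algebra of
    [block_form n a b]. *)
Definition clifford_invariant (b : nat -> A) (H : 'M[A]_n) : Cl :=
  zeta b (fun i => iota (H *m basis_vector A n i))
    (fun i => iota (H *m basis_vector A n (n./2 + i))) n./2.

Lemma clifford_invariant_lift b (g H : 'M[A]_n) (F : {lrmorphism Cl -> Cl}) :
  (forall v, F (iota v) = iota (g *m v)) ->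
  F (clifford_invariant b H) = clifford_invariant b (g *m H).
Proof.
have FA r : F r%:A = r%:A by rewrite linearZ /= rmorph1.
move=> HF; rewrite [LHS](zeta_morph (f := idfun) _ _ _ _ FA).
by apply: eq_zeta => i _ /=; rewrite !HF !mulmxA.
Qed.

Lemma clifford_invariant1 :
  clifford_invariant (fun=> 1) 1%:M = parity.
Proof.
apply: eq_zeta => i im; rewrite !mul1mx split_iota_U // split_iota_V //.
Qed.

(** The invariant lies in the center of the even algebra, and a vector [w] of
    norm [1] conjugates it as it conjugates [parity], which determines its
    second coefficient from the first. *)
Lemma clifford_invariant_value (a b : nat -> A) (H K : 'M[A]_n) : H *m K = 1%:M ->
  (forall v, qform (split_form A n) (H *m v) = qform (block_form n a b) v) ->
  let B := \prod_(i < n./2) b i in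
  exists s, clifford_invariant b H = s%:A + (B - 2%:R * s) *: parity /\
    s * (B - s) = zeta_norm a b (fun i => a (n./2 + i)%N) n./2.
Proof.
move=> HK Hq B; set Z := clifford_invariant b H.
pose j v := iota (H *m v).
have jL : linear j by move=> r v w; rewrite /j mulmxDr -scalemxAr linearP.
pose jm := GRing.isLinear.Build A 'cV[A]_n Cl *:%R j jL.
pose J : {linear 'cV[A]_n -> Cl} := HB.pack j jm.
have Jq v : J v * J v = (qform (block_form n a b) v)%:A.
  by rewrite /J /= /j split_iota_sqr // Hq.
have rel := clifford_rel_block Jq evn (erefl _).
have conj v : iota v * Z = (B%:A - Z) * iota v.
  have -> : iota v = J (K *m v) by rewrite /J /= /j mulmxA HK mul1mx.
  have -> u : J u = \sum_(i < n./2) (coord u i *: J (basis_vector A n i) +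
      coord u (n./2 + i) *: J (basis_vector A n (n./2 + i))).
    rewrite [in LHS](half_coord_sum evn u) linear_sum; apply: eq_bigr => i _.
    by rewrite linearD !linearZ.
  apply: (@zeta_linear_conj A Cl (fun i => J (basis_vector A n i))
    (fun i => J (basis_vector A n (n./2 + i))) n./2 B (coord (K *m v))
    (fun i => coord (K *m v) (n./2 + i)) Z) => i im.
  by have Hc := zeta_gen_conj rel (leqnn _) im; split; apply: Hc; [left|right].
have [|s [t Est]] := even_central evn n_gt0 (z := Z).
  move=> v w; rewrite /GRing.comm -[RHS]mulrA conj [RHS]mulrA.
  have Econj u : iota u * (B%:A - Z) = Z * iota u.
    by rewrite mulrBr conj mulrBl opprB addrC -addrA -(comm_alg (iota u)) addNr addr0.
  by rewrite Econj mulrA.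
have [w ww] := vector_sqr1 A evn n_gt0.
have Et : t = B - 2%:R * s.
  apply/eqP; rewrite -subr_eq0; apply/eqP/(@alg_inj A n./2); rewrite scale0r.
  have E1 : iota w * Z * iota w = B%:A - Z by rewrite conj -mulrA ww mulr1.
  have E2 : iota w * Z * iota w = s%:A + t *: (1 - parity).
    rewrite Est mulrDr mulrDl mulr_algr -!scalerAl ww -scalerAr -!scalerAl.
    by rewrite parity_conj -mulrA ww mulr1.
  have E : s%:A + (t%:A - t *: parity) = B%:A - (s%:A + t *: parity).
    by rewrite -Est -E1 E2 scalerBr.
  have : s%:A + t%:A - (B%:A - s%:A) = 0 :> Cl.
    apply/eqP; rewrite subr_eq0; apply/eqP; apply: (@addIr _ (- (t *: parity))).
    by rewrite -addrA E opprD addrA.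
  move=> E'; rewrite -[RHS]E' -!scalerBl -scalerDl -scalerBl.
  by congr (_ *: _); ring.
exists s; split; first by rewrite Est Et.
apply: (@alg_inj A n./2); have := zeta_normP rel (leqnn _).
move=> <-; rewrite -/Z -/B -[zeta _ _ _ _]/Z Est.
have -> : B%:A - (s%:A + t *: parity) = (s + t)%:A - t *: parity.
  by rewrite opprD addrA -scalerBl Et; congr (_%:A - _); ring.
rewrite mulrDl mulr_algl [t *: _ * _]mulrBr mulr_algr scalerBr -scalerAl -scalerAr parity_idem.
rewrite !scalerA -scalerBl -addrA -scaleNr -scalerDl.
rewrite (_ : - (s * t) + _ = 0); last by ring.
by rewrite scale0r addr0; congr (_ *: _); rewrite Et; ring.
Qed.

Definition swap_index (i : nat) : nat :=
  if i == 0%N then n./2 else if i == n./2 then 0%N else i.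

Lemma half_gt0 : (0 < n./2)%N. Proof. by move: evn n_gt0; lia. Qed.

Lemma swap_index_lt i : (i < n)%N -> (swap_index i < n)%N.
Proof. by move=> ni; rewrite /swap_index; case: ifP => _; [lia | case: ifP]. Qed.

Lemma swap_indexK : involutive swap_index.
Proof.
move=> i; rewrite /swap_index; have m0 := half_gt0.
have [->|i0] := eqVneq i 0%N; first by rewrite gtn_eqF // eqxx.
have [->|im] := eqVneq i n./2; first by rewrite eqxx.
by rewrite (negPf i0) (negPf im).
Qed.

(** The reflection swapping the first two dual basis vectors, on the factor of
    the ring cut out by the idempotent [e], and the identity on the other. *)
Definition swap_mx (e : A) : 'M[A]_n := sparse_mx n (fun=> 1 - e) (fun=> e) swap_index.

Lemma swap_mxE e v i : (i < n)%N ->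
  coord (swap_mx e *m v) i = (1 - e) * coord v i + e * coord v (swap_index i).
Proof. by move=> ni; rewrite sparse_mxE ?swap_index_lt. Qed.

Lemma swap_mx_basis e i : swap_mx e *m basis_vector A n i =
  (1 - e) *: basis_vector A n i + e *: basis_vector A n (swap_index i).
Proof.
apply/matrixP=> k l; rewrite ord1 -!coord_ord swap_mxE // coordD !coordZ.
rewrite !coord_basis_vector ?swap_index_lt //.
by rewrite -[swap_index k == i](inj_eq (inv_inj swap_indexK)) swap_indexK.
Qed.

Lemma swap_mx_invol e : e * e = e -> swap_mx e *m swap_mx e = 1%:M.
Proof.
move=> ee; have m0 := half_gt0.
apply/matrixP=> i j; rewrite -[LHS]/((swap_mx e *m swap_mx e) i j).
have -> : (swap_mx e *m swap_mx e) i j =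
    coord (swap_mx e *m (swap_mx e *m delta_mx j 0)) i.
  by rewrite mulmxA coord_ord -colE [RHS]mxE.
have -> : 1%:M i j = coord (delta_mx j 0 : 'cV[A]_n) i.
  by rewrite coord_ord !mxE eqxx andbT.
rewrite !swap_mxE ?swap_index_lt // swap_indexK; move: (delta_mx j 0) => v.
set x := coord v i; set y := coord v _.
have -> : (1 - e) * ((1 - e) * x + e * y) + e * ((1 - e) * y + e * x) =
   x + 2%:R * (e * e - e) * (x - y) by ring.
by rewrite ee subrr mulr0 mul0r addr0.
Qed.

Lemma swap_mx_orthogonal e : e * e = e -> Defs.orthogonal (swap_mx e).
Proof.
move=> ee; have m0 := half_gt0; split; first by exists (swap_mx e); rewrite swap_mx_invol.
move=> v; rewrite !(qform_split evn); apply: eq_bigr => -[i /= im] _.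
rewrite !swap_mxE /swap_index; try by lia.
rewrite [(n./2 + i == 0)%N]gtn_eqF ?ltn_addr // (_ : (n./2 + i == n./2)%N = (i == 0%N)); last by lia.
have [->|i0] := eqVneq i 0%N; last by rewrite ltn_eqF //; ring.
rewrite addn0; set x := coord v 0; set y := coord v _.
have -> : ((1 - e) * x + e * y) * ((1 - e) * y + e * x) =
   x * y + (e * e - e) * (2%:R * x * y - x * x - y * y) by ring.
by rewrite ee subrr mul0r addr0.
Qed.

(** A basis vector of the first pair is mapped to the mixture of both, so
    the product of that pair to the mixture of [parity] and its conjugate; the
    composition of centers is affine in each factor. *)
Lemma swap_mx_parity e (F : {lrmorphism Cl -> Cl}) : e * e = e ->
  (forall v, F (iota v) = iota (swap_mx e *m v)) ->
  F parity = e%:A + (1 - 2%:R * e) *: parity.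
Proof.
move=> ee HF; have m0 := half_gt0.
have FA r : F r%:A = r%:A by rewrite linearZ /= rmorph1.
have FU i : (i < n./2)%N -> F (split_U A n./2 i) =
    (1 - e) *: split_U A n./2 i + e *: iota (basis_vector A n (swap_index i)).
  by move=> im; rewrite -split_iota_U // HF swap_mx_basis linearD !linearZ.
have FV i : (i < n./2)%N -> F (split_V A n./2 i) =
    (1 - e) *: split_V A n./2 i + e *: iota (basis_vector A n (swap_index (n./2 + i))).
  by move=> im; rewrite -split_iota_V // HF swap_mx_basis linearD !linearZ.
have fixed (W : Cl) : W = (1 - e) *: W + e *: W by rewrite -scalerDl subrK scale1r.
pose U := split_U A n./2; pose V := split_V A n./2.
have F0 : F (U 0%N) * F (V 0%N) = (1 - e) *: (U 0%N * V 0%N) + e *: (1 - U 0%N * V 0%N).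
  rewrite FU // FV // addn0 /swap_index eqxx gtn_eqF // eqxx.
  rewrite -[X in basis_vector _ _ X]addn0 split_iota_V // split_iota_U // -/U -/V.
  have rel := split_rel A n./2.
  have VU : V 0%N * U 0%N = 1 - U 0%N * V 0%N.
    by rewrite -[1]scale1r -(rel_UV rel m0) addrC addKr.
  rewrite mulrDl !mulrDr -!scalerAl -!scalerAr (rel_U rel m0) (rel_V rel m0) VU.
  rewrite !scale0r !scaler0 addr0 add0r !scalerA ee.
  by congr (_ *: _ + _); rewrite mulrBl mul1r mulrBr mulr1 ee subrr subr0.
have Fi i : (0 < i)%N -> (i < n./2)%N -> F (U i) * F (V i) = U i * V i.
  move=> i0 im; rewrite FU // FV // /swap_index [(_ + _ == 0)%N]gtn_eqF ?ltn_addr //.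
  rewrite gtn_eqF // ltn_eqF // (_ : (n./2 + i == n./2)%N = false); last by apply/negP; lia.
  by rewrite split_iota_U // split_iota_V // -/U -/V -!fixed.
have FZ k : (0 < k <= n./2)%N -> F (zeta (fun=> 1) U V k) =
   (1 - e) *: zeta (fun=> 1) U V k + e *: (1 - zeta (fun=> 1) U V k).
  have zetaS l : zeta (fun=> 1) U V l.+1 = U l * V l * zeta (fun=> 1) U V l +
      (1 - U l * V l) * (1 - zeta (fun=> 1) U V l) by rewrite /= big1 // !scale1r.
  elim: k => [//|[|k] IHk] km; rewrite zetaS.
    by rewrite /= subrr mulr0 addr0 mulr1 rmorphM F0.
  set z := U k.+1 * V k.+1; set w := zeta _ _ _ k.+1 in IHk *.
  have Fw : F w = (1 - e) *: w + e *: (1 - w) by apply: IHk; exact: ltnW.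
  have Fz : F z = z by rewrite rmorphM Fi.
  clearbody z w; clear IHk.
  have -> : F (z * w + (1 - z) * (1 - w)) = z * F w + (1 - z) * (1 - F w).
    have FN (x y : Cl) : F (x * y + (1 - x) * (1 - y)) = F x * F y + (1 - F x) * (1 - F y).
      by rewrite rmorphD !rmorphM !rmorphB !rmorph1.
    by rewrite FN Fz.
  have -> : 1 - F w = (1 - e) *: (1 - w) + e *: w.
    by rewrite Fw {1}(fixed 1) !scalerBr !opprD !opprK !addrA [LHS](ACl (1*3*2*4*5)) /= addrK.
  have := compose_conj z w 1 1; rewrite mulr1 !scale1r => ->.
  rewrite Fw; move: (1 - w) (1 - z) => w' z'.
  rewrite !mulrDr -!scalerAr !addrA [LHS](ACl ((1*3)*(4*2))) /=.
  by rewrite -!scalerDr.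
have -> : F parity = (1 - e) *: parity + e *: (1 - parity) by apply: FZ; rewrite m0 leqnn.
rewrite scalerBr addrCA; congr (_ + _).
by rewrite -scalerBl; congr (_ *: _); ring.
Qed.

End Invariant.

Lemma split_vector_map (A A' : comNzRingType) (f : {rmorphism A -> A'}) m (x y : nat -> A) :
  map_mx f (split_vector m x y) = split_vector m (f \o x) (f \o y).
Proof.
elim: m => [|m IHm] /=; first exact: map_mx0.
pose k := (spin_dim m).+1.
rewrite /cblock (@map_block_mx _ _ f k k k k) -IHm map_mxN.
by rewrite !map_mxZ !map_mx1.
Qed.

(** The invariant is a polynomial in the entries of the isometry, which is why
    prescribing it defines a closed subscheme. *)
Lemma clifford_invariant_map (A A' : comNzRingType) (f : {rmorphism A -> A'}) n
  (b : nat -> A) (H : 'M[A]_n) :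
  map_mx f (clifford_invariant b H) = clifford_invariant (f \o b) (map_mx f H).
Proof.
have Fiota (v : 'cV[A]_n) : map_mx f (split_iota v) = split_iota (map_mx f v).
  rewrite split_vector_map; apply: eq_split_vector => i _ /=.
  have C k : f (coord v k) = coord (map_mx f v) k.
    by rewrite /coord; case: insubP => [l _ _|_] /=; rewrite ?mxE ?rmorph0.
  by rewrite !C.
have FA r : map_mx f (r%:A : split_clifford A n./2) = (f r)%:A by rewrite map_mxZ map_mx1.
have Fb i : map_mx f (basis_vector A n i) = basis_vector A' n i.
  by apply/matrixP=> k l; rewrite !mxE rmorph_nat.
rewrite [LHS](zeta_morph (f := f) (F := map_mx f) _ _ _ _ FA).
by apply: eq_zeta => i _ /=; rewrite !Fiota !map_mxM !Fb.
Qed.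

(** * The half-discriminant *)

Section TwoTorsion.

Lemma mpoly_int_torsion k (u v : {mpoly int[k]}) : u *+ 2 = v *+ 2 -> u = v.
Proof.
move=> E; apply/mpolyP => m.
have := congr1 (mcoeff m) E; rewrite !mcoeffMn.
by rewrite !mulr2n; lia.
Qed.

(** Any finite family of elements lifts to a ring in which [2] is cancellable;
    identities that hold there up to the factor [2] hold everywhere. *)
Lemma torsion_free_lift (A : comNzRingType) (T : finType) (a : T -> A) :
  exists (L : comNzRingType) (f : {rmorphism L -> A}) (x : T -> L),
    (forall u v : L, u *+ 2 = v *+ 2 -> u = v) /\ forall t, f (x t) = a t.
Proof.
exists {mpoly int[#|T|]}.
exists (mmap (intr : int -> A) (fun i => a (enum_val i))).
exists (fun t => 'X_(enum_rank t) : {mpoly int[#|T|]}).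
split; first exact: mpoly_int_torsion.
by move=> t /=; rewrite mmapX mmap1U enum_rankK.
Qed.

Lemma torsion_free_lift_mx (A : comNzRingType) k n (M : 'I_k -> 'M[A]_n) :
  exists (L : comNzRingType) (f : {rmorphism L -> A}) (X : 'I_k -> 'M[L]_n),
    (forall u v : L, u *+ 2 = v *+ 2 -> u = v) /\ forall i, map_mx f (X i) = M i.
Proof.
have [L [f [x [tL fx]]]] := torsion_free_lift (fun t : 'I_k * 'I_n * 'I_n => M t.1.1 t.1.2 t.2).
exists L, f, (fun i => \matrix_(j, l) x (i, j, l)); split=> // i.
by apply/matrixP=> j l; rewrite !mxE fx.
Qed.

Lemma det_congr2 (A : comNzRingType) n (N B : 'M[A]_n) :
  exists c, \det (N + B *+ 2) = \det N + c *+ 2.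
Proof.
pose R (a b : A) := exists c, a = b + c *+ 2.
have RM a b a' b' : R a b -> R a' b' -> R (a * a') (b * b').
  move=> [c ->] [c' ->]; exists (b * c' + c * b' + c * c' *+ 2); ring.
have RD a b a' b' : R a b -> R a' b' -> R (a + a') (b + b').
  move=> [c ->] [c' ->]; exists (c + c'); ring.
rewrite -/(R _ _) /determinant; apply: (big_ind2 R) => [||s _]; first by exists 0; rewrite mul0rn addr0.
  exact: RD.
apply: (RM); first by exists 0; rewrite mul0rn addr0.
apply: (big_ind2 R) => [||i _]; first by exists 0; rewrite mul0rn addr0.
  exact: RM.
by eexists; rewrite mxE; congr (_ + _); rewrite mulr2n mxE -mulr2n.
Qed.

(** Modulo [2] the symmetrization of a matrix is its antisymmetrization, which
    is singular in odd dimension. *)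
Lemma universal_disc_even n : odd n ->
  exists p, discriminant (universal_form n) = p *+ 2.
Proof.
move=> on; set U := universal_form n; pose N := U - U^T.
have N0 : \det N = 0.
  apply: mpoly_int_torsion; rewrite mul0rn.
  have : \det N = - \det N.
    rewrite -{1}det_tr (_ : N^T = (-1) *: N).
      by rewrite detZ -signr_odd on expr1 mulN1r.
    by rewrite linearB /= trmxK scaleN1r opprB.
  by move=> E; rewrite mulr2n {1}E addNr.
have [c E] := det_congr2 N U^T; exists c.
rewrite /discriminant (_ : U + U^T = N + U^T *+ 2) ?E ?N0 ?add0r //.
by rewrite mulr2n addrA subrK.
Qed.

Lemma half_mpoly_double k (p : {mpoly int[k]}) : half_mpoly (p *+ 2) = p.
Proof.
apply/mpolyP => m; rewrite /half_mpoly raddf_sum /=.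
transitivity (mcoeff m (p *+ 2) %/ 2)%Z; last first.
  by rewrite mcoeffMn; lia.
set s := msupp _; have us : uniq s by exact: msupp_uniq.
have E l : mcoeff m ((mcoeff l (p *+ 2) %/ 2)%Z *: 'X_[l]) =
    (mcoeff l (p *+ 2) %/ 2)%Z *+ (l == m).
  by rewrite mcoeffZ mcoeffX mulr_natr.
under eq_bigr => l _ do rewrite E.
have [ms|ms] := boolP (m \in s); last first.
  rewrite (memN_msupp_eq0 ms) div0z big_seq big1 // => l ls.
  by case: eqP => // lm; rewrite -lm ls in ms.
rewrite (bigD1_seq m) //= eqxx big1 ?addr0 // => l /negPf ->.
by rewrite mulr0n.
Qed.

Lemma universal_form_eval (A : comNzRingType) n (q : 'M[A]_n) :
  map_mx (mmap (intr : int -> A) (fun k => mxvec q 0 k)) (universal_form n) = q.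
Proof. by apply/matrixP=> i j; rewrite !mxE mmapX mmap1U mxvecE. Qed.

End TwoTorsion.

Section HalfDiscriminant.
Variable n : nat.
Hypothesis on : odd n.

Lemma half_discriminant_double (A : comNzRingType) (q : 'M[A]_n) :
  half_discriminant q *+ 2 = discriminant q.
Proof.
have [p E] := universal_disc_even on.
rewrite /half_discriminant E half_mpoly_double -raddfMn -E /discriminant.
pose f : {rmorphism {mpoly int[n * n]} -> A} := mmap intr (fun k => mxvec q 0 k).
rewrite -[LHS]/(f _) -det_map_mx map_mxD -map_trmx.
by rewrite [map_mx f _]universal_form_eval.
Qed.

Lemma half_discriminant_map (A B : comNzRingType) (f : {rmorphism A -> B}) (q : 'M[A]_n) :
  half_discriminant (map_mx f q) = f (half_discriminant q).
Proof.
rewrite /half_discriminant /mmap rmorph_sum; apply: eq_bigr => m _.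
rewrite rmorphM rmorph_int /mmap1 rmorph_prod; congr (_ * _).
by apply: eq_bigr => i _; rewrite rmorphXn -map_mxvec mxE.
Qed.

(** The identity holds after doubling. To cancel [2], the data are lifted to a
    ring of integral polynomials; two matrices of one form differ by an
    alternating matrix, and that difference is lifted to an alternating
    matrix. *)
Lemma half_discriminant_transfer (A : comNzRingType) (q q' P : 'M[A]_n) :
  (forall v, qform q' v = qform q (P *m v)) ->
  half_discriminant q' = \det P ^+ 2 * half_discriminant q.
Proof.
move=> E; have [] : (forall i, q' i i = (P^T *m q *m P) i i) /\
    q' + q'^T = P^T *m q *m P + (P^T *m q *m P)^T.
  by apply/qform_eqP => v; rewrite E qform_mulmx.
move EW : (P^T *m q *m P) => W Ed Es.
pose M (i : 'I_3) := [:: q; P; q' - W]`_i.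
have [L [f [X [tL fX]]]] := torsion_free_lift_mx M.
pose q0 := X ord0; pose P0 := X (inord 1).
have fq : map_mx f q0 = q by rewrite fX.
have fP : map_mx f P0 = P by rewrite fX /M inordK.
pose alt : 'M[L]_n := \matrix_(i, j) (if (i < j)%N then X (inord 2) i j
  else if (j < i)%N then - X (inord 2) j i else 0).
have fX2 : map_mx f (X (inord 2)) = q' - W by rewrite fX /M inordK.
have falt : map_mx f alt = q' - W.
  have X2 i j : f (X (inord 2) i j) = q' i j - W i j.
    by have /matrixP/(_ i j) := fX2; rewrite !mxE.
  apply/matrixP=> i j; rewrite !mxE; case: ltngtP => ij.
  - by rewrite X2.
  - have /matrixP/(_ i j) := Es; rewrite !mxE => Eij.
    rewrite rmorphN X2 opprB; apply/eqP.
    by rewrite subr_eq addrAC eq_sym subr_eq [W j i + _]addrC Eij.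
  - by rewrite (val_inj ij) Ed subrr rmorph0.
have altT : alt^T = - alt.
  by apply/matrixP=> i j; rewrite !mxE; case: ltngtP => // _; rewrite ?opprK ?oppr0.
pose q'0 := P0^T *m q0 *m P0 + alt.
have fq' : map_mx f q'0 = q'.
  by rewrite map_mxD falt !map_mxM -map_trmx fq fP EW [LHS]addrC subrK.
rewrite -fq' -fq -fP det_map_mx !half_discriminant_map -rmorphXn -rmorphM; congr (f _).
apply: tL; rewrite -mulrnAr !half_discriminant_double /discriminant.
have -> : q'0 + q'0^T = P0^T *m (q0 + q0^T) *m P0.
  rewrite /q'0 linearD /= altT addrACA addrN addr0 !trmx_mul trmxK mulmxDr mulmxDl.
  by rewrite mulmxA.
by rewrite !det_mulmx det_tr; ring.
Qed.

Lemma half_discriminant_diag (A : comNzRingType) (a : 'rV[A]_n) :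
  half_discriminant (diag_mx a) = (\prod_i a 0 i) *+ 2 ^ n.-1.
Proof.
have [L [f [x [tL fx]]]] := torsion_free_lift (fun i : 'I_n => a 0 i).
pose b := \row_i x i; have -> : a = map_mx f b by apply/rowP=> i; rewrite !mxE fx.
rewrite -map_diag_mx half_discriminant_map.
under eq_bigr => i _ do rewrite mxE; rewrite -rmorph_prod -rmorphMn; congr (f _).
apply: tL; rewrite half_discriminant_double /discriminant tr_diag_mx -linearD /= det_diag.
under eq_bigr => i _ do rewrite mxE -mulr2n -[_ *+ 2]mulr_natr.
rewrite big_split /= prodr_const card_ord -mulrnA -expnSr prednK; last by case: (n) on.
by rewrite -natrX mulr_natr.
Qed.

End HalfDiscriminant.

Lemma half_discriminant_block (A : comNzRingType) k n (B : 'M[A]_k) (q : 'M[A]_n) :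
  odd n -> ~~ odd k ->
  half_discriminant (block_mx B 0 0 q) = discriminant B * half_discriminant q.
Proof.
move=> on ek; have onk : odd (k + n) by rewrite oddD on (negPf ek).
have [L [f [x [tL fx]]]] := torsion_free_lift (fun t : ('I_k * 'I_k) + ('I_n * 'I_n) =>
  match t with inl t => B t.1 t.2 | inr t => q t.1 t.2 end).
pose B0 := \matrix_(i, j) x (inl (i, j)); pose q0 := \matrix_(i, j) x (inr (i, j)).
have <- : map_mx f B0 = B by apply/matrixP=> i j; rewrite !mxE fx.
have <- : map_mx f q0 = q by apply/matrixP=> i j; rewrite !mxE fx.
have -> : block_mx (map_mx f B0) 0 0 (map_mx f q0) = map_mx f (block_mx B0 0 0 q0).
  by rewrite map_block_mx !map_mx0.
rewrite !half_discriminant_map // /discriminant map_trmx -map_mxD det_map_mx -rmorphM.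
congr (f _); apply: tL; rewrite -mulrnAr !half_discriminant_double // /discriminant.
by rewrite tr_block_mx !trmx0 add_block_mx !addr0 det_ublock.
Qed.

(** Modulo an ideal containing [2] and the off-diagonal coefficients, the form
    is diagonal, and the half-discriminant of a diagonal form in at least
    three variables is even. *)
Lemma half_discriminant_mem (A : comNzRingType) (I : A -> Prop) n (q : 'M[A]_n) :
  is_ideal I -> odd n -> (1 < n)%N -> I 2%:R ->
  (forall i j, i != j -> I (q i j + q j i)) -> I (half_discriminant q).
Proof.
move=> iI on n1 I2 Iq.
pose up : 'M[A]_n := \matrix_(i, j) (if (i < j)%N then q i j + q j i else q i i *+ (i == j)).
pose dg : 'M[A]_n := diag_mx (\row_i q i i).
have -> : half_discriminant q = half_discriminant up.
  rewrite (half_discriminant_transfer on (P := 1%:M) (q := up)).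
    by rewrite det1 expr1n mul1r.
  move=> v; rewrite mul1mx; move: v; apply/qform_eqP; split=> [i|].
    by rewrite mxE ltnn eqxx.
  apply/matrixP=> i j; rewrite !mxE; case: (ltngtP i j) => ij.
  - by rewrite -val_eqE /= gtn_eqF // mulr0n addr0.
  - by rewrite -val_eqE /= gtn_eqF // mulr0n add0r addrC.
  - by rewrite (val_inj ij) eqxx.
pose R (a b : A) := I (a - b).
have R1 a : R a a by rewrite /R subrr; exact: ideal0.
have RM a b a' b' : R a b -> R a' b' -> R (a * a') (b * b').
  rewrite /R => H H'; have -> : a * a' - b * b' = (a - b) * a' + b * (a' - b') by ring.
  by apply: idealD => //; [exact: idealMr | exact: idealM].
have RD a b a' b' : R a b -> R a' b' -> R (a + a') (b + b').
  by rewrite /R => H H'; rewrite opprD addrACA; exact: idealD.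
have : R (half_discriminant up) (half_discriminant dg).
  rewrite /half_discriminant /mmap; apply: (big_ind2 R) => // m _; apply: (RM) => //.
  rewrite /mmap1; apply: (big_ind2 R) => // k _.
  have Rk : R (mxvec up 0 k) (mxvec dg 0 k).
    case/mxvec_indexP: k => i j; rewrite !mxvecE !mxE; case: ltnP => ij.
      by rewrite -val_eqE /= ltn_eqF // mulr0n /R subr0; apply: Iq; rewrite neq_ltn ij.
    by rewrite [q i i *+ _]mulrb.
  by elim: (m k) => [|e IHe]; rewrite ?expr0 // !exprS; exact: RM.
rewrite /R half_discriminant_diag // => H.
rewrite -(subrK ((\prod_i (\row_i q i i) 0 i) *+ 2 ^ n.-1) (half_discriminant up)).
apply: idealD => //; case: n n1 {on q Iq up dg H} (\prod_i _) => [|[|n]] //= _ x.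
by rewrite expnS mulrnA -mulr_natr; apply: idealMr => //; rewrite -mulr_natr; apply: idealM.
Qed.

(** * Orthogonal decomposition over a local ring *)

Section Reindex.
Variables (A : comNzRingType) (n : nat).

Definition reindex_mx (t : nat -> nat) : 'M[A]_n := sparse_mx n (fun=> 0) (fun=> 1) t.

Lemma reindex_mxE t (v : 'cV[A]_n) i : (i < n)%N -> (t i < n)%N ->
  coord (reindex_mx t *m v) i = coord v (t i).
Proof. by move=> ni nti; rewrite sparse_mxE // mul0r add0r mul1r. Qed.

Lemma coord_inj (v w : 'cV[A]_n) : (forall i, (i < n)%N -> coord v i = coord w i) -> v = w.
Proof. by move=> E; apply/matrixP=> i j; rewrite ord1 -!coord_ord E. Qed.

Lemma mulmx_ext (P Q : 'M[A]_n) : (forall v : 'cV[A]_n, P *m v = Q *m v) -> P = Q.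
Proof.
move=> E; apply/matrixP=> i j; have := E (delta_mx j 0); rewrite -!colE.
by move/matrixP/(_ i 0); rewrite !mxE.
Qed.

Lemma reindex_mxK s t : (forall i, (i < n)%N -> (s i < n)%N /\ (t i < n)%N) ->
  (forall i, (i < n)%N -> t (s i) = i) -> reindex_mx s *m reindex_mx t = 1%:M.
Proof.
move=> Hlt ts; apply: mulmx_ext => v; rewrite mul1mx -mulmxA; apply: coord_inj => i ni.
have [sn tn] := Hlt i ni; rewrite reindex_mxE // reindex_mxE ?ts //.
Qed.

(** Invertibility over rings in which inverses are not given as a function. *)
Definition invertible_mx (P : 'M[A]_n) := exists P', P *m P' = 1%:M.

Lemma invertible_mxM P Q : invertible_mx P -> invertible_mx Q -> invertible_mx (P *m Q).
Proof.
move=> [P' HP] [Q' HQ]; exists (Q' *m P').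
by rewrite mulmxA -(mulmxA P) HQ mulmx1.
Qed.

Lemma invertible_mx1 : invertible_mx 1%:M.
Proof. by exists 1%:M; rewrite mulmx1. Qed.

Lemma invertible_det P : invertible_mx P -> exists d, \det P * d = 1.
Proof. by move=> [P' HP]; exists (\det P'); rewrite -det_mulmx HP det1. Qed.

Lemma det_invertible P d : \det P * d = 1 -> invertible_mx P.
Proof.
by move=> Hd; exists (d *: \adj P); rewrite -scalemxAr mul_mx_adj scale_scalar_mx mulrC Hd.
Qed.

Lemma tperm_invertible i j : invertible_mx (tperm_mx i j).
Proof.
by exists (tperm_mx i j); rewrite /tperm_mx -perm_mxM perm.tperm2 perm_mx1.
Qed.

End Reindex.

Lemma discriminant_transfer (A : comNzRingType) n (q q' P : 'M[A]_n) :
  (forall v, qform q' v = qform q (P *m v)) ->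
  discriminant q' = \det P ^+ 2 * discriminant q.
Proof.
move=> E; have [_ Es] : (forall i, q' i i = (P^T *m q *m P) i i) /\
    q' + q'^T = P^T *m q *m P + (P^T *m q *m P)^T.
  by apply/qform_eqP => v; rewrite E qform_mulmx.
rewrite /discriminant Es !trmx_mul trmxK mulmxA -mulmxDl -mulmxDr !det_mulmx det_tr.
by ring.
Qed.

Lemma discriminant_block (A : comNzRingType) k n (B : 'M[A]_k) (q : 'M[A]_n) :
  discriminant (block_mx B 0 0 q) = discriminant B * discriminant q.
Proof. by rewrite /discriminant tr_block_mx !trmx0 add_block_mx !addr0 det_ublock. Qed.

Lemma polar_mulmx (A : comNzRingType) n (q P : 'M[A]_n) v w :
  polar (P^T *m q *m P) v w = polar q (P *m v) (P *m w).
Proof.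
rewrite /polar !trmx_mul trmxK mulmxA -mulmxDl -mulmxDr !mulmxA.
by rewrite -!mulmxA.
Qed.

Lemma polarDl (A : comNzRingType) n (q : 'M[A]_n) u v w :
  polar q (u + v) w = polar q u w + polar q v w.
Proof. by rewrite /polar [(u + v)^T]linearD /= !mulmxDl mxE. Qed.

Lemma qform_block_mx (A : comNzRingType) k n (B : 'M[A]_k) (q : 'M[A]_n) (v : 'cV_(k + n)) :
  qform (block_mx B 0 0 q) v = qform B (usubmx v) + qform q (dsubmx v).
Proof.
rewrite !qform_mx -{1 2}[v]vsubmxK tr_col_mx mul_row_block !mulmx0 addr0 add0r mul_row_col.
by rewrite mxE.
Qed.

(** Completing the square: if the polar form is nondegenerate on the span of
    the first [k] basis vectors, the others can be made orthogonal to it. *)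
Lemma orthogonal_split (A : comNzRingType) k n (q : 'M[A]_(k + n)) (C : 'M[A]_k) :
  (ulsubmx q + (ulsubmx q)^T) *m C = 1%:M ->
  exists (P : 'M[A]_(k + n)) (q' : 'M[A]_n), invertible_mx P /\
    forall v, qform q (P *m v) = qform (block_mx (ulsubmx q) 0 0 q') v.
Proof.
move=> HC; pose S := q + q^T; pose R := ursubmx S.
pose T := - (C *m R); pose P := block_mx 1%:M T 0 1%:M : 'M[A]_(k + n).
pose q2 := P^T *m q *m P.
have HS : ulsubmx S = ulsubmx q + (ulsubmx q)^T.
  by apply/matrixP=> i j; rewrite !mxE.
have PT : P^T = block_mx 1%:M 0 T^T 1%:M.
  by rewrite tr_block_mx !trmx1 trmx0.
have ST : S^T = S by rewrite /S linearD /= trmxK addrC.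
have S2 : q2 + q2^T = P^T *m S *m P.
  by rewrite /q2 /S !trmx_mul trmxK mulmxA -mulmxDl -mulmxDr.
have ur0 : ursubmx (q2 + q2^T) = 0.
  rewrite S2 PT -[S]submxK !mulmx_block block_mxKur.
  rewrite !mul0mx !addr0 !mul1mx !mulmx1 HS /T mulmxN mulmxA HC mul1mx.
  by rewrite addNr.
have ul : ulsubmx q2 = ulsubmx q.
  rewrite /q2 PT -{1}[q]submxK !mulmx_block block_mxKul.
  by rewrite !mul0mx !mulmx0 !addr0 !mul1mx !mulmx1.
exists P, (drsubmx q2); split.
  apply: (@det_invertible _ _ _ 1); rewrite /P det_ublock !det1 !mulr1 //.
move=> v; rewrite qform_mulmx -/q2; move: v; apply/qform_eqP; split=> [i|].
  rewrite -{1}[q2]submxK ul; case: (split_ordP i) => j ->.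
    by rewrite !block_mxEul.
  by rewrite !block_mxEdr.
have dl0 : dlsubmx (q2 + q2^T) = 0.
  have -> : q2 + q2^T = (q2 + q2^T)^T by rewrite linearD /= trmxK addrC.
  by rewrite -trmx_ursub ur0 trmx0.
rewrite -[q2 + q2^T]submxK ur0 dl0 tr_block_mx !trmx0 add_block_mx !addr0.
by rewrite -ul; congr block_mx; apply/matrixP=> i j; rewrite !mxE.
Qed.

Section Diagonalization.
Variables (R : comNzRingType) (M : R -> Prop).
Hypotheses (noethR : noetherian R) (locM : is_local M).

Let iM : is_ideal M. Proof. by case: locM => -[]. Qed.
Let prM : prime_ideal M. Proof. exact: (local_prime noethR locM). Qed.

Lemma not_mem_unit a b : a * b = 1 -> ~ M a.
Proof. by move=> ab Ma; apply: (prime_not1 prM); rewrite -ab; exact: idealMr. Qed.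

Lemma not_memD a b : ~ M a -> M b -> ~ M (a + b).
Proof.
move=> nMa Mb Mab; apply: nMa; rewrite -(addrK b a); exact: idealB.
Qed.

Lemma invertible_not_mem n (P : 'M[R]_n) : invertible_mx P -> ~ M (\det P).
Proof. by move=> /invertible_det[d Hd]; exact: not_mem_unit Hd. Qed.

Lemma det_mem n (N : 'M[R]_n) : (0 < n)%N -> (forall i j, M (N i j)) -> M (\det N).
Proof.
case: n N => // n N _ HN; rewrite (expand_det_row _ ord0).
by apply: ideal_sumr => // j; exact: idealMr.
Qed.

Lemma transvection_invertible n (i j : 'I_n) : i != j ->
  invertible_mx (1%:M + delta_mx j i : 'M[R]_n).
Proof.
move=> ij; exists (1%:M - delta_mx j i).
rewrite mulmxBr mulmx1 mulmxDl mul1mx mul_delta_mx_cond (negPf ij) mulr0n addr0.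
by rewrite addrK.
Qed.

Lemma transvection_delta n (i j k : 'I_n) :
  (1%:M + delta_mx j i : 'M[R]_n) *m (delta_mx k 0 : 'cV_n) =
  delta_mx k 0 + (delta_mx j 0 *+ (i == k)).
Proof. by rewrite mulmxDl mul1mx mul_delta_mx_cond. Qed.

Definition off_mem n (q : 'M[R]_n) := forall i j : 'I_n, i != j -> M (q i j + q j i).

(** If [q i i] and [q j j] are not units but [q i j + q j i] is, the value at
    [e_i + e_j] is a unit. *)
Lemma unit_diagonal n (q : 'M[R]_n) : ~ off_mem q ->
  exists P i j, [/\ invertible_mx P, i != j, ~ M ((P^T *m q *m P) i i) &
    M 2%:R -> ~ M ((P^T *m q *m P) i j + (P^T *m q *m P) j i)].
Proof.
move=> /existsNP[i /existsNP[j /not_implyP[ij nMij]]].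
case: (pselect (M (q i i))) => [Mi|nMi]; last first.
  exists 1%:M, i, j; split=> //; first exact: invertible_mx1.
    by rewrite trmx1 mul1mx mulmx1.
  by rewrite trmx1 mul1mx mulmx1.
case: (pselect (M (q j j))) => [Mj|nMj]; last first.
  exists 1%:M, j, i; split=> //; [exact: invertible_mx1 | by rewrite eq_sym | |].
    by rewrite trmx1 mul1mx mulmx1.
  by rewrite trmx1 mul1mx mulmx1 addrC.
exists (1%:M + delta_mx j i), i, j; split=> //; first exact: transvection_invertible.
  rewrite -qform_delta -qform_mulmx transvection_delta eqxx qformD !qform_delta polar_delta.
  by rewrite addrC; apply: not_memD => //; exact: idealD.
move=> M2; rewrite -polar_delta polar_mulmx !transvection_delta eqxx (negPf ij) mulr0n addr0.
have -> : polar q (delta_mx i 0 + delta_mx j 0 *+ true) (delta_mx j 0) =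
    (q i j + q j i) + 2%:R * q j j.
  by rewrite mulr1n polarDl !polar_delta; ring.
by apply: not_memD => //; exact: idealMr.
Qed.

Lemma diagonalization n (q : 'M[R]_n) : ~ M 2%:R -> ~ M (discriminant q) ->
  exists P d, invertible_mx P /\ forall v, qform q (P *m v) = qform (diag_mx d) v.
Proof.
move=> nM2; elim: n q => [|n IHn] q nMq.
  exists 1%:M, 0; split; first exact: invertible_mx1.
  by move=> v; rewrite /qform !big_ord0.
have [P1 [HP1 H00]] : exists P, invertible_mx P /\ ~ M ((P^T *m q *m P) ord0 ord0).
  have [P [i [HP Hi]]] : exists P i, invertible_mx P /\ ~ M ((P^T *m q *m P) i i).
    case: (pselect (exists i, ~ M (q i i))) => [[i Hi]|/forallNP Hd].
      by exists 1%:M, i; rewrite trmx1 mul1mx mulmx1; split; first exact: invertible_mx1.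
    have [|P [i [j [HP _ Hi _]]]] := @unit_diagonal _ q; last by exists P, i.
    move=> Hoff; apply: nMq; apply: det_mem => // i j; rewrite !mxE.
    have [<-|] := eqVneq i j; last exact: Hoff.
    by apply: idealD => //; apply: contrapT; exact: Hd.
  exists (P *m tperm_mx ord0 i); split.
    by apply: invertible_mxM => //; exact: tperm_invertible.
  rewrite -qform_delta -qform_mulmx -mulmxA.
  rewrite (_ : tperm_mx ord0 i *m delta_mx ord0 0 = delta_mx i 0); last first.
    rewrite -[tperm_mx _ _ *m _]/(_) -xrowE; apply/matrixP=> k l; rewrite !mxE.
    by rewrite (canF_eq (@perm.tpermK _ _ _)) perm.tpermL.
  by rewrite qform_mulmx qform_delta.
move Eq1 : (P1^T *m q *m P1) H00 => q1 H00.
have n2 : ~ M (2%:R * q1 ord0 ord0) by apply: (prime_notM prM).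
have [c Hc] := local_unit noethR locM n2.
have [|P2 [q' [HP2 Hq']]] := @orthogonal_split R 1 n q1 c%:M.
  apply/matrixP=> i j; rewrite !ord1 mul_mx_scalar !mxE.
  rewrite (_ : lshift n 0 = ord0); last exact: val_inj.
  by rewrite -Hc eqxx mulr1n; ring.
have nMq' : ~ M (discriminant q').
  have nM1 : ~ M (discriminant q1).
    rewrite (@discriminant_transfer _ _ q _ P1) => [|v]; last by rewrite qform_mulmx Eq1.
    by apply: (prime_notM prM) => //; move/(prime_exp prM); exact: invertible_not_mem.
  have := @discriminant_transfer R (1 + n)%N q1 _ P2 (fun v => esym (Hq' v)).
  rewrite discriminant_block => E Mq'.
  have : ~ M (\det P2 ^+ 2 * discriminant q1).
    by apply: (prime_notM prM) => //; move/(prime_exp prM); exact: invertible_not_mem.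
  by apply; rewrite -E; exact: idealM.
have [P3 [d [[P3' HP3] Hd]]] := IHn _ nMq'.
pose P4 : 'M[R]_(1 + n) := block_mx 1%:M 0 0 P3.
have HP4 : invertible_mx P4.
  exists (block_mx 1%:M 0 0 P3').
  rewrite mulmx_block !(mul0mx, mulmx0, mul1mx, addr0, add0r) HP3.
  by rewrite -scalar_mx_block.
exists (P1 *m (P2 *m P4)), (row_mx (const_mx (q1 ord0 ord0)) d : 'rV_(1 + n)); split.
  exact: (invertible_mxM HP1 (invertible_mxM HP2 HP4)).
have EL (w : 'cV_(1 + n)) : qform q1 (P2 *m (P4 *m w)) =
    qform (ulsubmx (q1 : 'M_(1 + n))) (usubmx w) + qform (diag_mx d) (dsubmx w).
  rewrite Hq' qform_block_mx -[w in LHS]vsubmxK mul_block_col.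
  by rewrite !mul0mx mul1mx addr0 add0r col_mxKu col_mxKd Hd.
have ER (w : 'cV_(1 + n)) : qform (diag_mx (row_mx (const_mx (q1 ord0 ord0)) d)) w =
    qform (diag_mx (const_mx (q1 ord0 ord0))) (usubmx w) + qform (diag_mx d) (dsubmx w).
  by rewrite diag_mx_row qform_block_mx.
move=> v; rewrite -mulmxA qform_mulmx Eq1 -mulmxA [LHS]EL [RHS]ER.
congr (qform _ _ + _); apply/matrixP=> i j; rewrite !ord1 !mxE eqxx mulr1n.
by congr (q1 _ _); exact: val_inj.
Qed.

End Diagonalization.

Section BlockDecomposition.
Variables (R : comNzRingType) (M : R -> Prop).
Hypotheses (noethR : noetherian R) (locM : is_local M).

Let iM : is_ideal M. Proof. by case: locM => -[]. Qed.
Let prM : prime_ideal M. Proof. exact: (local_prime noethR locM). Qed.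

Definition form_disc n (q : 'M[R]_n) := if odd n then half_discriminant q else discriminant q.

Lemma form_disc_transfer n (q q' P : 'M[R]_n) : invertible_mx P ->
  (forall v, qform q' v = qform q (P *m v)) -> ~ M (form_disc q) -> ~ M (form_disc q').
Proof.
move=> HP E nMq; have -> : form_disc q' = \det P ^+ 2 * form_disc q.
  rewrite /form_disc; case: ifP => on; first exact: half_discriminant_transfer.
  exact: discriminant_transfer.
apply: (prime_notM prM) => //; move/(prime_exp prM).
exact: (invertible_not_mem noethR locM).
Qed.

Lemma form_disc_block n (B : 'M[R]_2) (q : 'M[R]_n) :
  ~ M (form_disc (block_mx B 0 0 q)) -> ~ M (form_disc q).
Proof.
move=> H Mq; apply: H; rewrite /form_disc oddD /=.
case: ifP => on; rewrite /form_disc on in Mq.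
  by rewrite half_discriminant_block //; exact: idealM.
by rewrite discriminant_block; exact: idealM.
Qed.

Lemma tperm_mx_delta n (i j k : 'I_n) :
  (tperm_mx i j : 'M[R]_n) *m (delta_mx k 0 : 'cV_n) = delta_mx (tperm i j k) 0.
Proof.
rewrite -[tperm_mx _ _ *m _]/(_) -xrowE; apply/matrixP=> l m; rewrite !mxE.
by rewrite (canF_eq (@tpermK _ _ _)).
Qed.

Lemma det_2x2 (B : 'M[R]_2) : \det B = B 0 0 * B 1 1 - B 0 1 * B 1 0.
Proof.
rewrite (expand_det_row _ 0) !big_ord_recl big_ord0 addr0 /cofactor !det_mx11 !mxE /=.
rewrite expr0 expr1 mul1r mulN1r mulrN.
by congr (B _ _ * B _ _ - B _ _ * B _ _); exact: val_inj.
Qed.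

Lemma qform_2x2 (B : 'M[R]_2) (v : 'cV[R]_2) :
  qform B v = B 0 0 * v 0 0 ^+ 2 + (B 0 1 + B 1 0) * (v 0 0 * v 1 0) + B 1 1 * v 1 0 ^+ 2.
Proof.
rewrite /qform !big_ord_recl !big_ord0 !addr0.
have -> : lift ord0 ord0 = 1 :> 'I_2 by exact: val_inj.
by ring.
Qed.

Lemma residue2_not_off_mem n (q : 'M[R]_n) : M 2%:R -> (1 < n)%N ->
  ~ M (form_disc q) -> ~ off_mem M q.
Proof.
move=> M2 n1 nMq Hoff; apply: nMq; rewrite /form_disc; case: ifP => on.
  exact: (@half_discriminant_mem R M n q).
apply: (det_mem locM); first exact: ltnW.
move=> i j; rewrite !mxE; have [<-|] := eqVneq i j; last exact: Hoff.
by rewrite -mulr2n -mulr_natl; exact: idealMr.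
Qed.

(** In residue characteristic [2] the polar form is alternating modulo the
    maximal ideal, so the discriminant of a binary block is a unit as soon as
    its mixed coefficient is. *)
Lemma residue2_split n (q : 'M[R]_(2 + n)) : M 2%:R -> ~ M (form_disc q) ->
  exists (P : 'M[R]_(2 + n)) a b c (q' : 'M[R]_n),
    [/\ invertible_mx P, ~ M a, ~ M b, ~ M (form_disc q') &
     forall v : 'cV_(2 + n), qform q (P *m v) =
       a * coord v 0 ^+ 2 + b * (coord v 0 * coord v 1) + c * coord v 1 ^+ 2
       + qform q' (dsubmx v)].
Proof.
move=> M2 nMq.
have [P1 [i [j [HP1 ij Hi /(_ M2) Hij]]]] :=
  unit_diagonal locM (@residue2_not_off_mem (2 + n)%N q M2 isT nMq).
move E1 : (P1^T *m q *m P1) Hi Hij => q1 Hi Hij.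
pose o0 : 'I_(2 + n) := lshift n 0; pose o1 : 'I_(2 + n) := lshift n 1.
pose j' := tperm o0 i j.
pose P2 : 'M[R]_(2 + n) := tperm_mx o0 i *m tperm_mx o1 j'.
have HP2 : invertible_mx P2 by apply: invertible_mxM; exact: tperm_invertible.
have P2o1 : P2 *m (delta_mx o1 0 : 'cV_(2 + n)) = delta_mx j 0.
  by rewrite -mulmxA !tperm_mx_delta tpermL tpermK.
have P2o0 : P2 *m (delta_mx o0 0 : 'cV_(2 + n)) = delta_mx i 0.
  rewrite -mulmxA !tperm_mx_delta [tperm o1 j' o0]tpermD ?tpermL //.
  apply/eqP => E; case/eqP: ij; rewrite -[j](tpermK o0 i) -/j' E.
  by rewrite tpermL.
clearbody P2.
move E2 : (P2^T *m q1 *m P2) => q2.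
have q2a : q2 o0 o0 = q1 i i by rewrite -E2 -qform_delta -qform_mulmx P2o0 qform_delta.
have q2b : q2 o0 o1 + q2 o1 o0 = q1 i j + q1 j i.
  by rewrite -E2 -polar_delta polar_mulmx P2o0 P2o1 polar_delta.
have HB00 : ulsubmx q2 0 0 = q2 o0 o0 by rewrite !mxE.
have HB01 : ulsubmx q2 0 1 = q2 o0 o1 by rewrite !mxE.
have HB10 : ulsubmx q2 1 0 = q2 o1 o0 by rewrite !mxE.
have nMD : ~ M (\det (ulsubmx q2 + (ulsubmx q2)^T)).
  have trE : (ulsubmx q2)^T =2 (fun k l => ulsubmx q2 l k) by move=> k l; rewrite mxE.
  have addE k l : (ulsubmx q2 + (ulsubmx q2)^T) k l = ulsubmx q2 k l + ulsubmx q2 l k.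
    by rewrite mxE trE.
  rewrite det_2x2 !addE [ulsubmx q2 1 0 + _]addrC HB01 HB10 q2b.
  set u := ulsubmx q2 0 0; set w := ulsubmx q2 1 1; set b := q1 i j + _ in Hij *.
  have -> : (u + u) * (w + w) - b * b = - b ^+ 2 + 2%:R * (2%:R * u * w) by ring.
  apply: (not_memD locM); last exact: idealMr.
  by move/(idealN iM); rewrite opprK => /(prime_exp prM).
have [d Hd] := local_unit noethR locM nMD.
have [|P3 [q' [HP3 Hq']]] := @orthogonal_split R 2 n q2 (d *: \adj (ulsubmx q2 + (ulsubmx q2)^T)).
  by rewrite -scalemxAr mul_mx_adj scale_scalar_mx mulrC Hd.
have EP v : qform q (P1 *m (P2 *m P3) *m v) = qform (block_mx (ulsubmx q2) 0 0 q') v.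
  by rewrite -Hq' -!mulmxA [LHS]qform_mulmx E1 [LHS]qform_mulmx E2.
have HP : invertible_mx (P1 *m (P2 *m P3)) by do 2!apply: invertible_mxM => //.
exists (P1 *m (P2 *m P3)), (q1 i i), (q1 i j + q1 j i), (ulsubmx q2 1 1), q'; split=> //.
  apply: form_disc_block; apply: form_disc_transfer HP _ nMq => v; exact/esym/EP.
move=> v; rewrite EP qform_block_mx qform_2x2 HB00 HB01 HB10 q2a q2b.
by rewrite !mxE -!coord_ord.
Qed.

Lemma residue2_blocks n (q : 'M[R]_n) : M 2%:R -> ~ M (form_disc q) ->
  exists (P : 'M[R]_n) (a b c : nat -> R) (u : R), [/\ invertible_mx P,
    forall v, qform q (P *m v) = \sum_(i < n./2) (a i * coord v i.*2 ^+ 2 +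
       b i * (coord v i.*2 * coord v i.*2.+1) + c i * coord v i.*2.+1 ^+ 2) +
       (if odd n then u * coord v n.-1 ^+ 2 else 0),
    forall i, (i < n./2)%N -> ~ M (a i) & forall i, (i < n./2)%N -> ~ M (b i)].
Proof.
move=> M2; move: {2}(n./2) (erefl n./2) => m; elim: m n q => [|m IHm] n q Hm nMq.
  case: n Hm q nMq => [|[|n]] // _ q nMq.
    exists 1%:M, (fun=> 0), (fun=> 0), (fun=> 0), 0; split=> //; first exact: invertible_mx1.
    by move=> v; rewrite /qform !big_ord0 addr0.
  exists 1%:M, (fun=> 0), (fun=> 0), (fun=> 0), (q 0 0); split=> //; first exact: invertible_mx1.
  move=> v; rewrite mul1mx /qform big_ord0 !big_ord1 add0r /= (coord_ord v ord0).
  by rewrite expr2 mulrA.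
case: n Hm q nMq => [|[|n]] //= [Hm] q nMq.
have [P1 [a0 [b0 [c0 [q' [HP1 Ha0 Hb0 nMq' E1]]]]]] := @residue2_split n q M2 nMq.
have [P2 [a [b [c [u [[P2' HP2] E2 Ha Hb]]]]]] := IHm n q' Hm nMq'.
pose P3 : 'M[R]_(2 + n) := block_mx 1%:M 0 0 P2.
have HP3 : invertible_mx P3.
  exists (block_mx 1%:M 0 0 P2').
  rewrite mulmx_block !(mul0mx, mulmx0, mul1mx, addr0, add0r) HP2.
  by rewrite -scalar_mx_block.
pose ext (x : R) (f : nat -> R) i := if i is i'.+1 then f i' else x.
exists (P1 *m P3), (ext a0 a), (ext b0 b), (ext c0 c), u; split.
- exact: invertible_mxM.
- move=> v; rewrite -mulmxA [LHS]E1 big_ord_recl /= -!addrA.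
  have PE : P3 *m (v : 'cV_(2 + n)) = col_mx (usubmx (v : 'cV_(2 + n))) (P2 *m dsubmx (v : 'cV_(2 + n))).
    by rewrite -[v in LHS](@vsubmxK _ 2 n) mul_block_col !mul0mx mul1mx addr0 add0r.
  have C0 : coord (P3 *m (v : 'cV_(2 + n))) 0 = coord v 0.
    rewrite PE; transitivity (usubmx (v : 'cV_(2 + n)) (0 : 'I_2) 0).
      by rewrite -[RHS](col_mxEu _ (P2 *m dsubmx (v : 'cV_(2 + n)))) -coord_ord.
    by rewrite mxE -coord_ord.
  have C1 : coord (P3 *m (v : 'cV_(2 + n))) 1 = coord v 1.
    rewrite PE; transitivity (usubmx (v : 'cV_(2 + n)) (1 : 'I_2) 0).
      by rewrite -[RHS](col_mxEu _ (P2 *m dsubmx (v : 'cV_(2 + n)))) -coord_ord.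
    by rewrite mxE -coord_ord.
  have C2 i : coord (dsubmx (v : 'cV_(2 + n))) i = coord v i.+2.
    have [ni|ni] := ltnP i n; last first.
      by rewrite /coord !insubF //; apply/negbTE; rewrite -leqNgt.
    rewrite -[i in LHS]/(val (Ordinal ni)) coord_ord mxE -coord_ord.
    by [].
  rewrite C0 C1 PE col_mxKd E2; do 3!congr (_ + _).
  congr (_ + _); first by apply: eq_bigr => i _; rewrite !C2 /= -!addnn !addnS !addSn.
  by rewrite negbK; case: ifP => // on; rewrite C2; congr (u * coord v _ ^+ 2); lia.
- by case=> [|i] im //=; exact: Ha.
- by case=> [|i] im //=; exact: Hb.
Qed.

Lemma half_sum_odd (V : nmodType) n (F : nat -> V) : \sum_(i < n) F i =
  \sum_(i < n./2) (F i + F (n./2 + i)%N) + (if odd n then F n.-1 else 0).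
Proof.
case: ifP => on; last by rewrite addr0 half_sum // on.
case: n on => // n /= on; rewrite big_ord_recr /= half_sum // uphalf_half (negPf on).
by [].
Qed.

(** If [2] is a unit the form is diagonalized and the variables are paired;
    otherwise binary blocks are split off until at most one variable is left.
    The first coefficient of each block is made a unit, so that the block
    splits over a monic quadratic extension. *)
Lemma block_decomposition n (q : 'M[R]_n) : ~ M (form_disc q) ->
  exists (P : 'M[R]_n) (a b : nat -> R), [/\ invertible_mx P,
    forall v, qform q (P *m v) = qform (block_form n a b) v,
    forall i, (i < n./2)%N -> ~ M (a i) &
    forall i, (i < n./2)%N -> ~ M (b i ^+ 2 - 4%:R * (a i * a (n./2 + i)%N))].
Proof.
move=> nMq; case: (pselect (M 2%:R)) => [M2|nM2]; last first.
  have nMd : ~ M (discriminant q).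
    move: nMq; rewrite /form_disc; case: ifP => // on nMq.
    by rewrite -half_discriminant_double // -mulr_natl; exact: (prime_notM prM).
  have [P [d [HP Hd]]] := diagonalization noethR locM nM2 nMd.
  have Hdet : ~ M (discriminant (diag_mx d)).
    rewrite (@discriminant_transfer _ _ q _ P) => [|v]; last by rewrite Hd.
    apply: (prime_notM prM) => //; move/(prime_exp prM).
    exact: (invertible_not_mem noethR locM).
  have nMi i : (i < n)%N -> ~ M (coord d^T i).
    move=> ni; rewrite -[i]/(val (Ordinal ni)) coord_ord mxE => Mi; apply: Hdet.
    rewrite /discriminant tr_diag_mx -linearD det_diag (bigD1 (Ordinal ni)) //= !mxE.
    by apply: idealMr => //; exact: idealD.
  exists P, (coord d^T), (fun=> 0); split=> //.
  - move=> v; rewrite Hd; congr qform; apply/matrixP=> i j; rewrite !mxE mul0rn addr0.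
    by rewrite coord_ord mxE.
  - by move=> i im; apply: nMi; lia.
  - move=> i im; have ni : (i < n)%N by lia. have nmi : (n./2 + i < n)%N by lia.
    have -> : 0 ^+ 2 - 4%:R * (coord d^T i * coord d^T (n./2 + i)) =
       (- 1) * (2%:R * 2%:R * (coord d^T i * coord d^T (n./2 + i))) :> R by ring.
    have n1 := not_mem_unit noethR locM (etrans (mulrNN 1 (1 : R)) (mulr1 1)).
    by do ![apply: (prime_notM prM) => //]; exact: nMi.
have [P [a [b [c [u [HP E Ha Hb]]]]]] := residue2_blocks M2 nMq.
set m := n./2 in E Ha Hb *.
(* The pairs [(2 i, 2 i + 1)] are moved to [(i, m + i)]. *)
pose s i := (if i < m then i.*2 else if i < m.*2 then (i - m).*2.+1 else i)%N.
pose t i := (if i < m.*2 then (if odd i then m + i./2 else i./2) else i)%N.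
have mn : (m.*2 <= n)%N by rewrite /m -{2}[n]odd_double_half leq_addl.
have ts i : t (s i) = i.
  rewrite /s /t; case: (ltnP i m) => im; first by rewrite ltn_double im odd_double doubleK.
  case: (ltnP i m.*2) => im2; last by rewrite ltnNge im2.
  rewrite (_ : (_ < m.*2)%N) /= ?odd_double /= ?uphalf_double ?subnKC //.
  by rewrite -(subnKC im) -addnn ltn_add2l in im2; lia.
have st i : s (t i) = i.
  rewrite /s /t; case: (ltnP i m.*2) => im2; last first.
    by rewrite !ltnNge im2 /= (leq_trans _ im2) // -addnn leq_addl.
  have := odd_double_half i; case: (odd i) => /= Hi.
    by rewrite ltnNge leq_addr /= (_ : (_ < _)%N) ?addKn //; lia.
  by rewrite (_ : (_ < m)%N) //; lia.
have sn i : (i < n)%N -> (s i < n)%N.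
  by move=> ni; rewrite /s; case: ifP => [|_]; [lia | case: ifP => [|_] //; lia].
have tn i : (i < n)%N -> (t i < n)%N.
  by move=> ni; rewrite /t; case: ifP => [|_] //; case: ifP => _; lia.
pose a' i := if (i < m)%N then a i else if (i < m.*2)%N then c (i - m)%N else u.
exists (P *m reindex_mx R n t), a', b; split.
- apply: invertible_mxM => //; exists (reindex_mx R n s).
  by apply: reindex_mxK => i ni; [split; [exact: tn|exact: sn] | exact: st].
- move=> v; rewrite -mulmxA E qform_block (half_sum_odd n (fun i => a' i * coord v i ^+ 2)) -/m addrAC -big_split /=.
  congr (_ + _).
    apply: eq_bigr => -[i /= im] _.
    have i2 : (i.*2 < n)%N by lia. have i21 : (i.*2.+1 < n)%N by lia.
    rewrite !reindex_mxE ?tn //.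
    have -> : t i.*2 = i by rewrite /t ltn_double im odd_double doubleK.
    have -> : t i.*2.+1 = (m + i)%N.
      by rewrite /t (_ : (_ < _)%N) /= ?odd_double /= ?uphalf_double //; lia.
    rewrite /a' im ltnNge leq_addr /= (_ : (m + i < m.*2)%N) ?addKn; last by lia.
    by rewrite addrAC.
  case: ifP => // on; have n0 : (n.-1 < n)%N by case: (n) on.
  have En : n.-1 = m.*2 by rewrite /m -{1}[n]odd_double_half on.
  rewrite reindex_mxE ?tn // /a' /t En ltnn (_ : (m.*2 < m)%N = false) //.
  by apply/negbTE; rewrite -leqNgt; lia.
- by move=> i im; rewrite /a' im; exact: Ha.
- move=> i im; have := Hb i im; rewrite /a' im.
  move: (if (m + i < m)%N then _ else _) => x nMb.
  have -> : b i ^+ 2 - 4%:R * (a i * x) = b i ^+ 2 + 2%:R * (2%:R * - (a i * x)) by ring.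
  by apply: (not_memD locM); [move/(prime_exp prM) | exact: idealMr].
Qed.

End BlockDecomposition.

(** * Finite free covers *)

Section FiniteFree.

(** That the coordinates [co] are inverse to linear combination says that the
    [s i] generate and are independent. *)
Definition free_basis (R S : comNzRingType) (phi : R -> S) (I : finType)
    (s : I -> S) (co : S -> I -> R) :=
  (forall x, x = \sum_i phi (co x i) * s i) /\
  (forall (c : I -> R) i, co (\sum_i phi (c i) * s i) i = c i).

(** The index [i0] makes the extension faithful. *)
Definition finite_free (R S : comNzRingType) (phi : R -> S) :=
  exists (I : finType) (s : I -> S) (co : S -> I -> R) (i0 : I), free_basis phi s co.

Lemma finite_free_id (R : comNzRingType) : finite_free (@idfun R).
Proof.
exists unit, (fun=> 1), (fun x _ => x), tt.
have sum1 (F : unit -> R) : \sum_i F i = F tt by rewrite (bigD1 tt) //= big1 ?addr0 // => -[].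
by split=> [x|c []]; rewrite sum1 /= mulr1.
Qed.

Lemma finite_free_comp (R S T : comNzRingType) (phi : {rmorphism R -> S})
  (psi : {rmorphism S -> T}) :
  finite_free phi -> finite_free psi -> finite_free (psi \o phi).
Proof.
move=> [I [s [co [i0 [E C]]]]] [J [t [co' [j0 [E' C']]]]].
exists (J * I)%type, (fun p => psi (s p.2) * t p.1), (fun x p => co (co' x p.1) p.2), (j0, i0).
have split_sum (c : J * I -> R) : \sum_p (psi \o phi) (c p) * (psi (s p.2) * t p.1) =
    \sum_j psi (\sum_i phi (c (j, i)) * s i) * t j.
  rewrite (eq_bigr (fun p => psi (phi (c (p.1, p.2))) * (psi (s p.2) * t p.1))); last by case.
  rewrite -(pair_bigA _ (fun j i => psi (phi (c (j, i))) * (psi (s i) * t j))) /=.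
  apply: eq_bigr => j _; rewrite rmorph_sum mulr_suml; apply: eq_bigr => i _.
  by rewrite rmorphM mulrA.
split=> [x|c [j i]]; rewrite split_sum.
  by rewrite {1}[x]E'; apply: eq_bigr => j _ /=; rewrite -E.
by rewrite /= C' C.
Qed.

Section Flat.
Variables (R S : comNzRingType) (phi : {rmorphism R -> S}) (I : finType).
Variables (s : I -> S) (co : S -> I -> R).
Hypothesis bas : free_basis phi s co.

Lemma free_basis_coD x y i : co (x + y) i = co x i + co y i.
Proof.
case: bas => E C; rewrite -(C (fun i => co x i + co y i)); congr (co _ i).
rewrite {1}[x]E {1}[y]E -big_split; apply: eq_bigr => j _.
by rewrite rmorphD mulrDl.
Qed.

Lemma free_basis_coM r x i : co (phi r * x) i = r * co x i.
Proof.
case: bas => E C; rewrite -(C (fun i => r * co x i)); congr (co _ i).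
by rewrite {1}[x]E mulr_sumr; apply: eq_bigr => j _; rewrite rmorphM mulrA.
Qed.

Lemma free_basis_co_basis i j : co (s i) j = (j == i)%:R.
Proof.
case: bas => E C; rewrite -(C (fun j => (j == i)%:R)); congr (co _ j).
rewrite (bigD1 i) //= eqxx rmorph1 mul1r big1 ?addr0 // => k /negPf ->.
by rewrite rmorph0 mul0r.
Qed.

Section Tensor.
Variables (N : lmodType R) (T : zmodType) (t : N -> S -> T).
Hypothesis tensT : is_tensor phi t.

Lemma tensor0 x : t 0 x = 0.
Proof.
case: tensT => -[tD _ _] _; apply: (@addrI _ (t 0 x)).
by rewrite -tD !addr0.
Qed.

(** A tensor product with a free algebra is a direct sum of copies of the
    module, by its universal property. *)
Lemma tensor_coords : exists h : {additive T -> {ffun I -> N}},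
  (forall m x, h (t m x) = [ffun i => co x i *: m]) /\
  (forall y, y = \sum_i t (h y i) (s i)).
Proof.
case: tensT => -[tD tDr tZ] univ.
have [h [Hh _]] : exists h : {additive T -> {ffun I -> N}},
    (forall m x, h (t m x) = [ffun i => co x i *: m]) /\
    (forall h' : {additive T -> {ffun I -> N}},
      (forall m x, h' (t m x) = [ffun i => co x i *: m]) -> h' =1 h).
  apply: (univ _ (fun m x => [ffun i => co x i *: m])).
  split=> [m m' x|m x x'|r m x]; apply/ffunP=> i; rewrite !ffunE.
  - by rewrite scalerDr.
  - by rewrite free_basis_coD scalerDl.
  - by rewrite free_basis_coM scalerA mulrC.
exists h; split=> //.
pose th (y : T) : T := \sum_i t (h y i) (s i).
have thB : zmod_morphism th.
  move=> x y; rewrite /th raddfB -sumrB; apply: eq_bigr => i _.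
  rewrite !ffunE; apply/eqP; rewrite eq_sym subr_eq -tD.
  by rewrite subrK.
pose thm := GRing.isZmodMorphism.Build T T th thB.
pose Th : {additive T -> T} := HB.pack th thm.
have [k [_ ku]] := univ T t (And3 tD tDr tZ).
have E1 : Th =1 k.
  apply: ku => m x; rewrite /Th /= /th Hh.
  case: bas => E _; rewrite [x in RHS]E.
  have tsum (J : Type) (e : seq J) (F : J -> S) : t m (\sum_(j <- e) F j) = \sum_(j <- e) t m (F j).
    elim/big_rec2: _ => [|j y1 y2 _ <-]; last by rewrite tDr.
    by apply: (@addrI _ (t m 0)); rewrite -tDr !addr0.
  by rewrite tsum; apply: eq_bigr => i _; rewrite ffunE tZ.
have E2 : @idfun T =1 k by exact: (ku idfun).
by move=> y; rewrite {1}[y](E2 y) -E1.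
Qed.

Lemma tensor_injective (m : I -> N) : \sum_i t (m i) (s i) = 0 -> forall i, m i = 0.
Proof.
have [h [Hh _]] := tensor_coords; move=> E i.
have := congr1 (fun y => h y i) E; rewrite raddf0 raddf_sum sum_ffunE ffunE => <-.
rewrite (bigD1 i) //= Hh ffunE free_basis_co_basis eqxx scale1r big1 ?addr0 // => j.
by rewrite Hh ffunE free_basis_co_basis eq_sym => /negPf ->; rewrite scale0r.
Qed.

Lemma tensor_single i (m : N) : t m (s i) = 0 -> m = 0.
Proof.
move=> E; have := @tensor_injective (fun j => if j == i then m else 0).
rewrite (bigD1 i) //= eqxx E big1 => [|j /negPf ->]; last exact: tensor0.
by move=> /(_ (addr0 _)) /(_ i); rewrite eqxx.
Qed.

End Tensor.

End Flat.

(** Tensoring a complex with a free algebra gives a power of that complex, with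
    a nonzero exponent. *)
Lemma finite_free_faithfully_flat (R S : comNzRingType) (phi : {rmorphism R -> S}) :
  finite_free phi -> faithfully_flat phi.
Proof.
move=> [I [s [co [i0 bas]]]] M1 M2 M3 f g T1 T2 T3 t1 t2 t3 fS gS tens1 tens2 tens3 Hf Hg.
have sumf (F : I -> M1) : fS (\sum_i t1 (F i) (s i)) = \sum_i t2 (f (F i)) (s i).
  by rewrite raddf_sum; apply: eq_bigr => i _; rewrite Hf.
have sumg (F : I -> M2) : gS (\sum_i t2 (F i) (s i)) = \sum_i t3 (g (F i)) (s i).
  by rewrite raddf_sum; apply: eq_bigr => i _; rewrite Hg.
have [h1 [_ E1]] := tensor_coords bas tens1.
have [h2 [_ E2]] := tensor_coords bas tens2.
split=> ex y; split.
- move=> gy0; have Hi i : g (h2 y i) = 0.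
    by apply: (tensor_injective bas tens3 (m := fun i => g (h2 y i))); rewrite -sumg -E2.
  have /choice[F HF] : forall i, exists x, f x = h2 y i by move=> i; apply/ex.
  exists (\sum_i t1 (F i) (s i)); rewrite sumf [RHS]E2.
  by apply: eq_bigr => i _; rewrite HF.
- move=> [x <-]; rewrite [x]E1 sumf sumg big1 // => i _.
  have -> : g (f (h1 x i)) = 0 by apply/ex; exists (h1 x i).
  exact: (tensor0 tens3).
- move=> gy0; have : gS (t2 y (s i0)) = 0 by rewrite Hg gy0 (tensor0 tens3).
  move/ex => [x]; rewrite [x]E1 sumf => E; exists (h1 x i0).
  have [tD _ _] : balanced phi t2 by case: tens2.
  have := tensor_injective bas tens2 (m := fun i => f (h1 x i) - (if i == i0 then y else 0)).
  move=> /(_ _ i0); rewrite eqxx => H; apply/eqP; rewrite -subr_eq0; apply/eqP/H.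
  have tB a b c : t2 (a - b) c = t2 a c - t2 b c.
    by apply/eqP; rewrite eq_sym subr_eq -tD subrK.
  under eq_bigr => i _ do rewrite tB.
  rewrite sumrB E (bigD1 i0) //= eqxx big1 ?addr0 ?subrr // => i /negPf ->.
  exact: (tensor0 tens2).
- move=> [x <-]; apply: (tensor_single bas tens3 (i := i0)).
  by rewrite -Hg; apply/ex; exists (t1 x (s i0)); rewrite Hf.
Qed.

End FiniteFree.

(** The pair [(x, y)] stands for [x + y t] in [A[t] / (t^2 - beta t + gamma)]. *)
Definition quad_ext (A : comNzRingType) (beta gamma : A) : Type := (A * A)%type.

Section QuadExt.
Variables (A : comNzRingType) (beta gamma : A).
Local Notation Q := (quad_ext beta gamma).

HB.instance Definition _ := GRing.Zmodule.copy Q (A * A)%type.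

Definition quad_one : Q := (1, 0).
Definition quad_mul (x y : Q) : Q :=
  (x.1 * y.1 - gamma * (x.2 * y.2), x.1 * y.2 + x.2 * y.1 + beta * (x.2 * y.2)).

Fact quad_mulA : associative quad_mul.
Proof. by move=> [x x'] [y y'] [z z']; congr (_, _) => /=; ring. Qed.
Fact quad_mulC : commutative quad_mul.
Proof. by move=> [x x'] [y y']; congr (_, _) => /=; ring. Qed.
Fact quad_mul1 : left_id quad_one quad_mul.
Proof. by move=> [x x']; congr (_, _) => /=; ring. Qed.
Fact quad_mulDl : left_distributive quad_mul +%R.
Proof. by move=> [x x'] [y y'] [z z']; congr (_, _) => /=; ring. Qed.
Fact quad_one_neq0 : quad_one != 0.
Proof. by apply/eqP => -[] /eqP; rewrite oner_eq0. Qed.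

HB.instance Definition _ := GRing.Zmodule_isComNzRing.Build Q
  quad_mulA quad_mulC quad_mul1 quad_mulDl quad_one_neq0.

Definition quad_in (x : A) : Q := (x, 0).
Definition quad_root : Q := (0, 1).

Fact quad_in_zmod : zmod_morphism quad_in.
Proof. by move=> x y; congr (_, _); rewrite /= subr0. Qed.
Fact quad_in_monoid : monoid_morphism quad_in.
Proof. by split=> // x y; congr (_, _) => /=; ring. Qed.
HB.instance Definition _ := GRing.isZmodMorphism.Build A Q quad_in quad_in_zmod.
HB.instance Definition _ := GRing.isMonoidMorphism.Build A Q quad_in quad_in_monoid.

Lemma quad_rootP : quad_root ^+ 2 = quad_in beta * quad_root - quad_in gamma.
Proof. by congr (_, _) => /=; ring. Qed.

Lemma quad_ext_free : finite_free quad_in.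
Proof.
exists bool, (fun b => if b then quad_root else 1), (fun x b => if b then x.2 else x.1), true.
split=> [[x y]|c b]; rewrite (bigD1 true) //= (bigD1 false) //= big1 ?addr0; try by case.
  by congr (_, _) => /=; ring.
by case: b => /=; ring.
Qed.

End QuadExt.

Lemma quadratic_tower (R : comNzRingType) (beta gamma : nat -> R) k :
  exists (S : comNzRingType) (phi : {rmorphism R -> S}) (t : nat -> S),
    finite_free phi /\
    forall i, (i < k)%N -> t i ^+ 2 = phi (beta i) * t i - phi (gamma i).
Proof.
elim: k => [|k [S [phi [t [Ff Ht]]]]].
  by exists R, idfun, (fun=> 0); split; first exact: finite_free_id.
pose Q := quad_ext (phi (beta k)) (phi (gamma k)).
pose psi : {rmorphism S -> Q} := @quad_in S (phi (beta k)) (phi (gamma k)).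
exists Q, (psi \o phi), (fun i => if i == k then quad_root _ _ else psi (t i)); split.
  by apply: finite_free_comp => //; exact: quad_ext_free.
move=> i; rewrite ltnS leq_eqVlt => /orP[/eqP ->|ik].
  by rewrite eqxx quad_rootP.
by rewrite ltn_eqF // -rmorphXn Ht // rmorphB rmorphM.
Qed.

Lemma map_block_form (A B : comNzRingType) (f : {rmorphism A -> B}) n (a b : nat -> A) :
  map_mx f (block_form n a b) = block_form n (f \o a) (f \o b).
Proof. by apply/matrixP=> i j; rewrite !mxE rmorphD !rmorphMn. Qed.

(** A block [a x^2 + b x y + c y^2] with [a] invertible factors as
    [a (x - rho y) (x + (b / a + rho) y)] once a root [rho] of
    [t^2 + (b / a) t + c / a] is adjoined. *)
Lemma split_cover (R : comNzRingType) n (a a' b : nat -> R) :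
  (forall i, (i < n./2)%N -> a i * a' i = 1) ->
  exists (S : comNzRingType) (phi : {rmorphism R -> S}) (H : 'M[S]_n),
    finite_free phi /\
    forall v, qform (split_form S n) (H *m v) = qform (map_mx phi (block_form n a b)) v.
Proof.
move=> aa'; set m := n./2 in aa' *.
have [S [phi [t [Ff Ht]]]] := quadratic_tower
  (fun i => if (i < m)%N then - (b i * a' i) else 0)
  (fun i => if (i < m)%N then a (m + i)%N * a' i else - a n.-1) m.+1.
pose p i := if (i < m)%N then phi (a i) else
  if (i < m.*2)%N then phi (b (i - m)%N * a' (i - m)%N) + t (i - m)%N else t m.
pose r i := if (i < m)%N then - (phi (a i) * t i) else if (i < m.*2)%N then 1 else 0.
pose tau i := if (i < m)%N then (m + i)%N else if (i < m.*2)%N then (i - m)%N else i.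
exists S, phi, (sparse_mx n p r tau); split=> // v.
rewrite split_form_block map_block_form !qform_block.
rewrite (half_sum_odd n (fun i => (odd n && (i == n.-1))%:R * coord (sparse_mx n p r tau *m v) i ^+ 2)).
rewrite (half_sum_odd n (fun i => (phi \o a) i * coord v i ^+ 2)) -/m.
rewrite addrAC [RHS]addrAC -!big_split /=; congr (_ + _).
  apply: eq_bigr => -[i /= im] _; have a1 : phi (a i) * phi (a' i) = 1 by rewrite -rmorphM aa' ?rmorph1.
  have imT : (i < m)%N = true by exact: im.
  have root := Ht i (ltnW im); rewrite !imT in root.
  have ni : (i < n)%N by lia. have nmi : (m + i < n)%N by lia.
  have mi2 : (m + i < m.*2)%N by lia.
  have E0 : coord (sparse_mx n p r tau *m v) i = phi (a i) * (coord v i - t i * coord v (m + i)).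
    by rewrite sparse_mxE /tau /p /r ?imT //; ring.
  have E1 : coord (sparse_mx n p r tau *m v) (m + i) =
      (phi (b i * a' i) + t i) * coord v (m + i) + coord v i.
    have F : (m + i < m)%N = false by apply/negbTE; lia.
    by rewrite sparse_mxE /tau /p /r ?F ?mi2 ?addKn // mul1r.
  rewrite E0 E1 (_ : (i == n.-1) = false) ?andbF; last by apply/negP; lia.
  rewrite (_ : odd n && (m + i == n.-1)%N = false); last by apply/negP; lia.
  rewrite !mul0r !add0r mul1r; set x := coord v i; set y := coord v (m + i).
  have -> : phi (a i) * (x - t i * y) * ((phi (b i * a' i) + t i) * y + x) =
    phi (a i) * x ^+ 2 + phi (a i) * phi (b i * a' i) * (x * y)
     - phi (a i) * (t i ^+ 2 + phi (b i * a' i) * t i) * y ^+ 2 by ring.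
  rewrite root rmorphN !rmorphM.
  have -> : - (phi (b i) * phi (a' i)) * t i - phi (a (m + i)%N) * phi (a' i) +
     phi (b i) * phi (a' i) * t i = - (phi (a (m + i)%N) * phi (a' i)) by ring.
  have -> : phi (a i) * x ^+ 2 + phi (a i) * (phi (b i) * phi (a' i)) * (x * y)
    - phi (a i) * - (phi (a (m + i)%N) * phi (a' i)) * y ^+ 2 =
    phi (a i) * x ^+ 2 + (phi (a i) * phi (a' i)) * (phi (b i) * (x * y))
    + (phi (a i) * phi (a' i)) * (phi (a (m + i)%N) * y ^+ 2) by ring.
  by rewrite a1 !mul1r addrAC.
case: ifP => // on; have En : n.-1 = m.*2 by rewrite /m -{1}[n]odd_double_half on.
have root := Ht m (ltnSn _); rewrite /= ltnn rmorph0 mul0r sub0r rmorphN opprK in root.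
have F1 : (m.*2 < m)%N = false by apply/negbTE; lia.
rewrite on eqxx /= mul1r sparse_mxE /tau /p /r ?En ?F1 ?ltnn; try by lia.
by rewrite mul0r addr0 exprMn root En.
Qed.

(** * Torsors as closed functors of matrices *)

Lemma rmorphism_ext (A B : comNzRingType) (f g : {rmorphism A -> B}) : f =1 g -> f = g.
Proof.
case: f g => f cf [g cg] /= /funext fg; move: cf cg; rewrite fg => cf cg.
congr (GRing.RMorphism.Pack _); case: cf cg => -[a] [b] [[a'] [b']].
by rewrite (Prop_irrelevance a a') (Prop_irrelevance b b').
Qed.

Lemma rmorphism_of (A B : comNzRingType) (f : A -> B) :
  (forall x y, f (x + y) = f x + f y) -> (forall x y, f (x * y) = f x * f y) ->
  f 1 = 1 -> exists g : {rmorphism A -> B}, g =1 f.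
Proof.
move=> fD fM f1; have f0 : f 0 = 0 by apply: (@addrI _ (f 0)); rewrite -fD !addr0.
have fB : zmod_morphism f.
  by move=> x y; apply/eqP; rewrite eq_sym subr_eq -fD subrK.
pose m1 := GRing.isZmodMorphism.Build A B f fB.
pose m2 := GRing.isMonoidMorphism.Build A B f (conj f1 fM).
pose g : {rmorphism A -> B} := HB.pack f m1 m2.
by exists g.
Qed.

Lemma quotient_ring (P : comNzRingType) (I : P -> Prop) : is_ideal I -> ~ I 1 ->
  exists (B : comNzRingType) (pi : {rmorphism P -> B}),
    [/\ forall p, I p -> pi p = 0, forall b, exists p, b = pi p &
     forall (A : comNzRingType) (f : {rmorphism P -> A}), (forall p, I p -> f p = 0) ->
       exists y : {rmorphism B -> A}, forall p, y (pi p) = f p].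
Proof.
move=> iI nI1; pose S : P -> bool := fun p => `[< I p >].
have SP p : p \in S <-> I p by split=> /asboolP.
have idS : idealr_closed S.
  split; first by apply/SP; exact: ideal0.
    by apply/negP => /SP.
  by move=> a u v /SP Iu /SP Iv; apply/SP; apply: idealD => //; exact: idealM.
pose m1 := isIdealr.Build P S idS.
pose K : idealr P := HB.pack S m1.
pose B : comNzRingType := {ideal_quot K}.
pose pi : {rmorphism P -> B} := \pi_{ideal_quot K}%qT.
have piP p q : pi p = pi q <-> I (p - q).
  split; first by move=> /eqmodP E; apply/SP; move: E; rewrite /= Quotient.equivE.
  by move=> /SP Ipq; apply/eqmodP; rewrite /= Quotient.equivE.
exists B, pi; split.
- by move=> p Ip; rewrite -(rmorph0 pi); apply/piP; rewrite subr0.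
- by move=> b; exists (repr (b : {ideal_quot K})); exact/esym/(@reprK _ {ideal_quot K}).
- move=> A f fI; have fE p q : pi p = pi q -> f p = f q.
    by move=> /piP /fI; rewrite rmorphB => /eqP; rewrite subr_eq0 => /eqP.
  have rE (b : {ideal_quot K}) : pi (repr b) = b by exact: reprK.
  have [|||y Hy] := @rmorphism_of B A (fun b => f (repr b)).
  + move=> x y; have H : pi (repr (x + y)) = pi (repr x + repr y).
      by rewrite rmorphD !rE.
    by rewrite (fE _ _ H) rmorphD.
  + move=> x y; have H : pi (repr (x * y)) = pi (repr x * repr y).
      by rewrite rmorphM !rE.
    by rewrite (fE _ _ H) rmorphM.
  + have H : pi (repr (1 : B)) = pi 1 by rewrite rmorph1 rE.
    by rewrite (fE _ _ H) rmorph1.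
  by exists y => p; rewrite Hy; apply: fE; rewrite rE.
Qed.

Section Torsor.
Variables (R : comNzRingType) (n : nat) (Gf : matrix_functor n).
Local Notation G := (@Gf _).
Hypothesis G1 : forall A : comNzRingType, G (1%:M : 'M[A]_n).
Hypothesis GM : forall (A : comNzRingType) (g h : 'M[A]_n), G g -> G h -> G (g *m h).
Hypothesis Gmap : forall (A B : comNzRingType) (f : {rmorphism A -> B}) (g : 'M[A]_n),
  G g -> G (map_mx f g).
Hypothesis Ginv : forall (A : comNzRingType) (g : 'M[A]_n), G g ->
  exists2 h, g *m h = 1%:M & h *m g = 1%:M.

Variable F : forall A : comNzRingType, {rmorphism R -> A} -> 'M[A]_n -> Prop.

(** [F] is the functor of points of a closed subscheme of the space of
    matrices: it contains every point at which all functions vanishing on the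
    points of [F] do. *)
Definition closed_functor := forall (P B : comNzRingType) (psi : {rmorphism R -> P})
  (X : 'M[P]_n) (pi : {rmorphism P -> B}),
  (forall p, (forall (A : comNzRingType) (f : {rmorphism P -> A}),
     F (f \o psi) (map_mx f X) -> f p = 0) -> pi p = 0) ->
  F (pi \o psi) (map_mx pi X).

Hypothesis Fclosed : closed_functor.
Hypothesis Fmul : forall (A : comNzRingType) (psi : {rmorphism R -> A}) (g h H : 'M[A]_n),
  F psi H -> G g -> g *m h = 1%:M -> F psi (h *m H).
Hypothesis Finv : forall (A : comNzRingType) (psi : {rmorphism R -> A}) (H : 'M[A]_n),
  F psi H -> exists K, H *m K = 1%:M.
Hypothesis Ftrans : forall (A : comNzRingType) (psi : {rmorphism R -> A}) (H H' : 'M[A]_n),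
  F psi H -> F psi H' -> exists2 g, G g & H = g *m H'.

Lemma closed_functor_map (A B : comNzRingType) (psi : {rmorphism R -> A}) (f : {rmorphism A -> B})
  (H : 'M[A]_n) : F psi H -> F (f \o psi) (map_mx f H).
Proof.
move=> FH; apply: Fclosed => p Hp; rewrite (_ : p = 0) ?rmorph0 //.
have -> : p = idfun p by []; apply: Hp.
rewrite (_ : map_mx idfun H = H); last by apply/matrixP=> i j; rewrite mxE.
by rewrite (_ : (idfun \o psi : {rmorphism R -> A}) = psi) //; exact: rmorphism_ext.
Qed.

(** The quotient of the ring of polynomials in the matrix entries by those that
    vanish on all points of [F]; the point over [K] shows that it is not
    zero. *)
Lemma coordinate_ring (K : comNzRingType) (kap : {rmorphism R -> K}) (HK : 'M[K]_n) :
  F kap HK ->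
  exists (B : comNzRingType) (str : {rmorphism R -> B}) (X : 'M[B]_n),
  [/\ F str X,
    forall (A : comNzRingType) (psi : {rmorphism R -> A}) H, F psi H ->
      exists y : {rmorphism B -> A}, y \o str =1 psi /\ map_mx y X = H &
    forall (A : comNzRingType) (y y' : {rmorphism B -> A}),
      y \o str =1 y' \o str -> map_mx y X = map_mx y' X -> y =1 y'].
Proof.
move=> FK; pose P := {mpoly R[n * n]}.
pose psi : {rmorphism R -> P} := @mpolyC (n * n) R.
pose X : 'M[P]_n := \matrix_(i, j) 'X_(mxvec_index i j).
pose I (p : P) := forall (A : comNzRingType) (f : {rmorphism P -> A}),
  F (f \o psi) (map_mx f X) -> f p = 0.
have eval (A : comNzRingType) (phi : {rmorphism R -> A}) (H : 'M[A]_n) :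
    exists f : {rmorphism P -> A}, f \o psi =1 phi /\ map_mx f X = H.
  exists (mmap phi (fun k => mxvec H 0 k)); split=> [r|]; first by rewrite /= mmapC.
  by apply/matrixP=> i j; rewrite !mxE /= mmapX mmap1U mxvecE.
have evalF (A : comNzRingType) (phi : {rmorphism R -> A}) (H : 'M[A]_n)
    (f : {rmorphism P -> A}) : f \o psi =1 phi -> map_mx f X = H -> F phi H ->
    F (f \o psi) (map_mx f X).
  by move=> E ->; rewrite (rmorphism_ext E).
have iI : is_ideal I.
  split=> [A f _|p q Ip Iq A f Ff|r p Ip A f Ff]; first exact: rmorph0.
    by rewrite rmorphD Ip // Iq // addr0.
  by rewrite rmorphM Ip // mulr0.
have nI1 : ~ I 1.
  have [f [E1 E2]] := eval _ kap HK; move=> /(_ _ f (evalF _ _ _ _ E1 E2 FK)) /eqP.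
  by rewrite rmorph1 oner_eq0.
have [B [pi [piI piS lift]]] := quotient_ring iI nI1.
exists B, (pi \o psi), (map_mx pi X); split.
- exact: Fclosed.
- move=> A phi H FH; have [f [E1 E2]] := eval _ phi H.
  have [|y Hy] := lift _ f; first by move=> p; apply; exact: evalF E1 E2 FH.
  exists y; split=> [r|]; first by rewrite /= Hy -E1.
  by rewrite -map_mx_comp -E2; apply/matrixP=> i j; rewrite !mxE /= Hy.
- move=> A y y' E1 E2 b; have [p ->] := piS b; elim/mpolyind: p => [|c m p _ _ IHp].
    by rewrite !rmorph0.
  rewrite !rmorphD IHp; congr (_ + _).
  have XE : y (pi 'X_[m]) = y' (pi 'X_[m]).
    rewrite mpolyXE_id !rmorph_prod; apply: eq_bigr => k _; rewrite !rmorphXn; congr (_ ^+ _).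
    case/mxvec_indexP: k => i j; have /matrixP/(_ i j) := E2.
    by rewrite !mxE.
  rewrite -mul_mpolyC !rmorphM XE; congr (_ * _); exact: E1.
Qed.

(** The right action moves the point [H] to [g^-1 H]. Points of the coordinate
    ring are determined by the structure map and the universal matrix, which
    reduces every axiom to a computation with matrices; a point over [S]
    trivializes the action, and the image of [1] under a trivialization is a
    point. *)
Lemma torsor_action (K : comNzRingType) (kap : {rmorphism R -> K}) (HK : 'M[K]_n) :
  F kap HK ->
  exists E : affine_action R Gf,
    (forall (S : comNzRingType) (phi : {rmorphism R -> S}) (H : 'M[S]_n),
       F phi H -> trivial_over E phi) /\
    (trivial_over E (@idfun R) -> exists H, F (@idfun R) H).
Proof.
move=> FK; have [B [str [X [FX point uniq]]]] := coordinate_ring FK.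
have Fpt (A : comNzRingType) (y : {rmorphism B -> A}) : F (y \o str) (map_mx y X).
  exact: closed_functor_map.
have inv_uniq (A : comNzRingType) (g h h' : 'M[A]_n) : G g ->
    g *m h = 1%:M -> g *m h' = 1%:M -> h = h'.
  move=> Gg gh gh'; have [k _ kg] := Ginv Gg.
  by rewrite -[h]mul1mx -[h']mul1mx -kg -!mulmxA gh gh'.
have op_ex (A : comNzRingType) (x : {rmorphism B -> A}) (g : 'M[A]_n) :
    exists y : {rmorphism B -> A}, G g -> forall h, g *m h = 1%:M ->
      y \o str =1 x \o str /\ map_mx y X = h *m map_mx x X.
  case: (pselect (G g)) => [Gg|]; last by exists x.
  have [h gh _] := Ginv Gg.
  have [y Hy] := point _ _ _ (Fmul (Fpt _ x) Gg gh).
  by exists y => _ h' gh'; rewrite -(inv_uniq _ _ _ _ Gg gh gh').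
pose op A x g := projT1 (cid (op_ex A x g)).
have opP (A : comNzRingType) (x : {rmorphism B -> A}) (g h : 'M[A]_n) : G g ->
    g *m h = 1%:M -> op A x g \o str =1 x \o str /\ map_mx (op A x g) X = h *m map_mx x X.
  by move=> Gg gh; exact: (projT2 (cid (op_ex A x g)) Gg h gh).
have op_over (A : comNzRingType) x (g : 'M[A]_n) : G g -> op A x g \o str =1 x \o str.
  by move=> Gg; have [h gh _] := Ginv Gg; case: (opP _ x g h Gg gh).
have op_one (A : comNzRingType) x : op A x 1%:M =1 x.
  have [E1 E2] := opP A x _ _ (G1 A) (mulmx1 _).
  by apply: uniq => //; rewrite E2 mul1mx.
have op_mul (A : comNzRingType) x (g h : 'M[A]_n) : G g -> G h ->
    op A x (g *m h) =1 op A (op A x g) h.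
  move=> Gg Gh; have [g' gg' _] := Ginv Gg; have [h' hh' _] := Ginv Gh.
  have gh : g *m h *m (h' *m g') = 1%:M.
    by rewrite mulmxA -(mulmxA g) hh' mulmx1.
  have [E1 E2] := opP _ x _ _ (GM Gg Gh) gh.
  have [E3 E4] := opP _ x _ _ Gg gg'; have [E5 E6] := opP _ (op A x g) _ _ Gh hh'.
  by apply: uniq => [r|]; [rewrite E1 E5 E3 | rewrite E2 E6 E4 mulmxA].
have op_nat (A A' : comNzRingType) (f : {rmorphism A -> A'}) (x : {rmorphism B -> A})
    (g : 'M[A]_n) : G g -> op A' (f \o x) (map_mx f g) =1 f \o op A x g.
  move=> Gg; have [h gh _] := Ginv Gg.
  have fgh : map_mx f g *m map_mx f h = 1%:M by rewrite -map_mxM gh map_mx1.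
  have [E1 E2] := opP _ (f \o x) _ _ (Gmap f Gg) fgh.
  have [E3 E4] := opP _ x _ _ Gg gh.
  apply: uniq => [r|]; first by rewrite E1 /= -[op A x g _]/((op A x g \o str) r) E3.
  rewrite E2 [RHS]map_mx_comp E4 map_mxM; congr (_ *m _).
  by rewrite [LHS]map_mx_comp.
pose E : affine_action R Gf := @Build_affine_action R n Gf B str op op_over op_one op_mul op_nat.
exists E; split=> [S phi H0 FH0|[i [i1 _ _ _]]].
  have FA (A : comNzRingType) (psi : {rmorphism S -> A}) : F (psi \o phi) (map_mx psi H0).
    exact: closed_functor_map.
  have i_ex (A : comNzRingType) (psi : {rmorphism S -> A}) (g : 'M[A]_n) :
      exists y : {rmorphism B -> A}, G g -> forall h, g *m h = 1%:M ->
        y \o str =1 psi \o phi /\ map_mx y X = h *m map_mx psi H0.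
    case: (pselect (G g)) => [Gg|nGg]; last first.
      by have [y _] := point _ _ _ (FA A psi); exists y.
    have [h gh _] := Ginv Gg.
    have [y Hy] := point _ _ _ (Fmul (FA A psi) Gg gh).
    by exists y => _ h' gh'; rewrite -(inv_uniq _ _ _ _ Gg gh gh').
  pose i A psi g := projT1 (cid (i_ex A psi g)).
  have iP (A : comNzRingType) (psi : {rmorphism S -> A}) (g h : 'M[A]_n) : G g ->
      g *m h = 1%:M -> i A psi g \o str =1 psi \o phi /\
      map_mx (i A psi g) X = h *m map_mx psi H0.
    by move=> Gg gh; exact: (projT2 (cid (i_ex A psi g)) Gg h gh).
  exists i; split.
  - by move=> A psi g Gg; have [h gh _] := Ginv Gg; case: (iP _ psi g h Gg gh).
  - move=> A A' f psi g Gg; have [h gh _] := Ginv Gg.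
    have fgh : map_mx f g *m map_mx f h = 1%:M by rewrite -map_mxM gh map_mx1.
    have [E1 E2] := iP _ (f \o psi) _ _ (Gmap f Gg) fgh.
    have [E3 E4] := iP _ psi _ _ Gg gh.
    apply: uniq => [r|]; first by rewrite E1 /= -[i A psi g _]/((i A psi g \o str) r) E3.
    rewrite E2 [RHS]map_mx_comp E4 map_mxM; congr (_ *m _).
    by rewrite [LHS]map_mx_comp.
  - move=> A psi g h Gg Gh; have [g' gg' _] := Ginv Gg; have [h' hh' _] := Ginv Gh.
    have gh : g *m h *m (h' *m g') = 1%:M.
      by rewrite mulmxA -(mulmxA g) hh' mulmx1.
    have [E1 E2] := iP _ psi _ _ (GM Gg Gh) gh.
    have [E3 E4] := iP _ psi _ _ Gg gg'; have [E5 E6] := opP _ (i A psi g) _ _ Gh hh'.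
    by apply: uniq => [r|]; [rewrite E1 E5 E3 | rewrite E2 E6 E4 mulmxA].
  - move=> A psi y Ey; have FY := Fpt _ y; rewrite (rmorphism_ext Ey) in FY.
    have [g Gg Eg] := Ftrans (FA A psi) FY; have [h gh hg] := Ginv Gg.
    have [E1 E2] := iP _ psi _ _ Gg gh.
    exists g; split.
      split=> //; apply: uniq => [r|]; first by rewrite E1 Ey.
      by rewrite E2 Eg mulmxA hg mul1mx.
    move=> g' [Gg' Ey']; have [h' gh' hg'] := Ginv Gg'.
    have [_ E2'] := iP _ psi _ _ Gg' gh'.
    have Eg' : map_mx psi H0 = g' *m map_mx y X.
      have -> : map_mx y X = map_mx (i A psi g') X by apply/matrixP=> k l; rewrite !mxE Ey'.
      by rewrite E2' mulmxA gh' mul1mx.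
    have [Y' YY'] := Finv FY.
    by rewrite -[g]mulmx1 -[g']mulmx1 -YY' !mulmxA -Eg -Eg'.
have Ey := i1 R idfun 1%:M (G1 R); exists (map_mx (i R idfun 1%:M) X).
have := Fpt _ (i R idfun 1%:M).
by rewrite (rmorphism_ext (g := idfun) (Ey : i R idfun 1%:M \o str =1 idfun)).
Qed.

End Torsor.

(** * Transporters to the split form *)

Section Fractions.
Variable R : idomainType.

Lemma fraction_repr (z : {fraction R}) : exists a b : R, b != 0 /\ z * tofrac b = tofrac a.
Proof.
elim/quotW: z => x; have d0 := denom_ratioP x; exists (\n_x), (\d_x); split=> //.
unlock tofrac; rewrite -[LHS]FracField.pi_mul; apply/eqmodP => /=.
by rewrite FracField.equivfE /FracField.mulf !numden_Ratio ?mulr1 ?oner_neq0 // mulrC.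
Qed.

Lemma tofrac_inj : injective (@tofrac R).
Proof. by move=> x y /eqP; rewrite tofrac_eq => /eqP. Qed.

Lemma regular_local_quadratic (u v : R) (z : {fraction R}) : regular_local R ->
  z ^+ 2 = tofrac u * z - tofrac v -> exists r, z = tofrac r.
Proof.
move=> regR Ez; have [a [b [b0 E]]] := fraction_repr z.
have fb0 : tofrac b != 0 :> {fraction R} by rewrite tofrac_eq0.
have [|r Er] := @regular_local_integrally_closed R a b u v regR b0.
  apply: tofrac_inj; rewrite tofracB !tofracM -!E.
  transitivity (z ^+ 2 * tofrac b ^+ 2); first by ring.
  by rewrite Ez; ring.
exists r; apply: (mulIf fb0); by rewrite E Er tofracM mulrC.
Qed.

End Fractions.

Section CanonicalForm.

(** This matrix depends on the form only, so that equality of forms becomes an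
    equation between matrices. *)
Definition upper_form (A : comNzRingType) n (q : 'M[A]_n) : 'M[A]_n :=
  \matrix_(i, j) (if (i < j)%N then q i j + q j i else if i == j then q i i else 0).

Lemma upper_formP (A : comNzRingType) n (q q' : 'M[A]_n) :
  (forall v, qform q v = qform q' v) <-> upper_form q = upper_form q'.
Proof.
rewrite qform_eqP; split=> [[Ed Es]|/matrixP E].
  apply/matrixP=> i j; rewrite !mxE Ed; have /matrixP/(_ i j) := Es.
  by rewrite !mxE => ->.
have Ed i : q i i = q' i i by have := E i i; rewrite !mxE ltnn eqxx.
have El (i j : 'I_n) : (i < j)%N -> q i j + q j i = q' i j + q' j i.
  by move=> ij; have := E i j; rewrite !mxE ij.
split=> //; apply/matrixP=> i j; rewrite !mxE; case: (ltngtP i j) => ij.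
- exact: El.
- by rewrite addrC El // addrC.
- by rewrite (val_inj ij) Ed.
Qed.

Lemma map_upper_form (A B : comNzRingType) (f : {rmorphism A -> B}) n (q : 'M[A]_n) :
  map_mx f (upper_form q) = upper_form (map_mx f q).
Proof.
apply/matrixP=> i j; rewrite !mxE; case: ifP => _; first by rewrite rmorphD.
by case: ifP => _; rewrite ?rmorph0.
Qed.

Lemma map_split_form (A B : comNzRingType) (f : {rmorphism A -> B}) n :
  map_mx f (split_form A n) = split_form B n.
Proof. by apply/matrixP=> i j; rewrite !mxE rmorph_nat. Qed.

Lemma map_isometry (A B : comNzRingType) (f : {rmorphism A -> B}) n (q q' H : 'M[A]_n) :
  (forall v, qform q (H *m v) = qform q' v) ->
  forall v, qform (map_mx f q) (map_mx f H *m v) = qform (map_mx f q') v.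
Proof.
move=> E v; rewrite qform_mulmx; move: v; apply/upper_formP.
rewrite map_trmx -!map_mxM -!map_upper_form; congr (map_mx f _).
by apply/upper_formP => v; rewrite -qform_mulmx.
Qed.

End CanonicalForm.

Section OrthogonalGroup.
Variable n : nat.

Lemma orthogonal1 (A : comNzRingType) : Defs.orthogonal (1%:M : 'M[A]_n).
Proof. by split=> [|v]; [exists 1%:M; rewrite mulmx1 | rewrite mul1mx]. Qed.

Lemma orthogonalM (A : comNzRingType) (g h : 'M[A]_n) :
  Defs.orthogonal g -> Defs.orthogonal h -> Defs.orthogonal (g *m h).
Proof.
move=> [[g' [gg g'g]] og] [[h' [hh h'h]] oh]; split=> [|v]; last by rewrite -mulmxA og oh.
exists (h' *m g'); split.
  by rewrite mulmxA -(mulmxA g) hh mulmx1.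
by rewrite mulmxA -(mulmxA h') g'g mulmx1.
Qed.

Lemma orthogonal_map (A B : comNzRingType) (f : {rmorphism A -> B}) (g : 'M[A]_n) :
  Defs.orthogonal g -> Defs.orthogonal (map_mx f g).
Proof.
move=> [[h [gh hg]] og]; split.
  by exists (map_mx f h); rewrite -!map_mxM gh hg map_mx1.
by move=> v; have := map_isometry f og v; rewrite map_split_form.
Qed.

Lemma orthogonal_inv (A : comNzRingType) (g h : 'M[A]_n) :
  Defs.orthogonal g -> g *m h = 1%:M -> Defs.orthogonal h.
Proof.
move=> [_ og] gh; have hg := mulmx1C gh; split; first by exists g.
by move=> v; rewrite -[LHS]og mulmxA gh mul1mx.
Qed.

Lemma SO_inv (A : comNzRingType) (g : 'M[A]_n) : SO g ->
  exists2 h, g *m h = 1%:M & h *m g = 1%:M.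
Proof. by move=> [[[h [gh hg]] _] _]; exists h. Qed.

End OrthogonalGroup.

Section EvenGroup.
Variable n : nat.
Hypotheses (evn : ~~ odd n) (n_gt0 : (0 < n)%N).

Local Notation inv1 g := (clifford_invariant (fun=> 1) g).

(** The stabilizer of the parity idempotent is cut out by equations in the
    entries of [g]: the values of the Clifford invariant. *)
Lemma SO_even (A : comNzRingType) (g : 'M[A]_n) :
  SO g <-> Defs.orthogonal g /\ inv1 g = parity A n./2.
Proof.
rewrite /SO (negPf evn); split=> -[og dg]; split=> //.
  have [F HF] := orthogonal_lift evn og.
  have := (dickson_kernelP evn n_gt0 og).1 dg F HF.
  by rewrite -(@clifford_invariant1 A n evn) (clifford_invariant_lift _ _ HF) mulmx1.
apply/(dickson_kernelP evn n_gt0 og) => F HF.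
by rewrite -{1}(@clifford_invariant1 A n evn) (clifford_invariant_lift _ _ HF) mulmx1.
Qed.

Lemma map_parity (A B : comNzRingType) (f : {rmorphism A -> B}) :
  map_mx f (parity A n./2) = parity B n./2.
Proof.
rewrite -(@clifford_invariant1 A n evn) clifford_invariant_map map_mx1.
rewrite -(@clifford_invariant1 B n evn).
by apply: eq_zeta => i _ /=; rewrite rmorph1.
Qed.

Lemma SO_even1 (A : comNzRingType) : SO (1%:M : 'M[A]_n).
Proof. by apply/SO_even; split; [exact: orthogonal1 | exact: clifford_invariant1]. Qed.

Lemma SO_evenM (A : comNzRingType) (g h : 'M[A]_n) : SO g -> SO h -> SO (g *m h).
Proof.
move=> /SO_even[og ig] /SO_even[oh ih]; apply/SO_even; split; first exact: orthogonalM.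
have [F HF] := orthogonal_lift evn og.
by rewrite -(clifford_invariant_lift _ _ HF) ih -[RHS]ig
  -(@clifford_invariant1 A n evn) (clifford_invariant_lift _ _ HF) mulmx1.
Qed.

Lemma SO_even_map (A B : comNzRingType) (f : {rmorphism A -> B}) (g : 'M[A]_n) :
  SO g -> SO (map_mx f g).
Proof.
move=> /SO_even[og ig]; apply/SO_even; split; first exact: orthogonal_map.
rewrite -(map_parity f) -ig clifford_invariant_map.
by apply: eq_zeta => i _ /=; rewrite rmorph1.
Qed.

End EvenGroup.

Section OddGroup.
Variable n : nat.
Hypothesis on : odd n.

Lemma SO_odd (A : comNzRingType) (g : 'M[A]_n) : SO g <-> Defs.orthogonal g /\ \det g = 1.
Proof. by rewrite /SO on. Qed.

Lemma SO_odd1 (A : comNzRingType) : SO (1%:M : 'M[A]_n).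
Proof. by apply/SO_odd; split; [exact: orthogonal1 | exact: det1]. Qed.

Lemma SO_oddM (A : comNzRingType) (g h : 'M[A]_n) : SO g -> SO h -> SO (g *m h).
Proof.
move=> /SO_odd[og dg] /SO_odd[oh dh]; apply/SO_odd; split; first exact: orthogonalM.
by rewrite det_mulmx dg dh mulr1.
Qed.

Lemma SO_odd_map (A B : comNzRingType) (f : {rmorphism A -> B}) (g : 'M[A]_n) :
  SO g -> SO (map_mx f g).
Proof.
move=> /SO_odd[og dg]; apply/SO_odd; split; first exact: orthogonal_map.
by rewrite det_map_mx dg rmorph1.
Qed.

End OddGroup.

(** A closed functor on which [G] acts simply transitively, with a point over a
    finite free extension, is a principal bundle; a point over the fraction
    field makes it generically trivial. *)
Lemma torsor_section (R : idomainType) n (G : matrix_functor n)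
  (F : forall A : comNzRingType, {rmorphism R -> A} -> 'M[A]_n -> Prop) :
  (forall A : comNzRingType, G A 1%:M) ->
  (forall (A : comNzRingType) (g h : 'M[A]_n), G A g -> G A h -> G A (g *m h)) ->
  (forall (A B : comNzRingType) (f : {rmorphism A -> B}) (g : 'M[A]_n),
     G A g -> G B (map_mx f g)) ->
  (forall (A : comNzRingType) (g : 'M[A]_n), G A g ->
     exists2 h, g *m h = 1%:M & h *m g = 1%:M) ->
  closed_functor F ->
  (forall (A : comNzRingType) (psi : {rmorphism R -> A}) (g h H : 'M[A]_n),
     F A psi H -> G A g -> g *m h = 1%:M -> F A psi (h *m H)) ->
  (forall (A : comNzRingType) (psi : {rmorphism R -> A}) (H : 'M[A]_n),
     F A psi H -> exists K, H *m K = 1%:M) ->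
  (forall (A : comNzRingType) (psi : {rmorphism R -> A}) (H H' : 'M[A]_n),
     F A psi H -> F A psi H' -> exists2 g, G A g & H = g *m H') ->
  grothendieck_serre R G ->
  (exists H, F _ (@tofrac R) H) ->
  (exists (S : comNzRingType) (phi : {rmorphism R -> S}) H, finite_free phi /\ F S phi H) ->
  exists H, F R (@idfun R) H.
Proof.
move=> G1 GM Gmap Ginv Fc Fmul Finv Ftrans gs [HK FK] [S [phi [HS [free FS]]]].
have [E [triv sec]] := torsor_action G1 GM Gmap Ginv Fc Fmul Finv Ftrans FK.
apply: sec; apply: gs; last exact: triv FK.
by exists S, phi; split; [exact: finite_free_faithfully_flat | exact: triv FS].
Qed.

(** Closed functors are cut out by matrix equations that are natural in the
    point. *)
Lemma closed_functor_eq (R : comNzRingType) n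
  (F : forall A : comNzRingType, {rmorphism R -> A} -> 'M[A]_n -> Prop)
  (P B : comNzRingType) (psi : {rmorphism R -> P}) (X : 'M[P]_n) (pi : {rmorphism P -> B}) :
  (forall p, (forall (A : comNzRingType) (f : {rmorphism P -> A}),
     F A (f \o psi) (map_mx f X) -> f p = 0) -> pi p = 0) ->
  forall k l (M N : 'M[P]_(k, l)),
  (forall (A : comNzRingType) (f : {rmorphism P -> A}),
     F A (f \o psi) (map_mx f X) -> map_mx f M = map_mx f N) ->
  map_mx pi M = map_mx pi N.
Proof.
move=> Hp k l M N HMN; apply/matrixP=> i j; rewrite !mxE; apply/eqP; rewrite -subr_eq0 -rmorphB.
apply/eqP/Hp => A f /HMN /matrixP/(_ i j); rewrite !mxE rmorphB => ->.
by rewrite subrr.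
Qed.

Lemma qformZ (A : comNzRingType) n (q : 'M[A]_n) r v : qform q (r *: v) = r ^+ 2 * qform q v.
Proof.
rewrite /qform mulr_sumr; apply: eq_bigr => i _; rewrite mulr_sumr; apply: eq_bigr => j _.
by rewrite !mxE; ring.
Qed.

Section Transporters.
Variables (R : idomainType) (n : nat) (a b : nat -> R).
Local Notation q := (block_form n a b).

(** The points of the scheme of isometries between [q] and the split form. *)
Definition isometry (A : comNzRingType) (psi : {rmorphism R -> A}) (H : 'M[A]_n) :=
  forall v, qform (split_form A n) (H *m v) = qform (map_mx psi q) v.

Lemma isometry_act (A : comNzRingType) (psi : {rmorphism R -> A}) (g H : 'M[A]_n) :
  isometry psi H -> Defs.orthogonal g -> isometry psi (g *m H).
Proof. by move=> iH [_ og] v; rewrite -mulmxA og iH. Qed.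

Lemma isometry_closed (F : forall A : comNzRingType, {rmorphism R -> A} -> 'M[A]_n -> Prop)
  (P B : comNzRingType) (psi : {rmorphism R -> P}) (X : 'M[P]_n) (pi : {rmorphism P -> B}) :
  (forall (A : comNzRingType) (phi : {rmorphism R -> A}) H, F A phi H -> isometry phi H) ->
  (forall p, (forall (A : comNzRingType) (f : {rmorphism P -> A}),
     F A (f \o psi) (map_mx f X) -> f p = 0) -> pi p = 0) ->
  isometry (pi \o psi) (map_mx pi X).
Proof.
move=> Fiso Hp v; rewrite qform_mulmx; move: v; apply/upper_formP.
have mapE (A : comNzRingType) (f : {rmorphism P -> A}) :
    map_mx f (upper_form (X^T *m split_form P n *m X)) =
    upper_form ((map_mx f X)^T *m split_form A n *m map_mx f X).
  by rewrite map_upper_form !map_mxM -map_trmx map_split_form.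
rewrite -mapE; have compE (A : comNzRingType) (f : {rmorphism P -> A}) :
    upper_form (map_mx (f \o psi) q) = map_mx f (map_mx psi (upper_form q)).
  by rewrite -map_mx_comp map_upper_form.
rewrite compE; apply: (closed_functor_eq Hp) => A f /Fiso iH.
by rewrite mapE -compE; apply/upper_formP => v; rewrite -qform_mulmx iH.
Qed.

Lemma isometry_quotient (A : comNzRingType) (psi : {rmorphism R -> A}) (H H' K : 'M[A]_n) :
  isometry psi H -> isometry psi H' -> H' *m K = 1%:M -> (exists L, H *m L = 1%:M) ->
  Defs.orthogonal (H *m K).
Proof.
move=> iH iH' HK [L HL]; have KH := mulmx1C HK; have LH := mulmx1C HL; split.
  exists (H' *m L); split; first by rewrite mulmxA -(mulmxA H) KH mulmx1.
  by rewrite mulmxA -(mulmxA H') LH mulmx1.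
by move=> v; rewrite -mulmxA iH -iH' mulmxA HK mul1mx.
Qed.

End Transporters.

Section OddCase.
Variables (R : idomainType) (n : nat) (a a' b : nat -> R) (dq : R).
Hypotheses (regR : regular_local R) (gsR : grothendieck_serre R (@SO n)) (on : odd n).
Local Notation q := (block_form n a b).
Hypothesis aa' : forall i, (i < n./2)%N -> a i * a' i = 1.
Hypothesis Hdq : half_discriminant q * dq = 1.
Hypothesis fracq : exists H : 'M_n, isometry a b (@tofrac R) H.

Lemma half_discriminant_isometry (A : comNzRingType) (psi : {rmorphism R -> A}) (H : 'M[A]_n) :
  isometry a b psi H ->
  psi (half_discriminant q) = \det H ^+ 2 * psi (half_discriminant (split_form R n)).
Proof.
move=> iH; rewrite -!half_discriminant_map // map_split_form.
by apply: half_discriminant_transfer => // v; rewrite iH.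
Qed.

(** The inverse of the determinant of an isometry over the fraction field is a
    square root of an element of [R], so it belongs to [R]. *)
Lemma odd_transporter : exists H : 'M_n, isometry a b (@idfun R) H /\ exists K, H *m K = 1%:M.
Proof.
have [HK iK] := fracq; set hq := half_discriminant q; have Hq : hq * dq = 1 by [].

pose hs := half_discriminant (split_form R n).
have EK := half_discriminant_isometry iK; rewrite -/hq -/hs in EK.
have fdq : tofrac hq * tofrac dq = 1 :> {fraction R} by rewrite -tofracM Hq tofrac1.
pose z : {fraction R} := \det HK * tofrac hs * tofrac dq.
have Hz : z * \det HK = 1.
  by rewrite /z -fdq EK; ring.
have Hz2 : z ^+ 2 = tofrac (hs * dq).
  have : z ^+ 2 * (tofrac hq * tofrac dq) = tofrac (hs * dq).
    rewrite EK tofracM; transitivity ((z * \det HK) ^+ 2 * (tofrac hs * tofrac dq)); first by ring.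
    by rewrite Hz expr1n mul1r.
  by rewrite fdq mulr1.
have [|delta Ed] := @regular_local_quadratic R 0 (- (hs * dq)) z regR.
  by rewrite Hz2 tofrac0 mul0r sub0r tofracN opprK.
have Hd2 : delta ^+ 2 * hq = hs.
  apply: tofrac_inj; rewrite tofracM tofracXn -Ed Hz2 tofracM.
  by rewrite -mulrA [tofrac dq * _]mulrC fdq mulr1.
pose F (A : comNzRingType) (psi : {rmorphism R -> A}) (H : 'M[A]_n) :=
  isometry a b psi H /\ psi delta * \det H = 1.
have Finv (A : comNzRingType) (psi : {rmorphism R -> A}) (H : 'M[A]_n) :
    F A psi H -> exists K, H *m K = 1%:M.
  by move=> [_ dH]; apply: (@det_invertible _ _ _ (psi delta)); rewrite mulrC.
have [|||||H [iH dH]] := @torsor_section R n (@SO n) F (SO_odd1 on) (SO_oddM on)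
  (SO_odd_map on) (@SO_inv n) _ _ Finv _ gsR; last first.
- by exists H; split=> //; exact: (Finv R idfun H (conj iH dH)).
- have [S [phi [H [Ff iH]]]] := split_cover b aa'; exists S, phi.
  have E := half_discriminant_isometry iH; rewrite -/hq -/hs in E.
  (* The determinant is corrected by the sign [e], as the dimension is odd. *)
  pose e := phi delta * \det H.
  have e2 : e ^+ 2 = 1.
    have pq : phi hq * phi dq = 1 by rewrite -rmorphM Hq rmorph1.
    have : e ^+ 2 * (phi hq * phi dq) = phi hq * phi dq.
      rewrite [in RHS]E -Hd2 rmorphM rmorphXn /e; ring.
    by rewrite pq mulr1.
  exists (e *: H); split=> //; split=> [v|]; first by rewrite -scalemxAl qformZ e2 mul1r iH.
  rewrite detZ mulrCA mulrC -/e -exprS; have -> : (n.+1 = 2 * n.+1./2)%N by lia.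
  by rewrite exprM e2 expr1n.
- by exists HK; split=> //; move: Hz; rewrite Ed.
- move=> A psi H H' FH FH'; have [iH dH] := FH; have [iH' dH'] := FH'.
  have [K HK'] := Finv _ _ _ FH'; exists (H *m K); last by rewrite -mulmxA (mulmx1C HK') mulmx1.
  apply/(SO_odd on); split; first exact: isometry_quotient iH iH' HK' (Finv _ _ _ FH).
  rewrite det_mulmx; have d1 : \det H' * \det K = 1 by rewrite -det_mulmx HK' det1.
  by rewrite -[\det H]mul1r -dH' -mulrA mulrACA dH mul1r d1.
- move=> A psi g h H [iH dH] Gg gh; have [og dg] := (SO_odd on g).1 Gg.
  split; first exact: isometry_act iH (orthogonal_inv og gh).
  rewrite det_mulmx mulrCA dH mulr1 -[RHS](det1 A n) -gh det_mulmx dg mul1r //.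
- move=> P B psi X pi Hp; split.
    by apply: (isometry_closed (F := F)) Hp => A phi H [].
  have : map_mx pi (psi delta * \det X)%:M = map_mx pi 1%:M :> 'M_1.
    apply: (closed_functor_eq Hp) => A f [_ E].
    by rewrite !map_scalar_mx rmorphM -det_map_mx [X in X%:M]E rmorph1.
  move=> /matrixP/(_ 0 0); rewrite !mxE eqxx !mulr1n rmorphM rmorph1 -det_map_mx.
  by [].
Qed.

End OddCase.

Section EvenCase.
Variables (R : idomainType) (n : nat) (a a' b : nat -> R) (dq D' : R).
Hypotheses (regR : regular_local R) (gsR : grothendieck_serre R (@SO n)).
Hypotheses (evn : ~~ odd n) (n_gt0 : (0 < n)%N).
Local Notation q := (block_form n a b).
Local Notation m := n./2.
Hypothesis aa' : forall i, (i < m)%N -> a i * a' i = 1.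
Hypothesis Hdq : discriminant q * dq = 1.
Hypothesis HD' : \prod_(i < m) (b i ^+ 2 - 4%:R * (a i * a (m + i)%N)) * D' = 1.
Hypothesis fracq : exists H : 'M_n, isometry a b (@tofrac R) H.

Let B := \prod_(i < m) b i.
Let N := zeta_norm a b (fun i => a (m + i)%N) m.

Lemma isometry_invertible (A : comNzRingType) (psi : {rmorphism R -> A}) (H : 'M[A]_n) :
  isometry a b psi H -> exists K, H *m K = 1%:M.
Proof.
move=> iH; have := @discriminant_transfer A n _ (map_mx psi q) H (fun v => esym (iH v)).
rewrite /discriminant map_trmx -map_mxD det_map_mx => E.
apply: (@det_invertible _ _ _ (\det H * discriminant (split_form A n) * psi dq)).
rewrite !mulrA -expr2 /discriminant -E -rmorphM.
by rewrite -[X in psi X](_ : discriminant q * dq = _) // Hdq rmorph1.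
Qed.

(** Over every base the invariant of an isometry is determined by a root of the
    same polynomial [t^2 - B t + N] over [R]. *)
Lemma isometry_invariant (A : comNzRingType) (psi : {rmorphism R -> A}) (H : 'M[A]_n) :
  isometry a b psi H ->
  exists s, clifford_invariant (psi \o b) H = s%:A + (psi B - 2%:R * s) *: parity A m /\
    s * (psi B - s) = psi N.
Proof.
move=> iH; have [K HK] := isometry_invertible iH.
have zetaE c k : psi (zeta_norm a b c k) = zeta_norm (psi \o a) (psi \o b) (psi \o c) k.
  elim: k => [|k IHk] /=; first exact: rmorph0.
  by rewrite rmorphB rmorphD !(rmorphXn, rmorphM) IHk rmorph_nat rmorph_prod.
rewrite /B /N zetaE rmorph_prod.
apply: (clifford_invariant_value evn n_gt0 HK (a := psi \o a)) => v.
by rewrite iH map_block_form.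
Qed.

(** The coefficient of the invariant of an isometry over the fraction field is
    a root of [t^2 - B t + N], so it belongs to [R]. *)
Lemma even_transporter : exists H : 'M_n, isometry a b (@idfun R) H.
Proof.
have [HK iK] := fracq; have [s [Es Hs]] := isometry_invariant iK.
have [|alpha Ea] := @regular_local_quadratic R B N s regR.
  by rewrite -Hs; ring.
have Ha : alpha * (B - alpha) = N.
  by apply: tofrac_inj; rewrite tofracM tofracB -Ea Hs.
pose beta := B - 2%:R * alpha.
have betaV : beta * (beta * D') = 1.
  have H2 : beta ^+ 2 = B ^+ 2 - 4%:R * N by rewrite -Ha /beta; ring.
  by rewrite mulrA -expr2 H2 zeta_norm_disc.
pose F (A : comNzRingType) (psi : {rmorphism R -> A}) (H : 'M[A]_n) := isometry a b psi H /\
  clifford_invariant (psi \o b) H = (psi alpha)%:A + psi beta *: parity A m.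
have Finv (A : comNzRingType) (psi : {rmorphism R -> A}) (H : 'M[A]_n) :
    F A psi H -> exists K, H *m K = 1%:M.
  by move=> [iH _]; exact: isometry_invertible iH.
have FA (A : comNzRingType) (f : {lrmorphism split_clifford A m -> split_clifford A m}) s1 t1 x :
    f (s1%:A + t1 *: x) = s1%:A + t1 *: f x.
  by rewrite linearD !linearZ /= rmorph1.
have parE (A : comNzRingType) (g : 'M[A]_n) (f : {lrmorphism split_clifford A m -> split_clifford A m}) :
    (forall v, f (split_iota v) = split_iota (g *m v)) ->
    f (parity A m) = clifford_invariant (fun=> 1) g.
  by move=> Hf; rewrite -(@clifford_invariant1 A n evn) (clifford_invariant_lift _ _ Hf) mulmx1.
have [|||||H [iH _]] := @torsor_section R n (@SO n) F (SO_even1 evn n_gt0) (SO_evenM evn n_gt0)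
  (SO_even_map evn n_gt0) (@SO_inv n) _ _ Finv _ gsR; last first.
- by exists H.
- have [S [phi [H [Ff iH]]]] := split_cover b aa'; exists S, phi.
  have [r [Er Hr]] := isometry_invariant iH.
  pose gam := phi B - 2%:R * r.
  have gam2 : gam ^+ 2 = phi (beta ^+ 2).
    transitivity (phi B ^+ 2 - 4%:R * phi N); first by rewrite -Hr /gam; ring.
    by rewrite -Ha rmorphXn /beta rmorphM !rmorphB rmorphM rmorph_nat; ring.
  have gamV : gam * (gam * phi D') = 1.
    transitivity (phi (beta * (beta * D'))); last by rewrite betaV rmorph1.
    by rewrite mulrA -expr2 gam2 -rmorphM expr2 mulrA.
  (* The two roots [r] and [phi alpha] differ by the idempotent [e] times the
     square root [gam] of the discriminant, and the reflection over [e]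
     exchanges them. *)
  pose e := (phi alpha - r) * (gam * phi D').
  have ge : gam * e = phi alpha - r by rewrite /e mulrCA gamV mulr1.
  have ee : e * e = e.
    apply/eqP; rewrite -subr_eq0; apply/eqP.
    have : gam ^+ 2 * (e * e - e) = 0.
      transitivity ((gam * e) * (gam * e - gam)); first by ring.
      rewrite ge /gam; transitivity (r * (phi B - r) - phi alpha * (phi B - phi alpha)); first by ring.
      by rewrite Hr -rmorphB -rmorphM Ha subrr.
    move=> E0; have : (gam * (gam * phi D')) * (gam * (gam * phi D')) * (e * e - e) = 0.
      by transitivity (phi D' ^+ 2 * gam ^+ 2 * (gam ^+ 2 * (e * e - e))); [ring | rewrite E0 mulr0].
    by rewrite gamV !mul1r.
  have oe := swap_mx_orthogonal evn n_gt0 ee.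
  have [f Hf] := orthogonal_lift evn oe.
  exists (swap_mx n e *m H); split=> //; split; first exact: isometry_act.
  rewrite -(clifford_invariant_lift _ _ Hf) Er FA (swap_mx_parity evn n_gt0 ee Hf).
  rewrite scalerDr !scalerA addrA -scalerDl; congr (_ *: _ + _ *: _).
    by rewrite -/gam ge addrC subrK.
  rewrite -/gam mulrBr mulr1 mulrCA ge /gam /beta rmorphB rmorphM rmorph_nat; ring.
- by exists HK; split=> //; rewrite Es Ea /beta rmorphB rmorphM rmorph_nat.
- move=> A psi H H' FH FH'; have [iH cH] := FH; have [iH' cH'] := FH'.
  have [K HK'] := Finv _ _ _ FH'.
  have oHK := isometry_quotient iH iH' HK' (Finv _ _ _ FH).
  exists (H *m K); last by rewrite -mulmxA (mulmx1C HK') mulmx1.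
  apply/(SO_even evn n_gt0); split=> //.
  have [f Hf] := orthogonal_lift evn oHK; rewrite -(parE _ _ _ Hf).
  have : f (clifford_invariant (psi \o b) H') = clifford_invariant (psi \o b) H.
    by rewrite (clifford_invariant_lift _ _ Hf) -mulmxA (mulmx1C HK') mulmx1.
  rewrite cH cH' FA => /addrI /(congr1 (fun x => psi (beta * D') *: x)).
  by rewrite !scalerA -!rmorphM [_ * beta]mulrC betaV rmorph1 !scale1r.
- move=> A psi g h H [iH cH] Gg gh; have [og ig] := (SO_even evn n_gt0 g).1 Gg.
  have oh := orthogonal_inv og gh; split; first exact: isometry_act iH oh.
  have [f Hf] := orthogonal_lift evn oh.
  rewrite -(clifford_invariant_lift _ _ Hf) cH FA; congr (_ + _ *: _).
  by rewrite -{1}ig (clifford_invariant_lift _ _ Hf) (mulmx1C gh) clifford_invariant1.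
- move=> P C psi X pi Hp; split.
    by apply: (isometry_closed (F := F)) Hp => A phi H [].
  have mapE (A : comNzRingType) (f : {rmorphism P -> A}) s1 t1 :
      map_mx f (s1%:A + t1 *: parity P m) = (f s1)%:A + f t1 *: parity A m.
    by rewrite map_mxD !map_mxZ map_mx1 map_parity.
  have := clifford_invariant_map pi (psi \o b) X.
  rewrite -[RHS]/(clifford_invariant ((pi \o psi) \o b) (map_mx pi X)) => <-.
  rewrite -(mapE _ pi (psi alpha) (psi beta)).
  apply: (closed_functor_eq Hp) => A f [_ E].
  by rewrite clifford_invariant_map mapE.
Qed.

End EvenCase.

Lemma invertible_unitmx (A : comUnitRingType) n (P : 'M[A]_n) :
  invertible_mx P -> P \in unitmx.
Proof. by move=> [P' HP]; case: (mulmx1_unit HP). Qed.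

Theorem theorem4 (R : idomainType) (n : nat)
  (regR : regular_local R)
  (gsR : grothendieck_serre R (@SO n))
  (q : 'M[R]_n)
  (discq : (if odd n then half_discriminant q else discriminant q)
             \is a GRing.unit)
  (fracq : takes_to (map_mx (@tofrac R) q) (split_form {fraction R} n)) :
  takes_to q (split_form R n).
Proof.
have [n0|n_gt0] := posnP n.
  exists 1%:M; first exact: unitmx1.
  by move=> v; rewrite /qform !big1 // => -[i ni]; exfalso; rewrite n0 in ni.
have [noethR [M [locM _]]] := regR.
have nMq : ~ M (form_disc q) by exact: (not_mem_unit noethR locM (mulrV discq)).
have [P [a [b [HP E Ha HD]]]] := block_decomposition noethR locM nMq.
have [dq Hdq] := local_unit noethR locM
  (form_disc_transfer noethR locM HP (fun v => esym (E v)) nMq).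
have /choice[a' aa'] : forall i, exists x, (i < n./2)%N -> a i * x = 1.
  move=> i.
  case: (ltnP i n./2) => im; last by exists 0.
  by have [x Hx] := local_unit noethR locM (Ha i im); exists x.
have fracq' : exists H : 'M_n, isometry a b (@tofrac R) H.
  have [g ug Hg] := fracq; exists (invmx g *m map_mx (@tofrac R) P) => v.
  have := map_isometry (@tofrac R) (q' := block_form n a b) E v.
  by rewrite -Hg !mulmxA mulmxV // mul1mx.
have [H iH [K HK]] : exists2 H : 'M_n, isometry a b (@idfun R) H & exists K, H *m K = 1%:M.
  rewrite /form_disc in Hdq; case on : (odd n) Hdq => Hdq.
    have [H [iH HK]] := odd_transporter regR gsR on aa' Hdq fracq'.
    by exists H.
  have evn : ~~ odd n by rewrite on.
  have prM := local_prime noethR locM.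
  have [D' HD'] : exists D', \prod_(i < n./2) (b i ^+ 2 - 4%:R * (a i * a (n./2 + i)%N)) * D' = 1.
    apply: (local_unit noethR locM); apply: (big_ind (fun x => ~ M x)) => [|x y|i _].
    - exact: prime_not1.
    - exact: prime_notM.
    - exact: (HD i (ltn_ord i)).
  have [H iH] := even_transporter regR gsR evn n_gt0 aa' Hdq HD' fracq'.
  by exists H => //; exact: (isometry_invertible Hdq iH).
exists (P *m K).
  apply: invertible_unitmx; apply: invertible_mxM => //.
  by exists H; exact: mulmx1C.
move=> v; rewrite -mulmxA E.
have := iH (K *m v); rewrite mulmxA HK mul1mx => ->.
by congr qform; apply/matrixP=> i j; rewrite [RHS]mxE.
Qed.
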